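(* Let $f(x,y)=4y^3-3y(x^4-12x^3+14x^2+12x+1)+(x^2+1)(x^4-18x^3+74x^2+18x+1)$, let $(a,b,c)\in\mathbb{C}^3$, and let $B\subset\mathbb{P}^2$ be the plane sextic given by the affine equation $f(x,y^2+ax^2+bx+c)=0$. Let $t_\pm=-\frac12\mp\frac12\sqrt5$, $t'_\pm=2\pm\sqrt5$, $\epsilon_\pm=\frac{-3\pm\sqrt5}{2}$. To each set of singularities $\Sigma$ below attach the following condition $C(\Sigma)$ on $(a,b,c)$: - $C(4\mathbf{A}_4)$: no condition. - $C(\mathbf{A}_9\oplus2\mathbf{A}_4)$: $c=\frac12$ or $a=\frac12$. - $C(2\mathbf{A}_9)$: $a=c=\frac12$. - $C(\mathbf{Y}^1_{1,1}\oplus2\mathbf{A}_4)$: $(c,b)=(\frac12,3)$ or $(a,b)=(\frac12,-3)$. - $C(\mathbf{Y}^1_{1,1}\oplus\mathbf{A}_9)$: $a=c=\frac12$ and $b=\pm3$. - $C(\mathbf{W}_{12}\oplus2\mathbf{A}_4)$: $(a,b,c)=(-\frac{11}2,3,\frac12)$ or $(a,b,c)=(\frac12,-3,-\frac{11}2)$. - $C(4\mathbf{A}_4\oplus\mathbf{A}_1)$: either there is $t\in\mathbb{C}\smallsetminus\{0,\pm1,t_+,t_-\}$ such that $$a=\frac{-b(t^3+2t^2-1)+t^5-5t^3-5t^2-3}{2t^2(t-1)(t^2+t-1)},\qquad c=-\frac{bt^2(t^3-2t+1)+3t^5+5t^3-5t^2+1}{2(t+1)(t^2+t-1)},\qquad(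 * )$$ or $(b,c)=(-6,-1)$, or $(a,b)=(-1,6)$. - $C(\mathbf{A}_9\oplus2\mathbf{A}_4\oplus\mathbf{A}_1)$: either for some $t\in\mathbb{C}\smallsetminus\{0,1,t_+,t_-\}$ $$a=\frac{t^4-t^3-2t^2+3t+11}{2(t-1)^2(t^2+t-1)},\quad b=-\frac{3(t^3+2t-1)}{(t-1)(t^2+t-1)},\quad c=\frac12,$$ or for some $t\in\mathbb{C}\smallsetminus\{0,-1,t_+,t_-\}$ $$a=\frac12,\quad b=-\frac{3(t^3+2t^2+1)}{(t+1)(t^2+t-1)},\quad c=-\frac{11t^4-3t^3-2t^2+t+1}{2(t+1)^2(t^2+t-1)}.$$ - $C(4\mathbf{A}_4\oplus2\mathbf{A}_1)$: for some choice of sign $\pm$ (with $\mp$ the opposite sign) and some $t\in\mathbb{C}\smallsetminus\{0,\pm1,t_+,t_-,t'_\pm\}$ one has $$b=-\frac{3(t^2+(3\epsilon_\mp+1)t-\epsilon_\mp)(t^2-\epsilon_\pm t-\epsilon_\mp)(t+t_\pm)}{(t-t_\pm)(t-t_\mp)^2(t-t'_\pm)^2}$$ and $a$, $c$ are given by $( * )$ with these $b$ and $t$. - $C(4\mathbf{A}_4\oplus\mathbf{A}_2)$: for some $t\in\mathbb{C}\smallsetminus\{0,t_+,t_-\}$ $$a=\frac{t^6+3t^5-5t^3+12t+11}{2(t^2+t-1)^3},\quad b=-\frac{3(t^2+1)(t^4+3t^3-t^2-3t+1)}{(t^2+t-1)^3},\quad c=-\frac{11t^6-12t^5+5t^3-3t+1}{2(t^2+t-1)^3}.$$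 - $C(\mathbf{A}_9\oplus2\mathbf{A}_4\oplus\mathbf{A}_2)$: $(a,b,c)=(\frac{3077}{10},\frac{177}5,\frac12)$ or $(a,b,c)=(\frac12,-\frac{177}5,\frac{3077}{10})$. Then $B$ has set of singularities $\Sigma$ if and only if $(a,b,c)$ satisfies $C(\Sigma)$ but does not satisfy $C(\Sigma')$ for any immediate degeneration $\Sigma'$ of $\Sigma$, where the immediate degenerations are: $4\mathbf{A}_4$: $\mathbf{A}_9\oplus2\mathbf{A}_4$ and $4\mathbf{A}_4\oplus\mathbf{A}_1$; $\mathbf{A}_9\oplus2\mathbf{A}_4$: $2\mathbf{A}_9$, $\mathbf{Y}^1_{1,1}\oplus2\mathbf{A}_4$ and $\mathbf{A}_9\oplus2\mathbf{A}_4\oplus\mathbf{A}_1$; $2\mathbf{A}_9$: $\mathbf{Y}^1_{1,1}\oplus\mathbf{A}_9$; $\mathbf{Y}^1_{1,1}\oplus2\mathbf{A}_4$: $\mathbf{W}_{12}\oplus2\mathbf{A}_4$ and $\mathbf{Y}^1_{1,1}\oplus\mathbf{A}_9$; $4\mathbf{A}_4\oplus\mathbf{A}_1$: $4\mathbf{A}_4\oplus2\mathbf{A}_1$, $4\mathbf{A}_4\oplus\mathbf{A}_2$ and $\mathbf{A}_9\oplus2\mathbf{A}_4\oplus\mathbf{A}_1$; $4\mathbf{A}_4\oplus\mathbf{A}_2$ and $\mathbf{A}_9\oplus2\mathbf{A}_4\oplus\mathbf{A}_1$: $\mathbf{A}_9\oplus2\mathbf{A}_4\oplus\mathbf{A}_2$;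 the remaining sets have none.
   Context: All varieties are over $\mathbb{C}$. The sextic $B$ is the projective closure in $\mathbb{P}^2$ of the affine curve in the chart $\mathbb{C}^2$ with coordinates $(x,y)$. A set of singularities lists the types, with multiplicities, of all singular points of $B$. $\mathbf{A}_p$ are the usual simple singularities; in Arnol'd's notation, $\mathbf{Y}^1_{1,1}$ is the quadruple point that is a transversal intersection of two cusps (two type $\mathbf{A}_2$ branches with distinct tangents), and $\mathbf{W}_{12}$ is the semiquasihomogeneous singularity of type $(4,5)$. *)

(* Defs.v *)
From HB Require Import structures.
From mathcomp Require Import all_boot all_order all_algebra.
From mathcomp Require Import mpoly.

Set Implicit Arguments.
Unset Strict Implicit.
Unset Printing Implicit Defensive.

Import Order.TTheory GRing.Theory Num.Theory.
Local Open Scope ring_scope.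

(** * Convergent power series in two variables

    [s i j] is the coefficient of [x^i y^j]. Everything is stated over a
    [numClosedFieldType] [K]; the intended instance is [R[i]] with
    [R : realType]. *)

Definition series (K : Type) := nat -> nat -> K.

(* Convergence in some polydisc around the origin (Cauchy estimates); the
   inequalities force [M], and [r] unless [M = 0], to be nonnegative reals. *)
Definition convergent {K : numClosedFieldType} (s : series K) : Prop :=
  exists M r : K, forall i j, `|s i j| <= M * r ^+ (i + j).

Definition series_one {K : numClosedFieldType} : series K :=
  fun i j => ((i == 0) && (j == 0))%N%:R.

Definition series_add {K : numClosedFieldType} (s t : series K) : series K :=
  fun i j => s i j + t i j.

Definition series_mul {K : numClosedFieldType} (s t : series K) : series K :=
  fun i j => \sum_(k < i.+1) \sum_(l < j.+1) s k l * t (i - k)%N (j - l)%N.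

Definition series_exp {K : numClosedFieldType} (s : series K) (n : nat) :
    series K :=
  iter n (series_mul s) series_one.

(* [h(X, Y)], for [X] and [Y] without constant term: [X^k Y^l] then has order
   at least [k + l], so only [k, l <= i + j] contribute to the coefficient of
   [x^i y^j]. *)
Definition series_comp {K : numClosedFieldType} (h X Y : series K) : series K :=
  fun i j => \sum_(k < (i + j).+1) \sum_(l < (i + j).+1)
    h k l * series_mul (series_exp X k) (series_exp Y l) i j.

Definition series_unit {K : numClosedFieldType} (u : series K) : Prop :=
  convergent u /\ u 0%N 0%N != 0.

(* [(X, Y)] is a system of local analytic coordinates at the origin. *)
Definition local_coordinates {K : numClosedFieldType} (X Y : series K) : Prop :=
  [/\ convergent X, convergent Y, X 0%N 0%N = 0, Y 0%N 0%N = 0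
    & X 1%N 0%N * Y 0%N 1%N - X 0%N 1%N * Y 1%N 0%N != 0].

(** * Types of plane curve singularities

    The predicates below are about the curve germ [g = 0] at the origin. *)

(* A_p : [X^2 + Y^(p+1) = 0] in suitable local coordinates. *)
Definition germ_A {K : numClosedFieldType} (p : nat) (g : series K) : Prop :=
  exists X Y u : series K,
    [/\ local_coordinates X Y, series_unit u
      & g =2 series_mul u (series_add (series_exp X 2) (series_exp Y p.+1))].

(* The quadratic part of [g] is the square of [al x + be y], i.e., [g = 0] is a
   double point whose only tangent is the line [al x + be y = 0]. *)
Definition double_tangent {K : numClosedFieldType} (g : series K) (al be : K) :
    Prop :=
  [/\ g 2%N 0%N = al ^+ 2, g 1%N 1%N = 2 * al * be & g 0%N 2%N = be ^+ 2].

(* Y^1_{1,1} : the union of two cusps with distinct tangents. *)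
Definition germ_Y11 {K : numClosedFieldType} (g : series K) : Prop :=
  exists g1 g2 : series K,
    [/\ g =2 series_mul g1 g2, germ_A 2 g1, germ_A 2 g2
      & exists al1 be1 al2 be2 : K,
          [/\ double_tangent g1 al1 be1, double_tangent g2 al2 be2
            & al1 * be2 - al2 * be1 != 0]].

(* W_12 : in suitable local coordinates the equation is semiquasihomogeneous of
   type (4, 5). The only monomials [X^k Y^l] with [k / 4 + l / 5 = 1] are [X^4]
   and [Y^5], so the principal part is nondegenerate iff both of them occur. *)
Definition semiquasihomogeneous_4_5 {K : numClosedFieldType} (h : series K) :
    Prop :=
  [/\ forall k l, (5 * k + 4 * l < 20)%N -> h k l = 0,
      h 4%N 0%N != 0 & h 0%N 5%N != 0].

Definition germ_W12 {K : numClosedFieldType} (g : series K) : Prop :=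
  exists X Y h : series K,
    [/\ local_coordinates X Y, convergent h, semiquasihomogeneous_4_5 h
      & g =2 series_comp h X Y].

Inductive singularity := A of nat | Y11 | W12.

Definition germ_type {K : numClosedFieldType} (T : singularity) (g : series K) :
    Prop :=
  match T with
  | A p => germ_A p g
  | Y11 => germ_Y11 g
  | W12 => germ_W12 g
  end.

(** * Plane projective curves

    A curve is given by a form [F : {mpoly K[3]}]. A point of the projective
    plane is a nonzero row vector [v : 'rV_3] of homogeneous coordinates; two
    vectors represent the same point iff they span the same line, which is
    [(v == w)%MS]. *)

(* Projective closure of the affine curve [p = 0]: the homogenization of [p]
   in degree [deg p = (msize p).-1]; the last coordinate is the new one. *)
Definition homogenization {K : numClosedFieldType} (p : {mpoly K[2]}) :
    {mpoly K[3]} :=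
  \sum_(m <- msupp p)
    p@_m *: 'X_[[multinom [tuple m 0; m 1; ((msize p).-1 - mdeg m)%N]]].

Definition singular_point {K : numClosedFieldType} (F : {mpoly K[3]})
    (v : 'rV[K]_3) : Prop :=
  [/\ v != 0, F.@[v 0] = 0 & forall k : 'I_3, (F^`M(k)).@[v 0] = 0].

(* Equation of the curve in the affine chart where the [i]-th homogeneous
   coordinate is 1, translated so that [v] (with [v 0 i != 0]) is the origin. *)
Definition local_equation {K : numClosedFieldType} (F : {mpoly K[3]})
    (i : 'I_3) (v : 'rV[K]_3) : {mpoly K[2]} :=
  F \mPo [tuple (v 0 k / v 0 i)%:MP + (if unlift i k is Some j then 'X_j else 0)
         | k < 3].

Definition germ_of {K : numClosedFieldType} (p : {mpoly K[2]}) : series K :=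
  fun i j => p@_[multinom [tuple i; j]].

Definition point_type {K : numClosedFieldType} (F : {mpoly K[3]})
    (v : 'rV[K]_3) (T : singularity) : Prop :=
  exists2 i : 'I_3, v 0 i != 0 & germ_type T (germ_of (local_equation F i v)).

(* [P] lists all singular points of [F], each exactly once, and the types of
   its entries are listed by [Sigma]. *)
Definition has_set_of_singularities {K : numClosedFieldType}
    (F : {mpoly K[3]}) (Sigma : seq singularity) : Prop :=
  exists P : seq 'rV[K]_3,
    [/\ size P = size Sigma,
        pairwise (fun v w => ~~ (v == w)%MS) P,
        forall v, v \in P -> singular_point F v,
        forall v, singular_point F v -> has (fun w => (v == w)%MS) P
      & forall n, (n < size P)%N ->
          point_type F (nth 0 P n) (nth Y11 Sigma n)].

(** * The family of sextics *)

Definition trigonal {K : numClosedFieldType} : {mpoly K[2]} :=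
  let x := 'X_0 in let y := 'X_1 in
  4 * y ^+ 3 - 3 * y * (x ^+ 4 - 12 * x ^+ 3 + 14 * x ^+ 2 + 12 * x + 1)
  + (x ^+ 2 + 1) * (x ^+ 4 - 18 * x ^+ 3 + 74 * x ^+ 2 + 18 * x + 1).

Definition sextic {K : numClosedFieldType} (a b c : K) : {mpoly K[3]} :=
  homogenization
    (trigonal \mPo
       [tuple 'X_0; 'X_1 ^+ 2 + a *: 'X_0 ^+ 2 + b *: 'X_0 + c%:MP]).

(** * The strata and their equations *)

Inductive stratum :=
  | S_4A4 | S_A9_2A4 | S_2A9 | S_Y11_2A4 | S_Y11_A9 | S_W12_2A4
  | S_4A4_A1 | S_A9_2A4_A1 | S_4A4_2A1 | S_4A4_A2 | S_A9_2A4_A2.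

Definition singularities (S : stratum) : seq singularity :=
  match S with
  | S_4A4       => nseq 4 (A 4)
  | S_A9_2A4    => A 9 :: nseq 2 (A 4)
  | S_2A9       => nseq 2 (A 9)
  | S_Y11_2A4   => Y11 :: nseq 2 (A 4)
  | S_Y11_A9    => [:: Y11; A 9]
  | S_W12_2A4   => W12 :: nseq 2 (A 4)
  | S_4A4_A1    => rcons (nseq 4 (A 4)) (A 1)
  | S_A9_2A4_A1 => A 9 :: rcons (nseq 2 (A 4)) (A 1)
  | S_4A4_2A1   => nseq 4 (A 4) ++ nseq 2 (A 1)
  | S_4A4_A2    => rcons (nseq 4 (A 4)) (A 2)
  | S_A9_2A4_A2 => A 9 :: rcons (nseq 2 (A 4)) (A 2)
  end.

Definition immediate_degeneration (S S' : stratum) : bool :=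
  match S, S' with
  | S_4A4,       (S_A9_2A4 | S_4A4_A1)
  | S_A9_2A4,    (S_2A9 | S_Y11_2A4 | S_A9_2A4_A1)
  | S_2A9,       S_Y11_A9
  | S_Y11_2A4,   (S_W12_2A4 | S_Y11_A9)
  | S_4A4_A1,    (S_4A4_2A1 | S_4A4_A2 | S_A9_2A4_A1)
  | S_4A4_A2,    S_A9_2A4_A2
  | S_A9_2A4_A1, S_A9_2A4_A2 => true
  | _, _ => false
  end.

(* A sign is an [s : K] with [s = 1 \/ s = -1]: [t_ s], [t'_ s] and [eps s] are
   the constants with the upper subscript for [s = 1] and with the lower one
   for [s = -1], so that the opposite subscript is obtained from [- s]. *)
Definition t_ {K : numClosedFieldType} (s : K) : K :=
  - (1 / 2) - s * (sqrtC 5 / 2).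

Definition t'_ {K : numClosedFieldType} (s : K) : K := 2 + s * sqrtC 5.

Definition eps {K : numClosedFieldType} (s : K) : K := (- 3 + s * sqrtC 5) / 2.

Definition star_a {K : numClosedFieldType} (b t : K) : K :=
  (- b * (t ^+ 3 + 2 * t ^+ 2 - 1) + t ^+ 5 - 5 * t ^+ 3 - 5 * t ^+ 2 - 3)
  / (2 * t ^+ 2 * (t - 1) * (t ^+ 2 + t - 1)).

Definition star_c {K : numClosedFieldType} (b t : K) : K :=
  - ((b * t ^+ 2 * (t ^+ 3 - 2 * t + 1)
      + 3 * t ^+ 5 + 5 * t ^+ 3 - 5 * t ^+ 2 + 1)
     / (2 * (t + 1) * (t ^+ 2 + t - 1))).

Definition cond_A9_2A4_A1 {K : numClosedFieldType} (a b c : K) : Prop :=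
  (exists t : K,
     [/\ t \notin [:: 0; 1; t_ 1; t_ (-1)],
         a = (t ^+ 4 - t ^+ 3 - 2 * t ^+ 2 + 3 * t + 11)
             / (2 * (t - 1) ^+ 2 * (t ^+ 2 + t - 1)),
         b = - (3 * (t ^+ 3 + 2 * t - 1) / ((t - 1) * (t ^+ 2 + t - 1)))
       & c = 1 / 2])
  \/
  (exists t : K,
     [/\ t \notin [:: 0; -1; t_ 1; t_ (-1)],
         a = 1 / 2,
         b = - (3 * (t ^+ 3 + 2 * t ^+ 2 + 1) / ((t + 1) * (t ^+ 2 + t - 1)))
       & c = - ((11 * t ^+ 4 - 3 * t ^+ 3 - 2 * t ^+ 2 + t + 1)
                / (2 * (t + 1) ^+ 2 * (t ^+ 2 + t - 1)))]).

Definition cond_4A4_2A1 {K : numClosedFieldType} (a b c : K) : Prop :=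
  exists s t : K,
    [/\ s = 1 \/ s = -1,
        t \notin [:: 0; 1; -1; t_ 1; t_ (-1); t'_ s],
        b = - (3 * (t ^+ 2 + (3 * eps (- s) + 1) * t - eps (- s))
                 * (t ^+ 2 - eps s * t - eps (- s)) * (t + t_ s)
               / ((t - t_ s) * (t - t_ (- s)) ^+ 2 * (t - t'_ s) ^+ 2)),
        a = star_a b t
      & c = star_c b t].

Definition cond_4A4_A2 {K : numClosedFieldType} (a b c : K) : Prop :=
  exists t : K,
    [/\ t \notin [:: 0; t_ 1; t_ (-1)],
        a = (t ^+ 6 + 3 * t ^+ 5 - 5 * t ^+ 3 + 12 * t + 11)
            / (2 * (t ^+ 2 + t - 1) ^+ 3),
        b = - (3 * (t ^+ 2 + 1) * (t ^+ 4 + 3 * t ^+ 3 - t ^+ 2 - 3 * t + 1)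
               / (t ^+ 2 + t - 1) ^+ 3)
      & c = - ((11 * t ^+ 6 - 12 * t ^+ 5 + 5 * t ^+ 3 - 3 * t + 1)
               / (2 * (t ^+ 2 + t - 1) ^+ 3))].

Definition cond {K : numClosedFieldType} (S : stratum) (a b c : K) : Prop :=
  match S with
  | S_4A4 => True
  | S_A9_2A4 => c = 1 / 2 \/ a = 1 / 2
  | S_2A9 => a = 1 / 2 /\ c = 1 / 2
  | S_Y11_2A4 => (c = 1 / 2 /\ b = 3) \/ (a = 1 / 2 /\ b = - 3)
  | S_Y11_A9 => [/\ a = 1 / 2, c = 1 / 2 & b = 3 \/ b = - 3]
  | S_W12_2A4 =>
      [/\ a = - (11 / 2), b = 3 & c = 1 / 2]
      \/ [/\ a = 1 / 2, b = - 3 & c = - (11 / 2)]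
  | S_4A4_A1 =>
      [\/ exists t : K, [/\ t \notin [:: 0; 1; -1; t_ 1; t_ (-1)],
                            a = star_a b t & c = star_c b t],
          b = - 6 /\ c = - 1
        | a = - 1 /\ b = 6]
  | S_A9_2A4_A1 => cond_A9_2A4_A1 a b c
  | S_4A4_2A1 => cond_4A4_2A1 a b c
  | S_4A4_A2 => cond_4A4_A2 a b c
  | S_A9_2A4_A2 =>
      [/\ a = 3077 / 10, b = 177 / 5 & c = 1 / 2]
      \/ [/\ a = 1 / 2, b = - (177 / 5) & c = 3077 / 10]
  end.

(* Main.v *)
Require Import Defs.
From mathcomp Require Import all_boot all_order all_algebra.
From mathcomp Require Import complex reals.
From HB Require Import structures.
From mathcomp Require Import boolp ring mpoly.

Set Implicit Arguments.
Unset Strict Implicit.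
Unset Printing Implicit Defensive.

Import Order.TTheory GRing.Theory Num.Theory.
Local Open Scope ring_scope.

(* The sextic is the pull-back of the rational trigonal curve [f(x, Y) = 0] under
   the double covering [Y = y^2 + s(x)] ramified over the section [Y = s(x)],
   where [s = a x^2 + b x + c]. The trigonal curve has the parametrization
   [x = t^2 (t - 1) / (t + 1)], and on it [Y - s(x)] becomes a polynomial [N] of
   degree 6 in [t] divided by [(t + 1)^2]. The curve has A_4 points over [x = 0]
   and [x = oo], i.e., at [t = 0] and [t = oo]; each lifts to two A_4 points of
   the sextic unless the section passes through it, in which case the order of
   [N] there (2, 4 or 5) decides between A_9, Y^1_{1,1} and W_12. The other
   singular points come from the roots [t <> 0] of [N] of multiplicity 2 (A_1) and
   3 (A_2). Two such roots force [N] to be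
   [A (t^2 + p t - p^2)^2 (t^2 - 2 (1 + p) t - p)], which yields the double
   tangency family and excludes a third root. The symmetry
   [t -> -1/t, (a, b, c) -> (c, -b, a)] exchanges the two A_4 points.

   To see that a sextic has only one set of singularities, the types are told
   apart by the contact orders of lines through the point; analytic coordinates
   are obtained from inverses and roots of convergent series, which exist by
   the differential equation [u E(w) = al w E(u)] of the powers [w = u^al]. *)

(** * The ring of power series *)

(** Every normal form is reached through an explicit ring identity (a completed square, a splitting
    into two cusps), so that all of the analysis reduces to inverses and roots of unit series. The
    open strata are shown to cover the parameter space, and each to have its list of types. The
    converse then amounts to one sextic not having the lists of two strata. The obstacle there is
    that a type is asserted for some representative vector and in some chart; the separating
    invariants must be independent of both, and are therefore contact orders in homogeneous
    coordinates. The constants [3] and [- (11 / 2)] come from the parabola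
    [Y = (1 + 6 x - 11 x^2) / 2], which osculates the trigonal curve at its A_4 point over [x = 0]:
    the section passes through that point if [c = 1 / 2], is tangent to the parabola there if also
    [b = 3], and equals it if also [a = - (11 / 2)]. The golden constants have two sources: the
    projection to [x] ramifies where [t^2 + t - 1 = 0], and two tangency parameters satisfy
    [t1 t2 = - (t1 + t2)^2], so that they are [p h] with [h^2 + h - 1 = 0]. *)

Definition pser (K : numClosedFieldType) : Type := series K.

HB.instance Definition _ (K : numClosedFieldType) := gen_eqMixin (pser K).
HB.instance Definition _ (K : numClosedFieldType) := gen_choiceMixin (pser K).

Section SeriesRing.
Variable K : numClosedFieldType.
Implicit Types s t u : series K.

Lemma series_ext (s t : pser K) : s =2 t -> s = t.
Proof. by move=> e; apply/funext => i; apply/funext => j. Qed.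

(** A coefficient of a product involves only coefficients of smaller or equal indices, so the ring
    laws for series can be read off from polynomials that agree with them far enough. *)
Definition truncation (N : nat) s : {poly {poly K}} :=
  \poly_(i < N) \poly_(j < N) s i j.

Lemma coef_truncation N s i j : (i < N)%N -> (j < N)%N ->
  (truncation N s)`_i`_j = s i j.
Proof. by move=> iN jN; rewrite !coef_poly iN coef_poly jN. Qed.

Lemma coef2M (p q : {poly {poly K}}) i j :
  (p * q)`_i`_j = \sum_(k < i.+1) \sum_(l < j.+1) p`_k`_l * q`_(i - k)`_(j - l).
Proof.
by rewrite coefM coef_sum; apply: eq_bigr => k _; rewrite coefM.
Qed.

Lemma series_mul_truncation N s t i j : (i < N)%N -> (j < N)%N ->
  series_mul s t i j = (truncation N s * truncation N t)`_i`_j.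
Proof.
move=> iN jN; rewrite coef2M; apply: eq_bigr => k _; apply: eq_bigr => l _.
rewrite !coef_truncation //.
- exact: leq_ltn_trans (leq_subr _ _) iN.
- exact: leq_ltn_trans (leq_subr _ _) jN.
- by apply: leq_ltn_trans iN; rewrite -ltnS.
- by apply: leq_ltn_trans jN; rewrite -ltnS.
Qed.

Lemma eq_coef2M (p p' q : {poly {poly K}}) i j :
  (forall k l, (k <= i)%N -> (l <= j)%N -> p`_k`_l = p'`_k`_l) ->
  (p * q)`_i`_j = (p' * q)`_i`_j.
Proof.
move=> e; rewrite !coef2M; apply: eq_bigr => k _; apply: eq_bigr => l _.
by rewrite e // -ltnS.
Qed.

Lemma series_mulC : commutative (@series_mul K).
Proof.
move=> s t; apply: series_ext => i j; pose N := (maxn i j).+1.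
rewrite !(@series_mul_truncation N) ?ltnS ?leq_maxl ?leq_maxr //.
by rewrite mulrC.
Qed.

Lemma series_mulA : associative (@series_mul K).
Proof.
move=> s t u; apply: series_ext => i j; pose N := (maxn i j).+1.
have iN : (i < N)%N by rewrite ltnS leq_maxl.
have jN : (j < N)%N by rewrite ltnS leq_maxr.
rewrite !(@series_mul_truncation N) //.
rewrite [truncation N s * _]mulrC.
(* The truncation of a product is not the product of the truncations, but both agree at indices
   below [N], which is all that the coefficient at [(i, j)] sees. *)
rewrite (@eq_coef2M (truncation N (series_mul t u)) (truncation N t * truncation N u)); last first.
  move=> k l ki lj.
  have [kN lN] := (leq_ltn_trans ki iN, leq_ltn_trans lj jN).
  by rewrite coef_truncation // (@series_mul_truncation N).
rewrite [_ * truncation N s]mulrC mulrA; apply/esym/eq_coef2M => k l ki lj.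
have [kN lN] := (leq_ltn_trans ki iN, leq_ltn_trans lj jN).
by rewrite coef_truncation // (@series_mul_truncation N).
Qed.

Lemma series_mul1 : left_id (@series_one K) (@series_mul K).
Proof.
move=> s; apply: series_ext => i j.
rewrite /series_mul (bigD1 ord0) //= (bigD1 ord0) //= !subn0.
rewrite /series_one /= mul1r !big1 ?addr0 //.
  by move=> k k0; rewrite big1 // => l _; rewrite -val_eqE /= in k0;
    rewrite (negPf k0) mul0r.
by move=> l l0; rewrite -val_eqE /= in l0; rewrite (negPf l0) mul0r.
Qed.

Lemma series_mulDl : left_distributive (@series_mul K) (@series_add K).
Proof.
move=> s t u; apply: series_ext => i j.
rewrite /series_mul /series_add -big_split /=; apply: eq_bigr => k _.
by rewrite -big_split /=; apply: eq_bigr => l _; rewrite mulrDl.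
Qed.

Definition series_zero : series K := fun _ _ => 0.
Definition series_opp s : series K := fun i j => - s i j.

Lemma series_addA : associative (@series_add K).
Proof. by move=> s t u; apply: series_ext => i j; exact: addrA. Qed.
Lemma series_addC : commutative (@series_add K).
Proof. by move=> s t; apply: series_ext => i j; exact: addrC. Qed.
Lemma series_add0 : left_id series_zero (@series_add K).
Proof. by move=> s; apply: series_ext => i j; exact: add0r. Qed.
Lemma series_addN : left_inverse series_zero series_opp (@series_add K).
Proof. by move=> s; apply: series_ext => i j; exact: addNr. Qed.

HB.instance Definition _ := GRing.isZmodule.Build (pser K)
  series_addA series_addC series_add0 series_addN.

Lemma series_one_neq0 : (@series_one K : pser K) != 0.
Proof.
apply/eqP => /(congr1 (fun s : series K => s 0%N 0%N)) /eqP.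
by rewrite /series_one /= oner_eq0.
Qed.

HB.instance Definition _ := GRing.Zmodule_isComNzRing.Build (pser K)
  series_mulA series_mulC series_mul1 series_mulDl series_one_neq0.

End SeriesRing.

Section SeriesTheory.
Variable K : numClosedFieldType.
Implicit Types s t u w : pser K.

Lemma pserD s t i j : (s + t) i j = s i j + t i j. Proof. by []. Qed.
Lemma pserN s i j : (- s) i j = - s i j. Proof. by []. Qed.
Lemma pserB s t i j : (s - t) i j = s i j - t i j. Proof. by []. Qed.
Lemma pser0 i j : (0 : pser K) i j = 0. Proof. by []. Qed.
Lemma pser1 i j : (1 : pser K) i j = ((i == 0) && (j == 0))%N%:R.
Proof. by []. Qed.
Lemma pserM s t i j :
  (s * t) i j = \sum_(k < i.+1) \sum_(l < j.+1) s k l * t (i - k)%N (j - l)%N.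
Proof. by []. Qed.

Lemma series_expE s n : series_exp s n = s ^+ n.
Proof. by elim: n => //= n IH; rewrite exprS -IH. Qed.

Lemma pserM00 s t : (s * t) 0%N 0%N = s 0%N 0%N * t 0%N 0%N.
Proof. by rewrite pserM !big_ord1. Qed.

Lemma pserM10 s t :
  (s * t) 1%N 0%N = s 0%N 0%N * t 1%N 0%N + s 1%N 0%N * t 0%N 0%N.
Proof. by rewrite pserM !(big_ord_recl, big_ord0) /= !addr0. Qed.

Lemma pserM01 s t :
  (s * t) 0%N 1%N = s 0%N 0%N * t 0%N 1%N + s 0%N 1%N * t 0%N 0%N.
Proof. by rewrite pserM !(big_ord_recl, big_ord0) /= !addr0. Qed.

Lemma pserX00 s n : (s ^+ n) 0%N 0%N = s 0%N 0%N ^+ n.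
Proof. by elim: n => [|n IH] //; rewrite !exprS pserM00 IH. Qed.

Definition pserC (c : K) : pser K :=
  fun i j => if (i == 0)%N && (j == 0)%N then c else 0.

Lemma pserCM c s i j : (pserC c * s) i j = c * s i j.
Proof.
rewrite pserM big_ord_recl /= big_ord_recl /= !subn0 /pserC /=.
rewrite !big1 ?addr0 //= => [k _|l _]; last by rewrite mul0r.
by rewrite big1 // => l _; rewrite mul0r.
Qed.

Lemma pserC_is_zmod_morphism : zmod_morphism pserC.
Proof.
move=> a b; apply: series_ext => i j; rewrite pserB /pserC.
by case: ifP; rewrite ?subr0.
Qed.

Lemma pserC_is_monoid_morphism : monoid_morphism pserC.
Proof.
split=> [|a b]; apply: series_ext => i j.
  by rewrite pser1 /pserC; case: ifP.
by rewrite pserCM /pserC; case: ifP; rewrite ?mulr0.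
Qed.

HB.instance Definition _ := GRing.isZmodMorphism.Build K (pser K) pserC
  pserC_is_zmod_morphism.
HB.instance Definition _ := GRing.isMonoidMorphism.Build K (pser K) pserC
  pserC_is_monoid_morphism.

End SeriesTheory.

(** * Convergence and its stability under ring operations *)

Section Convergence.
Variable K : numClosedFieldType.
Implicit Types s t u w : pser K.

(** Normalizes the constants to be positive, also when the given [M] is zero, and makes the bound
    monotone in [r], so that two series can be estimated with one common [r']. *)
Lemma convergent_bound s : convergent s ->
  exists M r : K, [/\ 0 < M, 0 < r &
    forall r', r <= r' -> forall i j, `|s i j| <= M * r' ^+ (i + j)].
Proof.
move=> [M [r sM]].
have M0 : 0 <= M.
  by have := sM 0%N 0%N; rewrite expr0 mulr1; apply: le_trans.
have [M00|Mn0] := eqVneq M 0.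
  exists 1, 1; split=> // r' r1 i j; apply: le_trans (sM i j) _.
  by rewrite M00 mul0r mul1r exprn_ge0 // (le_trans ler01 r1).
have Mp : 0 < M by rewrite lt_def Mn0.
have r0 : 0 <= r.
  have := sM 1%N 0%N; rewrite addn0 expr1 => /(le_trans (normr_ge0 _)).
  by rewrite pmulr_rge0.
exists M, (r + 1); split=> // [|r' rr' i j]; first by rewrite ltr_wpDl.
apply: le_trans (sM i j) _; rewrite ler_wpM2l // lerXn2r ?nnegrE //.
  by apply: le_trans rr'; rewrite addr_ge0.
by apply: le_trans rr'; rewrite lerDl.
Qed.

Lemma convergent_pserC (c : K) : convergent (pserC c).
Proof.
exists `|c|, 0 => i j; rewrite /pserC.
case: i => [|i]; case: j => [|j] //=.
- by rewrite expr0 mulr1.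
all: by rewrite normr0 expr0n mulr0.
Qed.

Lemma convergent1 : convergent (1 : pser K).
Proof. by rewrite -(rmorph1 (@pserC K)); exact: convergent_pserC. Qed.

Lemma convergentN s : convergent s -> convergent (- s).
Proof. by move=> [M [r sM]]; exists M, r => i j; rewrite pserN normrN. Qed.

Lemma convergentD s t : convergent s -> convergent t -> convergent (s + t).
Proof.
move=> /convergent_bound [M [r [M0 r0 sM]]] /convergent_bound [L [q [L0 q0 tL]]].
exists (M + L), (r + q) => i j; rewrite pserD.
apply: le_trans (ler_normD _ _) _; rewrite mulrDl.
by apply: lerD; [apply: sM; rewrite lerDl ltW | apply: tL; rewrite lerDr ltW].
Qed.

Lemma convergentM s t : convergent s -> convergent t -> convergent (s * t).
Proof.
move=> /convergent_bound [M [r [M0 r0 sM]]] /convergent_bound [L [q [L0 q0 tL]]].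
have {}sM := sM (r + q) (ler_wpDr (ltW q0) (lexx r)).
have {}tL := tL (r + q) (ler_wpDl (ltW r0) (lexx q)).
set p := r + q in sM tL; have p0 : 0 < p by rewrite addr_gt0.
exists (M * L), (2 * p) => i j; rewrite pserM.
apply: (@le_trans _ _ (\sum_(k < i.+1) \sum_(l < j.+1) M * L * p ^+ (i + j))).
  apply: le_trans (ler_norm_sum _ _ _) _; apply: ler_sum => k _.
  apply: le_trans (ler_norm_sum _ _ _) _; apply: ler_sum => l _.
  rewrite normrM.
  have -> : (i + j = (k + l) + ((i - k) + (j - l)))%N.
    have := ltn_ord k; have := ltn_ord l; rewrite !ltnS => lj ki.
    by rewrite addnACA !subnKC.
  rewrite exprD mulrACA; apply: ler_pM; rewrite ?normr_ge0 //.
(* The number of equal terms, [(i + 1)(j + 1)], is at most [2 ^ (i + j)]; this accounts for the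
   factor 2 in the new radius constant. *)
rewrite !sumr_const !card_ord -mulrnA -[leLHS]mulr_natr exprMn -[leLHS]mulrA.
rewrite ler_wpM2l ?mulr_ge0 ?(ltW M0) ?(ltW L0) // mulrC ler_wpM2r ?exprn_ge0 ?(ltW p0) //.
rewrite -natrX ler_nat expnD mulnC; apply: leq_mul; exact: ltn_expl.
Qed.

Lemma convergentX s n : convergent s -> convergent (s ^+ n).
Proof.
move=> cs; elim: n => [|n IH]; first exact: convergent1.
by rewrite exprS; apply: convergentM.
Qed.

Lemma convergent_natmul s n : convergent s -> convergent (s *+ n).
Proof.
move=> cs; rewrite -mulr_natl -(rmorph_nat (@pserC K)).
by apply: convergentM => //; exact: convergent_pserC.
Qed.

Lemma geometric_sum_le (x : K) n : 0 < x -> x < 1 ->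
  \sum_(k < n) x ^+ k <= (1 - x)^-1.
Proof.
move=> x0 x1; have h : 0 < 1 - x by rewrite subr_gt0.
rewrite -[leRHS]mul1r ler_pdivlMr // mulrC -[1 - x]opprB mulNr -subrX1 opprB.
by rewrite gerBl exprn_ge0 // ltW.
Qed.

(* With [q = 1 / C], the sum of [M * q ^ (k + l)] over [(k, l) != 0] is at most
   [M * ((1 - q)^-2 - 1)], which is at most 1 for [C = 2 M + 3]. *)
Lemma convergent_majorant u w : convergent u ->
  (forall i j, (0 < i + j)%N -> `|w i j| <=
     \sum_(k < i.+1) \sum_(l < j.+1 | (0 < k + l)%N)
       `|u k l| * `|w (i - k)%N (j - l)%N|) ->
  convergent w.
Proof.
move=> /convergent_bound [M [r [M0 r0 /(_ r (lexx r)) uM]]] wu.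
pose C := 2 * M + 3; pose q := C^-1.
have C0 : 0 < C by rewrite addr_gt0 ?mulr_gt0.
have C1 : 1 < C by rewrite ltr_wpDl ?mulr_ge0 ?ltW // ltr1n.
have q0 : 0 < q by rewrite invr_gt0.
have q1 : q < 1 by rewrite invf_lt1.
have qC : q * C = 1 by rewrite mulVf ?gt_eqF.
have key i j : \sum_(k < i.+1) \sum_(l < j.+1 | (0 < k + l)%N)
    M * q ^+ (k + l) <= 1.
  have -> : \sum_(k < i.+1) \sum_(l < j.+1 | (0 < k + l)%N) M * q ^+ (k + l) =
    M * ((\sum_(k < i.+1) q ^+ k) * (\sum_(l < j.+1) q ^+ l) - 1).
    rewrite big_distrlr /= pair_big /= (bigD1 (ord0, ord0)) //= expr0 mulr1.
    rewrite [1 + _]addrC addrK mulr_sumr pair_big_dep /=.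
    apply: eq_big => [[k l]|[k l] _] /=; last by rewrite exprD.
    by rewrite lt0n addn_eq0.
  have q_inv : 0 < (1 - q)^-1 by rewrite invr_gt0 subr_gt0.
  apply: (@le_trans _ _ (M * ((1 - q)^-1 * (1 - q)^-1 - 1))).
    rewrite ler_wpM2l ?(ltW M0) // lerB // ler_pM //;
    by [exact: geometric_sum_le | apply: sumr_ge0 => k _; rewrite exprn_ge0 // ltW].
  have -> : (1 - q)^-1 = C / (C - 1).
    rewrite -[1 in LHS]qC -[X in _ - X]mulr1 -mulrBr invfM mulrC.
    by rewrite /q invrK mulrC.
  have C10 : 0 < C - 1 by rewrite subr_gt0.
  rewrite (_ : M * _ = M * (2 * C - 1) / (C - 1) ^+ 2); last first.
    by field; rewrite gt_eqF.
  rewrite ler_pdivrMr ?exprn_gt0 // mul1r -subr_ge0.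
  rewrite (_ : _ - _ = 3 * M + 4); last by rewrite /C; ring.
  by rewrite addr_ge0 // mulr_ge0 // ltW.
(* In the induction on [i + j] each factor [r] is rewritten as [q * (C * r)]; by [key] the freed
   powers of [q], weighted by [M], sum to at most 1, so the constant in front does not grow. *)
exists `|w 0%N 0%N|, (C * r) => i j.
have [n] := ubnP (i + j); elim: n i j => // n IH i j ijn.
have [ij0|ij0] := posnP (i + j).
  by move/eqP: ij0; rewrite addn_eq0 => /andP[/eqP-> /eqP->]; rewrite mulr1.
apply: le_trans (wu i j ij0) _.
rewrite -[leRHS]mul1r; apply: le_trans (ler_wpM2r _ (key i j)); last first.
  by rewrite mulr_ge0 // exprn_ge0 // mulr_ge0 // ltW.
rewrite mulr_suml; apply: ler_sum => k _; rewrite mulr_suml.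
apply: ler_sum => l kl.
have := ltn_ord k; have := ltn_ord l; rewrite !ltnS => lj ki.
have e : (i + j = (k + l) + ((i - k) + (j - l)))%N by rewrite addnACA !subnKC.
have := IH (i - k)%N (j - l)%N.
have -> : (i - k + (j - l) < n)%N.
  by rewrite -ltnS; apply: leq_trans ijn; rewrite ltnS e -add1n leq_add2r.
move=> /(_ isT) wb.
rewrite e [(C * r) ^+ (_ + _)]exprD; apply: le_trans (ler_pM _ _ (uM k l) wb) _ => //.
rewrite [leLHS](_ : _ = M * `|w 0%N 0%N| * r ^+ (k + l) * (C * r) ^+ (i - k + (j - l))); last by ring.
rewrite [leRHS](_ : _ = M * `|w 0%N 0%N| * (q ^+ (k + l) * (C * r) ^+ (k + l)) * (C * r) ^+ (i - k + (j - l))); last by ring.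
by rewrite -exprMn mulrA qC mul1r.
Qed.

End Convergence.

(** * Powers of a unit series: inverses and roots *)

Section Powers.
Variable K : numClosedFieldType.
Implicit Types s t u w z : pser K.

(** The recursion decreases the total degree, so [n] applications of [step] already fix all
    coefficients with [i + j <= n]; the diagonal sequence [approx (i + j)] is therefore a
    solution. *)
Lemma series_recursion (phi : nat -> nat -> nat -> nat -> K) :
  exists w : pser K, w 0%N 0%N = 1 /\ forall i j, (0 < i + j)%N ->
    w i j = \sum_(k < i.+1) \sum_(l < j.+1 | (0 < k + l)%N)
              phi i j k l * w (i - k)%N (j - l)%N.
Proof.
pose step (f : nat -> nat -> K) i j : K :=
  if (0 < i + j)%N then \sum_(k < i.+1) \sum_(l < j.+1 | (0 < k + l)%N)
    phi i j k l * f (i - k)%N (j - l)%N else 1.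
pose approx n := iter n step (fun _ _ => 1).
have stable n i j : (i + j <= n)%N -> approx n i j = approx (i + j)%N i j.
  have [m] := ubnP n; elim: m n i j => // m IH n i j nm ijn.
  case: n nm ijn => [|n] nm ijn; first by move: ijn; rewrite leqn0 => /eqP->.
  case ij: (i + j)%N => [|d]; first by rewrite /= /step ij.
  rewrite /= /step ij /=; apply: eq_bigr => k _; apply: eq_bigr => l kl.
  have := ltn_ord k; have := ltn_ord l; rewrite !ltnS => lj ki.
  have e : (i + j = (k + l) + ((i - k) + (j - l)))%N by rewrite addnACA !subnKC.
  have ld : (i - k + (j - l) <= d)%N.
    by rewrite -ltnS -ij e -add1n leq_add2r.
  have dn : (d <= n)%N by rewrite -ltnS -ij.
  have nm' : (n < m)%N by [].
  by rewrite !IH // ?(leq_trans ld) //; apply: leq_ltn_trans nm'.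
exists (fun i j => approx (i + j)%N i j); split=> // i j ij.
case d: (i + j)%N (ij) => [|n] // _; rewrite /= /step d /=.
apply: eq_bigr => k _; apply: eq_bigr => l kl.
have := ltn_ord k; have := ltn_ord l; rewrite !ltnS => lj ki.
have e : (i + j = (k + l) + ((i - k) + (j - l)))%N by rewrite addnACA !subnKC.
by rewrite stable // -ltnS -d e -add1n leq_add2r.
Qed.

(** The Euler field [x d/dx + y d/dy]. In characteristic 0 it kills only constants, so a single
    equation determines a series up to a constant. *)
Definition euler s : pser K := fun i j => (i + j)%:R * s i j.

Lemma eulerM s t : euler (s * t) = euler s * t + s * euler t.
Proof.
apply: series_ext => i j; rewrite pserD /euler !pserM mulr_sumr -big_split /=.
apply: eq_bigr => k _; rewrite mulr_sumr -big_split /=; apply: eq_bigr => l _.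
have := ltn_ord k; have := ltn_ord l; rewrite !ltnS => lj ki.
have -> : (i + j = (k + l) + ((i - k) + (j - l)))%N by rewrite addnACA !subnKC.
by rewrite natrD; ring.
Qed.

Lemma euler1 : euler 1 = 0.
Proof.
apply: series_ext => i j; rewrite /euler pser1 pser0.
by case: i => [|i]; case: j => [|j] //=; rewrite ?mul0r ?mulr0.
Qed.

Lemma eulerX s n : euler (s ^+ n.+1) = (s ^+ n * euler s) *+ n.+1.
Proof.
elim: n => [|n IH]; first by rewrite expr1 expr0 mul1r.
by rewrite exprS eulerM IH mulrnAr mulrA -exprS mulrC -mulrS.
Qed.

Lemma euler_eq0 s : euler s = 0 -> s = pserC (s 0%N 0%N).
Proof.
move=> e; apply: series_ext => i j; rewrite /pserC.
have [ij0|ij0] := posnP (i + j).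
  by move/eqP: ij0; rewrite addn_eq0 => /andP[/eqP-> /eqP->].
have ijn0 : (i + j == 0)%N = false by apply/negbTE; rewrite -lt0n.
rewrite -addn_eq0 ijn0.
have /eqP := congr1 (fun z : pser K => z i j) e.
by rewrite /euler pser0 mulf_eq0 pnatr_eq0 ijn0 /= => /eqP.
Qed.

(* The equation [u E(w) = al w E(u)] is a linear recursion for the
   coefficients of [w = u ^ al]; for [|al| <= 1] its coefficients are dominated
   by those of [u]. *)
Lemma convergent_power (al : K) u : `|al| <= 1 -> convergent u ->
  u 0%N 0%N = 1 ->
  exists w, [/\ convergent w, w 0%N 0%N = 1
    & u * euler w = pserC al * (w * euler u)].
Proof.
move=> al1 cu u1.
(* As [u] has constant term 1, [w i j] enters the coefficient of index [(i, j)] of the equation with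
   factor [i + j]; dividing by it solves for [w i j]. *)
pose phi i j k l := (i + j)%:R^-1 *
  (u k l * (al * (k + l)%:R - (i - k + (j - l))%:R)).
have [w [w1 wE]] := series_recursion phi.
exists w; split=> //.
  apply: (convergent_majorant cu) => i j ij; rewrite wE //.
  apply: le_trans (ler_norm_sum _ _ _) _; apply: ler_sum => k _.
  apply: le_trans (ler_norm_sum _ _ _) _; apply: ler_sum => l kl.
  rewrite normrM ler_wpM2r // /phi mulrCA normrM -[leRHS]mulr1 ler_wpM2l //.
  rewrite normrM ger0_norm ?invr_ge0 ?ler0n // mulrC.
  rewrite ler_pdivrMr ?ltr0n // mul1r.
  have := ltn_ord k; have := ltn_ord l; rewrite !ltnS => lj ki.
  have -> : (i + j = (k + l) + ((i - k) + (j - l)))%N.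
    by rewrite addnACA !subnKC.
  (* With [|al| <= 1] the bracket in [phi] is at most [(k + l) + (i - k + (j - l)) = i + j], which
     cancels the denominator. *)
  apply: le_trans (ler_normB _ _) _; rewrite normrM !normr_nat [leRHS]natrD lerD2r.
  by rewrite ler_piMl.
apply: series_ext => i j; rewrite pserCM [w * _]mulrC; apply/eqP.
rewrite eq_sym -subr_eq0 !pserM mulr_sumr -sumrB.
have [ij0|ij0] := posnP (i + j).
  move/eqP: ij0; rewrite addn_eq0 => /andP[/eqP-> /eqP->].
  by rewrite !big_ord1 /euler !mul0r !mulr0 subr0.
under eq_bigr => k _ do rewrite mulr_sumr -sumrB.
rewrite pair_big /= (bigD1 (ord0, ord0)) //= !subn0 u1 /euler mul0r mul0r mulr0.
rewrite sub0r mul1r wE // addrC subr_eq0; apply/eqP.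
rewrite mulr_sumr.
have ijn0 : (i + j)%:R != 0 :> K by rewrite pnatr_eq0 -lt0n.
rewrite [in RHS](eq_bigr (fun k : 'I_i.+1 => \sum_(l < j.+1 | (0 < k + l)%N)
  (i + j)%:R * (phi i j k l * w (i - k)%N (j - l)%N))); last first.
  by move=> k _; rewrite mulr_sumr.
rewrite pair_big_dep /=; apply: eq_big => [[k l]|[k l] _] /=.
  by rewrite lt0n addn_eq0.
by rewrite /phi !mulrA mulfV // mul1r; ring.
Qed.

End Powers.

Section Units.
Variable K : numClosedFieldType.
Implicit Types s t u v w x y X Y : pser K.

Lemma pser_nat n i j :
  (n%:R : pser K) i j = if (i == 0)%N && (j == 0)%N then n%:R else 0.
Proof. by rewrite -(rmorph_nat (@pserC K)). Qed.

Lemma pserMn s n i j : (s *+ n) i j = s i j *+ n.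
Proof. by elim: n => [|n IH] //; rewrite !mulrS pserD IH. Qed.

Lemma convergent_nat n : convergent (n%:R : pser K).
Proof. by rewrite -(rmorph_nat (@pserC K)); exact: convergent_pserC. Qed.

(** This is the power with exponent -1: its equation says that the Euler derivative of the product
    vanishes, so the product is constant. The division by the constant term beforehand meets the
    normalization of [convergent_power]. *)
Lemma unit_inverse u : series_unit u ->
  exists v, [/\ convergent v, v 0%N 0%N = (u 0%N 0%N)^-1 & u * v = 1].
Proof.
move=> [cu u0]; pose u' := pserC (u 0%N 0%N)^-1 * u.
have cu' : convergent u' by apply: convergentM => //; exact: convergent_pserC.
have u'1 : u' 0%N 0%N = 1 by rewrite /u' pserCM mulVf.
have [|w [cw w1 wE]] := @convergent_power K (-1) u' _ cu' u'1.
  by rewrite normrN1.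
exists (pserC (u 0%N 0%N)^-1 * w); split.
- by apply: convergentM => //; exact: convergent_pserC.
- by rewrite pserCM w1 mulr1.
rewrite mulrCA mulrA -/u'; have /euler_eq0 -> : euler (u' * w) = 0.
  by rewrite eulerM wE rmorphN1 mulN1r mulrC addrN.
by rewrite pserM00 u'1 w1 mulr1 rmorph1.
Qed.

(** With [w] the power of exponent [1 / (n + 1)], both [w ^ (n + 1)] and [u'] solve the same Euler
    equation, so their quotient is constant. The root [c] is prescribed, which later allows a branch
    to be chosen. *)
Lemma unit_root n u (c : K) : series_unit u -> c ^+ n.+1 = u 0%N 0%N ->
  exists w, [/\ convergent w, w 0%N 0%N = c & w ^+ n.+1 = u].
Proof.
move=> [cu u0] cn; pose u' := pserC (u 0%N 0%N)^-1 * u.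
have cu' : convergent u' by apply: convergentM => //; exact: convergent_pserC.
have u'1 : u' 0%N 0%N = 1 by rewrite /u' pserCM mulVf.
have uE : u = pserC (u 0%N 0%N) * u' by rewrite /u' mulrA -rmorphM mulfV // rmorph1 mul1r.
have [|w [cw w1 wE]] := @convergent_power K n.+1%:R^-1 u' _ cu' u'1.
  by rewrite ger0_norm ?invr_ge0 ?ler0n // invf_le1 ?ltr0n // ler1n.
have [v [cv _ u'v]] : exists v, [/\ convergent v, v 0%N 0%N = (u' 0%N 0%N)^-1 & u' * v = 1].
  by apply: unit_inverse; split; rewrite // u'1 oner_neq0.
exists (pserC c * w); split.
- by apply: convergentM => //; exact: convergent_pserC.
- by rewrite pserCM w1 mulr1.
rewrite exprMn -rmorphXn cn [in RHS]uE; congr (_ * _).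
pose z := w ^+ n.+1.
have zE : u' * euler z = z * euler u'.
  have nC : n.+1%:R * pserC n.+1%:R^-1 = 1 :> pser K.
    rewrite -(rmorph_nat (@pserC K)) -rmorphM mulfV ?pnatr_eq0 //.
    exact: rmorph1.
  rewrite /z eulerX mulrnAr mulrCA wE -mulr_natl -[RHS]mul1r -[X in _ = X * _]nC.
  rewrite exprS.
  move: (pserC _) (euler u') (w ^+ n) => A B C; ring.
have vE : u' * euler v = - v * euler u'.
  apply/eqP; rewrite mulNr -addr_eq0 addrC [v * _]mulrC -eulerM u'v euler1.
  exact/eqP.
have zv0 : euler (z * v) = 0.
  have -> : euler (z * v) = v * (u' * (euler z * v + z * euler v)).
    by rewrite mulrA [v * u']mulrC u'v mul1r eulerM.
  by rewrite mulrDr mulrA zE mulrCA vE; ring.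
have /euler_eq0 zvC := zv0.
have zv1 : z * v = 1.
  have /(congr1 (fun s : pser K => s 0%N 0%N)) := u'v.
  rewrite pserM00 u'1 mul1r => v1.
  by rewrite zvC pserM00 v1 mulr1 /z pserX00 w1 expr1n rmorph1.
by rewrite -[LHS]mulr1 -u'v mulrCA zv1 mulr1.
Qed.

Lemma unit_root_ex n u : series_unit u ->
  exists w, series_unit w /\ w ^+ n.+1 = u.
Proof.
move=> uu; have [|w [cw w0 wn]] := @unit_root n u (n.+1.-root (u 0%N 0%N)) uu.
  by rewrite rootCK.
exists w; split=> //; split=> //; case: uu => _; rewrite -wn pserX00.
by apply: contra_neq => ->; rewrite expr0n.
Qed.

End Units.

Ltac conv :=
  try assumption;
  lazymatch goal with
  | |- convergent (GRing.add _ _) => apply: convergentD; conv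
  | |- convergent (GRing.mul _ _) => apply: convergentM; conv
  | |- convergent (GRing.opp _) => apply: convergentN; conv
  | |- convergent (GRing.exp _ _) => apply: convergentX; conv
  | |- convergent (GRing.natmul (GRing.one _) _) => exact: convergent_nat
  | |- convergent (GRing.one _) => exact: convergent1
  | |- convergent (pserC _) => exact: convergent_pserC
  | |- convergent (GRing.natmul _ _) => apply: convergent_natmul; conv
  | |- _ => idtac
  end.

Definition jet0 := (pserD, pserN, pserM00, pserX00, pser_nat, pserMn, pser1).

(** * Normal forms at the A_4 points of the trigonal curve *)

Section Criteria.
Variable K : numClosedFieldType.
Implicit Types s t u v w x y X Y g : pser K.

(** The unit [V] is absorbed into [x] by means of its root of order [p + 1], whose nonzero constant
    term only rescales the Jacobian. *)
Lemma germ_A_of p g u V X x : local_coordinates X x -> series_unit u ->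
  series_unit V -> g = u * (X ^+ 2 + x ^+ p.+1 * V) -> germ_A p g.
Proof.
move=> [cX cx X0 x0 lin] uu uV ->.
have [w [[cw w0] <-]] := unit_root_ex p uV.
exists X, (x * w), u; split=> //.
  split=> //; first exact: convergentM.
    by rewrite [LHS]pserM00 x0 mul0r.
  rewrite !pserM10 !pserM01 x0 !mul0r !add0r !mulrA -mulrBl mulf_neq0 //.
by move=> i j; rewrite -exprMn -!series_expE.
Qed.

Lemma local_coordinatesC X Y : local_coordinates X Y -> local_coordinates Y X.
Proof.
move=> [cX cY X0 Y0 lin]; split=> //; rewrite -oppr_eq0 opprB.
by rewrite [X in _ - X]mulrC [X in X - _]mulrC.
Qed.

Definition cuspD x W : pser K := 3 * (1 + 6 * x - 11 * x ^+ 2) + W.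
Definition cuspX x W : pser K := 2 * cuspD x W * W - 360 * x ^+ 3 * (1 - x).
Definition cuspV x W : pser K :=
  4 * cuspD x W * (1728 - 1296 * x) - x * (360 * (1 - x)) ^+ 2.
(* 2 f(x, Y) for [W = 2 Y - (1 + 6 x - 11 x^2)]: the parabola is chosen to
   osculate the curve at its A_4 point over [x = 0]. *)
Definition cusp x W : pser K :=
  W ^+ 3 + 3 * (1 + 6 * x - 11 * x ^+ 2) * W ^+ 2 - 360 * x ^+ 3 * (1 - x) * W
  + x ^+ 5 * (1728 - 1296 * x).

(** Once [W ^+ 3] is put into the leading coefficient [cuspD], the cubic [cusp] is quadratic in [W],
    and [4 * cuspD] completes its square. The remainder is divisible by [x ^ 5], which is the A_4
    normal form as [cuspD] and [cuspV] are units at the origin. *)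
Lemma cuspE x W :
  4 * cuspD x W * cusp x W = cuspX x W ^+ 2 + x ^+ 5 * cuspV x W.
Proof. by rewrite /cusp /cuspV /cuspX /cuspD; ring. Qed.

Lemma cusp_inverse x W : convergent x -> convergent W -> x 0%N 0%N = 0 ->
  W 0%N 0%N = 0 -> exists u, series_unit u /\
  cusp x W = u * (cuspX x W ^+ 2 + x ^+ 5 * cuspV x W).
Proof.
move=> cx cW x0 W0.
have [|u [cu u0 uD]] := @unit_inverse K (4 * cuspD x W).
  split; first by rewrite /cuspD; conv.
  by rewrite /cuspD !jet0 x0 W0 /= !expr0n /= !mulr0 addr0 subr0 addr0 mulr1 mulf_neq0 ?pnatr_eq0.
exists u; split; last by rewrite -cuspE mulrA [u * _]mulrC uD mul1r.
split=> //; rewrite u0 invr_eq0.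
by rewrite /cuspD !jet0 x0 W0 /= !expr0n /= !mulr0 addr0 subr0 addr0 mulr1 mulf_neq0 ?pnatr_eq0.
Qed.

End Criteria.

Definition trigonal_form (R : comNzRingType) (x Y z : R) : R :=
  4 * Y ^+ 3
  - 3 * Y * (x ^+ 4 - 12 * x ^+ 3 * z + 14 * x ^+ 2 * z ^+ 2
             + 12 * x * z ^+ 3 + z ^+ 4)
  + (x ^+ 2 + z ^+ 2) * (x ^+ 4 - 18 * x ^+ 3 * z + 74 * x ^+ 2 * z ^+ 2
                         + 18 * x * z ^+ 3 + z ^+ 4).

Definition conic_form (R : comNzRingType) (a b c x z : R) : R :=
  a * x ^+ 2 + b * x * z + c * z ^+ 2.

Definition sextic_form (R : comNzRingType) (a b c x y z : R) : R :=
  trigonal_form x (y ^+ 2 + conic_form a b c x z) z.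

(* The symmetry [x -> -1/x] of the trigonal curve exchanges its A_4 points. *)
Lemma sextic_form_sym (R : comNzRingType) (a b c x y z : R) :
  sextic_form a b c x y z = sextic_form c (- b) a (- z) y x.
Proof. by rewrite /sextic_form /trigonal_form /conic_form; ring. Qed.

Section GermsAtCusps.
Variable K : numClosedFieldType.
Implicit Types (s t u v w x y X Y g : pser K) (a b c e : K).

Lemma jet_cusp x W : convergent x -> convergent W -> x 0%N 0%N = 0 ->
  W 0%N 0%N = 0 ->
  [/\ convergent (cuspD x W), cuspD x W 0%N 0%N = 3, convergent (cuspV x W)
    & cuspV x W 0%N 0%N = 12 * 1728].
Proof.
move=> cx cW x0 W0; rewrite /cuspV /cuspD; split; [conv | | conv | ].
  by rewrite !jet0 x0 W0 /= !expr0n /=; ring.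
by rewrite !jet0 x0 W0 /= !expr0n /=; ring.
Qed.

(** The coordinates are arguments because the point over infinity is treated with the same lemmas,
    with [- pserY] and [pserX] in place of [x] and [y]. *)
Definition affine_germ a b c e x y : pser K :=
  sextic_form (pserC a) (pserC b) (pserC c) x (pserC e + y) 1.

Definition cusp_coord a b c e x y : pser K :=
  2 * ((pserC e + y) ^+ 2
       + conic_form (pserC a) (pserC b) (pserC c) x 1)
  - (1 + 6 * x - 11 * x ^+ 2).

Lemma affine_germ_cusp a b c e x y :
  affine_germ a b c e x y = pserC 2^-1 * cusp x (cusp_coord a b c e x y).
Proof.
have h : pserC 2^-1 * 2 = 1 :> pser K.
  rewrite -(rmorph_nat (@pserC K)) -rmorphM mulVf ?pnatr_eq0 //.
  exact: rmorph1.
rewrite -[LHS]mul1r -h -mulrA; congr (_ * _).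
rewrite /affine_germ /sextic_form /trigonal_form /cusp /cusp_coord.
by move: (conic_form _ _ _ _ _) => q; ring.
Qed.

(** The equation [2 * (e ^+ 2 + c) = 1] places the centre [(0, e)] above the A_4 point [(0, 1/2)] of
    the trigonal curve, and it is exactly what makes [W] vanish there. *)
Lemma affine_germ_unit a b c e x y : convergent x -> convergent y ->
  x 0%N 0%N = 0 -> y 0%N 0%N = 0 -> 2 * (e ^+ 2 + c) = 1 ->
  let W := cusp_coord a b c e x y in
  [/\ convergent W, W 0%N 0%N = 0 & exists u, series_unit u /\
  affine_germ a b c e x y = u * (cuspX x W ^+ 2 + x ^+ 5 * cuspV x W)].
Proof.
move=> cx cy x0 y0 ec W.
have cW : convergent W by rewrite /W /cusp_coord /conic_form; conv.
have W0 : W 0%N 0%N = 0.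
  rewrite /W /cusp_coord /conic_form !jet0 /pserC x0 y0 /= !expr0n /=.
  by rewrite -[RHS](subrr 1) -[X in _ = X - _]ec; ring.
split=> //; have [u [[cu u0] uE]] := cusp_inverse cx cW x0 W0.
exists (pserC 2^-1 * u); split; last by rewrite affine_germ_cusp uE mulrA.
split; first by conv.
by rewrite pserCM mulf_neq0 ?invr_eq0 ?pnatr_eq0.
Qed.

Lemma cuspX_linear x W : x 0%N 0%N = 0 -> W 0%N 0%N = 0 ->
  (cuspX x W 1%N 0%N = 6 * W 1%N 0%N) * (cuspX x W 0%N 1%N = 6 * W 0%N 1%N).
Proof.
move=> x0 W0.
have -> : cuspX x W = (2 * cuspD x W) * W - x * (x * (360 * x * (1 - x))).
  by rewrite /cuspX; ring.
rewrite !pserB !pserM10 !pserM01 !pserM00 x0 W0.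
rewrite !(mulr0, mul0r, addr0, add0r, subr0).
rewrite (_ : cuspD x W 0%N 0%N = 3); last first.
  by rewrite /cuspD !jet0 x0 W0 /= !expr0n /=; ring.
by rewrite pser_nat /= -natrM.
Qed.

(** For [e != 0] the double covering is unramified at the point, so [cuspX] and [x] are still
    coordinates and the A_4 point lifts unchanged. *)
Lemma germ_A4 a b c e x y : local_coordinates x y -> e != 0 ->
  2 * (e ^+ 2 + c) = 1 -> germ_A 4 (affine_germ a b c e x y).
Proof.
move=> lc e0 ec; have [cx cy x0 y0 lin] := lc.
have [cW W0 [u [uu uE]]] := affine_germ_unit a b cx cy x0 y0 ec.
set W := cusp_coord a b c e x y in cW W0 uE.
have [cD D0 cV V0] := jet_cusp cx cW x0 W0.
apply: (germ_A_of _ uu _ uE); last by split; rewrite // V0 -natrM pnatr_eq0.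
have [X10 X01] := cuspX_linear x0 W0.
split=> //; first by rewrite /cuspX; conv.
  by rewrite /cuspX !jet0 W0 x0 /= expr0n /=; ring.
rewrite X10 X01.
have WE : W = pserC (2 * (e ^+ 2 + c) - 1) + y * (2 * y + 4 * pserC e)
          + x * (2 * pserC a * x + 2 * pserC b - 6 + 11 * x).
  have -> : pserC (2 * (e ^+ 2 + c) - 1) = 2 * (pserC e ^+ 2 + pserC c) - 1.
    by rewrite rmorphB rmorphM /= rmorph_nat rmorph1 rmorphD rmorphXn.
  by rewrite /W /cusp_coord /conic_form; ring.
rewrite WE ec subrr rmorph0 add0r !pserD !pserM10 !pserM01 x0 y0 !mul0r !add0r.
rewrite !jet0 /pserC x0 y0 /=.
apply: contra_neq lin => h.
have := h; rewrite (_ : _ - _ = - (24 * e) * (x 1%N 0%N * y 0%N 1%N - x 0%N 1%N * y 1%N 0%N)).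
  by move=> /eqP; rewrite mulf_eq0 oppr_eq0 !mulf_eq0 pnatr_eq0 (negPf e0) /= => /eqP.
by ring.
Qed.

End GermsAtCusps.

Section A9.
Variable R : comNzRingType.
Implicit Types D V E x y m X : R.

(** Since [x * E = X - m], the germ times [E ^ 5] is [E ^ 5 X ^ 2 + V (X - m) ^ 5 = G X ^ 2 + 5 V m
    ^ 4 X - V m ^ 5]: [A9_G] collects everything divisible by [X ^ 2]. [A9_X] is the completed
    square, and as [m] is a multiple of [y ^ 2] the remainder contains [m ^ 5], hence [y ^ 10]. *)
Definition A9_G D V E x y : R :=
  let m := 4 * D * y ^+ 2 in let X := m + x * E in
  E ^+ 5 + V * (X ^+ 3 - 5 * X ^+ 2 * m + 10 * X * m ^+ 2 - 10 * m ^+ 3).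

Definition A9_X D V E x y : R :=
  2 * A9_G D V E x y * (4 * D * y ^+ 2 + x * E)
  + 5 * V * (4 * D * y ^+ 2) ^+ 4.

Definition A9_V D V E x y : R :=
  - ((4 * D) ^+ 5 * V * (25 * V * (4 * D) ^+ 3 * y ^+ 6 + 4 * A9_G D V E x y)).

(* Eliminate [x = (X - m) / E] and complete the square in [X]. *)
Lemma A9_identity D V E x y :
  4 * A9_G D V E x y * E ^+ 5 * ((4 * D * y ^+ 2 + x * E) ^+ 2 + x ^+ 5 * V) =
  A9_X D V E x y ^+ 2 + y ^+ 10 * A9_V D V E x y.
Proof.
rewrite /A9_X /A9_V; set G := A9_G _ _ _ _ _; set m := 4 * D * y ^+ 2.
set X := m + x * E.
have -> : 4 * G * E ^+ 5 * (X ^+ 2 + x ^+ 5 * V) =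
    4 * G * (G * X ^+ 2 + 5 * V * m ^+ 4 * X - V * m ^+ 5).
  rewrite -[LHS]mulrA; congr (_ * _); rewrite /G /A9_G -/m -/X.
  have -> : E ^+ 5 * (X ^+ 2 + x ^+ 5 * V) = E ^+ 5 * X ^+ 2 + (X - m) ^+ 5 * V.
    by rewrite /X; ring.
  by clearbody X m; ring.
have -> : y ^+ 10 * (- ((4 * D) ^+ 5 * V * (25 * V * (4 * D) ^+ 3 * y ^+ 6 + 4 * G)))
  = - (V * m ^+ 5 * (25 * V * m ^+ 3 + 4 * G)) by rewrite /m; ring.
by clearbody G X m; ring.
Qed.

End A9.

Section Y11.
Variable R : comNzRingType.
Implicit Types m V E x y r th k : R.

Definition cusp_factor m r th x y : R :=
  m * y ^+ 2 + x * y * th - x ^+ 2 * r.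

(** Absorbing [x ^ 5 V] into [r] leaves [m^2 y^4 + 2 m E x^2 y^2 + r^2 x^4], which is
    [(m y^2 - r x^2)^2] plus [2 m (E + r) x^2 y^2]; the square root [th] turns this into a
    difference of two squares. *)
Lemma Y11_identity m V E x y r th : r ^+ 2 = E ^+ 2 + x * V ->
  th ^+ 2 = - (2 * m * (E + r)) ->
  (m * y ^+ 2 + x ^+ 2 * E) ^+ 2 + x ^+ 5 * V =
  cusp_factor m r th x y * cusp_factor m r (- th) x y.
Proof.
move=> rE thE.
have -> : cusp_factor m r th x y * cusp_factor m r (- th) x y =
  (m * y ^+ 2 - x ^+ 2 * r) ^+ 2 - x ^+ 2 * y ^+ 2 * th ^+ 2.
  by rewrite /cusp_factor; ring.
have -> : (m * y ^+ 2 - x ^+ 2 * r) ^+ 2 =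
  m ^+ 2 * y ^+ 4 - 2 * m * y ^+ 2 * x ^+ 2 * r + x ^+ 4 * r ^+ 2 by ring.
by rewrite thE rE; ring.
Qed.

(** The discriminant of the factor as a quadratic form is [th^2 + 4 m r = 2 m (r - E)], and
    [r - E = x V / (r + E)] contributes one more [x]: this gives the cusp. *)
Lemma cusp_factor_identity m V E x y r th k : r ^+ 2 = E ^+ 2 + x * V ->
  th ^+ 2 = - (2 * m * (E + r)) -> (r + E) * k = 1 ->
  4 * m * cusp_factor m r th x y =
  (2 * m * y + x * th) ^+ 2 + x ^+ 3 * (- (2 * m * V * k)).
Proof.
move=> rE thE kE.
have rEE : r - E = x * (V * k).
  rewrite -[LHS]mulr1 -kE.
  have -> : (r - E) * ((r + E) * k) = (r ^+ 2 - E ^+ 2) * k by ring.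
  by rewrite rE; ring.
have -> : (2 * m * y + x * th) ^+ 2 =
  4 * m ^+ 2 * y ^+ 2 + 4 * m * x * y * th + x ^+ 2 * th ^+ 2 by ring.
have -> : x ^+ 3 * (- (2 * m * V * k)) = - (2 * m * x ^+ 2 * (x * (V * k))).
  by ring.
by rewrite thE -rEE /cusp_factor; ring.
Qed.

End Y11.

Section Germs.
Variable K : numClosedFieldType.
Implicit Types (s t u v w x y X Y g : pser K) (a b c e : K).

(** For a section through the A_4 point, [W = 2 y^2 + x (2 b - 6 + (2 a + 11) x)]; the two
    coefficients measure how far the section is from the osculating parabola in order 1 and 2. *)
Lemma cuspX_through a b c x y : 2 * c = 1 ->
  let W := cusp_coord a b c 0 x y in
  cuspX x W = 4 * cuspD x W * y ^+ 2
    + x * (2 * cuspD x W * (pserC (2 * b - 6) + pserC (2 * a + 11) * x)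
           - 360 * x ^+ 2 * (1 - x)).
Proof.
move=> c2 W; rewrite /cuspX.
have c2' : 2 * pserC c = 1.
  by rewrite -(rmorph_nat (@pserC K)) -rmorphM c2; exact: rmorph1.
have -> : pserC (2 * b - 6) = 2 * pserC b - 6.
  by rewrite rmorphB rmorphM /= !rmorph_nat.
have -> : pserC (2 * a + 11) = 2 * pserC a + 11.
  by rewrite rmorphD rmorphM /= !rmorph_nat.
have WE : W = 2 * y ^+ 2 + x * (2 * pserC b - 6 + (2 * pserC a + 11) * x)
    + (2 * pserC c - 1).
  by rewrite /W /cusp_coord /conic_form rmorph0; ring.
rewrite c2' subrr addr0 in WE.
by move: (cuspD x W) => D; rewrite WE; ring.
Qed.

(** [b != 3] means that the section crosses the cuspidal tangent transversally. Then [E], with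
    constant term [12 (b - 3)], is a unit and [x] can be eliminated. *)
Lemma germ_A9 a b c x y : local_coordinates x y -> 2 * c = 1 -> b != 3 ->
  germ_A 9 (affine_germ a b c 0 x y).
Proof.
move=> lc c2 b3; have [cx cy x0 y0 lin] := lc.
have ec : 2 * (0 ^+ 2 + c) = 1 by rewrite expr0n /= add0r.
have [cW W0 [u [uu uE]]] := affine_germ_unit a b cx cy x0 y0 ec.
have XE := cuspX_through a b x y c2.
set W := cusp_coord a b c 0 x y in cW W0 uE XE.
have [cD D0 cV V0] := jet_cusp cx cW x0 W0.
move: uE; rewrite {}XE; set D := cuspD x W in cD D0 *.
set V := cuspV x W in cV V0 *.
set E := 2 * D * _ - _ => uE.
have cE : convergent E by rewrite /E; conv.
have E0 : E 0%N 0%N = 12 * (b - 3).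
  by rewrite /E !jet0 /pserC x0 D0 /= !expr0n /=; ring.
have En0 : E 0%N 0%N != 0 by rewrite E0 mulf_neq0 ?pnatr_eq0 ?subr_eq0.
have cG : convergent (A9_G D V E x y) by rewrite /A9_G; conv.
have G0 : A9_G D V E x y 0%N 0%N = E 0%N 0%N ^+ 5.
  by rewrite /A9_G !jet0 x0 y0 /= !expr0n /=; ring.
have uG : series_unit (4 * A9_G D V E x y * E ^+ 5).
  split; first by conv.
  by rewrite !jet0 G0 /= !mulf_neq0 ?expf_neq0 ?pnatr_eq0.
have [v [cv v0 Gv]] := unit_inverse uG.
apply: (@germ_A_of _ 9 _ (u * v) (A9_V D V E x y) (A9_X D V E x y) y).
- split=> //; first by rewrite /A9_X; conv.
    by rewrite /A9_X !jet0 x0 y0 /= !expr0n /=; ring.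
  have -> : A9_X D V E x y = x * (2 * A9_G D V E x y * E)
    + y * (y * (8 * A9_G D V E x y * D + 5 * V * (4 * D) ^+ 4 * y ^+ 6)).
    by rewrite /A9_X; ring.
  rewrite !pserD !pserM10 !pserM01 !pserM00 x0 y0 G0.
  rewrite !(mulr0, mul0r, addr0, add0r) pser_nat /=.
  set k := 2%:R * _ * _.
  rewrite (_ : _ - _ = k * (x 1%N 0%N * y 0%N 1%N - x 0%N 1%N * y 1%N 0%N)).
    by rewrite mulf_neq0 // /k !mulf_neq0 ?expf_neq0 ?pnatr_eq0.
  by ring.
- case: uu => cu u0; split; first by conv.
  by rewrite pserM00 mulf_neq0 // v0 invr_eq0; case: uG.
- split; first by rewrite /A9_V; conv.
  rewrite /A9_V pserN oppr_eq0 !jet0 y0 G0 D0 V0 /= expr0n /= mulr0 add0r.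
  by rewrite !mulf_neq0 ?expf_neq0 ?mulf_neq0 ?pnatr_eq0.
rewrite uE -A9_identity -[RHS]mulrA; congr (_ * _).
by rewrite [RHS]mulrA [v * _]mulrC Gv mul1r.
Qed.

End Germs.

Section GermY11.
Variable K : numClosedFieldType.
Implicit Types (s t u v w x y X Y g : pser K) (a b c e : K).

Lemma pserM_quadratic s t : s 0%N 0%N = 0 -> t 0%N 0%N = 0 ->
  [/\ (s * t) 2%N 0%N = s 1%N 0%N * t 1%N 0%N,
      (s * t) 1%N 1%N = s 1%N 0%N * t 0%N 1%N + s 0%N 1%N * t 1%N 0%N
    & (s * t) 0%N 2%N = s 0%N 1%N * t 0%N 1%N].
Proof.
move=> s0 t0; rewrite !pserM !(big_ord_recl, big_ord0) /= !subn0 !subSS !subn0.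
by rewrite s0 t0 !(mulr0, mul0r, addr0, add0r); split=> //; rewrite addrC.
Qed.

Lemma germ_cusp_factor (m V E r th k v x y : pser K) : local_coordinates x y ->
  series_unit v -> convergent m -> convergent V -> convergent k ->
  convergent th -> m 0%N 0%N != 0 -> V 0%N 0%N != 0 ->
  r ^+ 2 = E ^+ 2 + x * V -> th ^+ 2 = - (2 * m * (E + r)) ->
  (r + E) * k = 1 -> germ_A 2 (v * cusp_factor m r th x y).
Proof.
move=> [cx cy x0 y0 lin] [cv v0] cm cV ck cth m0 V0 rE thE kE.
have [|w [cw w0 mw]] := @unit_inverse K (4 * m).
  by split; [conv | rewrite pserM00 pser_nat mulf_neq0 ?pnatr_eq0].
have k0 : k 0%N 0%N != 0.
  apply/eqP => k0; move: (congr1 (fun s : pser K => s 0%N 0%N) kE).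
  by rewrite pserM00 k0 mulr0 => /eqP; rewrite eq_sym oner_eq0.
apply: (@germ_A_of _ 2 _ (v * w) (- (2 * m * V * k)) (2 * m * y + x * th) x).
- split=> //; first by conv.
    by rewrite !jet0 x0 y0 /=; ring.
  rewrite !pserD !pserM10 !pserM01 !pserM00 x0 y0.
  rewrite !(mulr0, mul0r, addr0, add0r) pser_nat /=.
  set d := _ - _; have -> : d = - (2 * m 0%N 0%N)
      * (x 1%N 0%N * y 0%N 1%N - x 0%N 1%N * y 1%N 0%N) by rewrite /d; ring.
  by rewrite mulf_neq0 // oppr_eq0 mulf_neq0 ?pnatr_eq0.
- split; first by conv.
  rewrite pserM00 w0 mulf_neq0 // invr_eq0 pserM00 pser_nat mulf_neq0 //.
  by rewrite pnatr_eq0.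
- split; first by conv.
  by rewrite !jet0 /= oppr_eq0 !mulf_neq0 ?pnatr_eq0.
rewrite -(cusp_factor_identity y rE thE kE) -mulrA; congr (_ * _).
by rewrite mulrA [w * _]mulrC mw mul1r.
Qed.

(** On constant terms the quadratic form [v (m y^2 + th x y - r x^2)] has discriminant zero, so it
    is [v / (4 m)] times the square of [2 m y + th x]; [q] is a root of that factor. *)
Lemma cusp_factor_tangent (m r th v x y : pser K) (q : K) : x 0%N 0%N = 0 ->
  y 0%N 0%N = 0 -> m 0%N 0%N != 0 ->
  th 0%N 0%N ^+ 2 = - (4 * m 0%N 0%N * r 0%N 0%N) ->
  q ^+ 2 = v 0%N 0%N / (4 * m 0%N 0%N) ->
  double_tangent (v * cusp_factor m r th x y)
    (q * (2 * m 0%N 0%N * y 1%N 0%N + th 0%N 0%N * x 1%N 0%N))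
    (q * (2 * m 0%N 0%N * y 0%N 1%N + th 0%N 0%N * x 0%N 1%N)).
Proof.
move=> x0 y0 m0 thE qE.
have -> : v * cusp_factor m r th x y =
  y * (v * m * y) + x * (v * th * y) - x * (v * r * x).
  by rewrite /cusp_factor; ring.
have [] := @pserM_quadratic y (v * m * y) y0; first by rewrite !pserM00 y0 mulr0.
have [] := @pserM_quadratic x (v * th * y) x0; first by rewrite !pserM00 y0 mulr0.
have [] := @pserM_quadratic x (v * r * x) x0; first by rewrite !pserM00 x0 mulr0.
rewrite !pserM10 !pserM01 !pserM00 x0 y0 => x20 x11 x02 xy20 xy11 xy02 y20 y11 y02.
have v0E : v 0%N 0%N = 4 * m 0%N 0%N * q ^+ 2.
  by rewrite qE mulrCA mulfV ?mulr1 // mulf_neq0 ?pnatr_eq0.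
have rE : v 0%N 0%N * r 0%N 0%N = - (th 0%N 0%N ^+ 2 * q ^+ 2).
  by rewrite thE v0E; ring.
rewrite /double_tangent !pserB !pserD x20 x11 x02 xy20 xy11 xy02 y20 y11 y02.
rewrite !mulr0 !addr0 rE v0E.
by split; ring.
Qed.

Lemma germ_Y11_at_cusp a b c x y : local_coordinates x y -> 2 * c = 1 ->
  b = 3 -> 2 * a + 11 != 0 -> germ_Y11 (affine_germ a b c 0 x y).
Proof.
move=> lc c2 b3 an0; have [cx cy x0 y0 lin] := lc.
have ec : 2 * (0 ^+ 2 + c) = 1 by rewrite expr0n /= add0r.
have [cW W0 [u [uu uE]]] := affine_germ_unit a b cx cy x0 y0 ec.
have XE := cuspX_through a b x y c2.
set W := cusp_coord a b c 0 x y in cW W0 uE XE.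
have [cD D0 cV V0] := jet_cusp cx cW x0 W0.
have b0 : 2 * b - 6 = 0 by rewrite b3 -natrM subrr.
rewrite b0 rmorph0 add0r in XE.
set D := cuspD x W in cD D0 XE; set V := cuspV x W in cV V0 uE.
pose E := 2 * D * pserC (2 * a + 11) - 360 * x * (1 - x).
have cE : convergent E by rewrite /E; conv.
pose e := 6 * (2 * a + 11).
have e0 : e != 0 by rewrite mulf_neq0 ?pnatr_eq0.
have E0 : E 0%N 0%N = e.
  by rewrite /E /e !jet0 /pserC x0 D0 /=; ring.
pose m := 4 * D; have cm : convergent m by rewrite /m; conv.
have m0 : m 0%N 0%N = 12 by rewrite /m !jet0 D0 /= -natrM.
have {XE} XE : cuspX x W = m * y ^+ 2 + x ^+ 2 * E.
  by rewrite XE /m /E /D; move: (cuspD x W) (pserC _) => A B; ring.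
have [||r [cr r0 rE]] := @unit_root K 1 (E ^+ 2 + x * V) e.
(* The branch of [r] with [r(0) = e], rather than [- e], is taken so that [E + r] has constant term
   [2 e] and is a unit. *)
- split; first by conv.
  by rewrite !jet0 E0 x0 mul0r addr0 expf_neq0.
- by rewrite !jet0 E0 x0 mul0r addr0.
have [|k [ck _ kE]] := @unit_inverse K (r + E).
  split; first by conv.
  by rewrite pserD r0 E0 -mulr2n mulrn_eq0.
have [|th [[cth th0] thE]] := @unit_root_ex K 1 (- (2 * m * (E + r))).
  split; first by conv.
  rewrite !jet0 m0 E0 r0 /= oppr_eq0 !mulf_neq0 ?pnatr_eq0 //.
  by rewrite -mulr2n mulrn_eq0.
have thE' : (- th) ^+ 2 = - (2 * m * (E + r)) by rewrite sqrrN.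
have mn0 : m 0%N 0%N != 0 by rewrite m0 pnatr_eq0.
have Vn0 : V 0%N 0%N != 0 by rewrite V0 -natrM pnatr_eq0.
have th0E : th 0%N 0%N ^+ 2 = - (4 * m 0%N 0%N * r 0%N 0%N).
  by rewrite -pserX00 thE !jet0 m0 E0 r0 /=; ring.
exists (u * cusp_factor m r th x y), (1 * cusp_factor m r (- th) x y); split.
- move=> i j; rewrite uE XE (Y11_identity y rE thE) mul1r.
  by rewrite -[series_mul _ _]/(_ * _ : pser K) -mulrA.
- exact: (germ_cusp_factor lc uu cm cV ck cth mn0 Vn0 rE thE kE).
- apply: (germ_cusp_factor lc _ cm cV ck _ mn0 Vn0 rE thE' kE).
    by split; [conv | rewrite pser1 oner_eq0].
  by conv.
pose q v : K := sqrtC (v 0%N 0%N / (4 * m 0%N 0%N)).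
have qn0 v : v 0%N 0%N != 0 -> q v != 0.
  by move=> v0; rewrite sqrtC_eq0 mulf_neq0 // invr_eq0 mulf_neq0 ?pnatr_eq0.
exists (q u * (2 * m 0%N 0%N * y 1%N 0%N + th 0%N 0%N * x 1%N 0%N)),
  (q u * (2 * m 0%N 0%N * y 0%N 1%N + th 0%N 0%N * x 0%N 1%N)),
  (q 1 * (2 * m 0%N 0%N * y 1%N 0%N + (- th) 0%N 0%N * x 1%N 0%N)),
  (q 1 * (2 * m 0%N 0%N * y 0%N 1%N + (- th) 0%N 0%N * x 0%N 1%N)).
split.
- by apply: cusp_factor_tangent; rewrite ?sqrtCK.
- by apply: cusp_factor_tangent; rewrite ?sqrtCK // pserN sqrrN.
(* The tangents of the two cusps differ only in the sign of [th], so the determinant is a nonzero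
   multiple of [th(0)]. *)
rewrite pserN; set d := _ - _.
have -> : d = q u * q 1 * (4 * m 0%N 0%N * th 0%N 0%N)
    * (x 1%N 0%N * y 0%N 1%N - x 0%N 1%N * y 1%N 0%N) by rewrite /d; ring.
rewrite !mulf_neq0 ?qn0 ?pser1 ?oner_eq0 ?pnatr_eq0 //.
by case: uu.
Qed.

End GermY11.

Section GermSmooth.
Variable K : numClosedFieldType.
Implicit Types (s t u v w x y X Y g : pser K) (a b c e : K).

Definition series_eval s (p : {poly K}) : pser K := (map_poly (@pserC K) p).[s].

Lemma series_eval_is_zmod_morphism s : zmod_morphism (series_eval s).
Proof. by move=> p q; rewrite /series_eval rmorphB hornerD hornerN. Qed.

Lemma series_eval_is_monoid_morphism s : monoid_morphism (series_eval s).
Proof.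
split=> [|p q]; first by rewrite /series_eval rmorph1 hornerC.
by rewrite /series_eval rmorphM hornerM.
Qed.

HB.instance Definition _ s := GRing.isZmodMorphism.Build {poly K} (pser K)
  (series_eval s) (series_eval_is_zmod_morphism s).
HB.instance Definition _ s := GRing.isMonoidMorphism.Build {poly K} (pser K)
  (series_eval s) (series_eval_is_monoid_morphism s).

Lemma series_evalC s e : series_eval s e%:P = pserC e.
Proof. by rewrite /series_eval map_polyC hornerC. Qed.

Lemma series_evalX s : series_eval s 'X = s.
Proof. by rewrite /series_eval map_polyX hornerX. Qed.

Lemma series_eval0 s p : series_eval s p 0%N 0%N = p.[s 0%N 0%N].
Proof.
elim/poly_ind: p => [|p e IH]; first by rewrite rmorph0 horner0.
rewrite rmorphD rmorphM /= series_evalC series_evalX pserD pserM00 IH.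
by rewrite hornerD hornerM hornerX hornerC.
Qed.

Lemma convergent_series_eval s p : convergent s -> convergent (series_eval s p).
Proof.
move=> cs; elim/poly_ind: p => [|p e IH].
  by rewrite rmorph0 -(rmorph0 (@pserC K)); exact: convergent_pserC.
by rewrite rmorphD rmorphM /= series_evalC series_evalX; conv.
Qed.

End GermSmooth.

Lemma rmorph_trigonal (R S : comNzRingType) (f : {rmorphism R -> S}) x Y z :
  f (trigonal_form x Y z) = trigonal_form (f x) (f Y) (f z).
Proof. by rewrite /trigonal_form !(rmorphD, rmorphN, rmorphM, rmorphXn, rmorph_nat, rmorph1). Qed.

Lemma rmorph_conic (R S : comNzRingType) (f : {rmorphism R -> S}) a b c x z :
  f (conic_form a b c x z) = conic_form (f a) (f b) (f c) (f x) (f z).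
Proof. by rewrite /conic_form !(rmorphD, rmorphM, rmorphXn). Qed.

Lemma rmorph_sextic (R S : comNzRingType) (f : {rmorphism R -> S}) a b c x y z :
  f (sextic_form a b c x y z) =
  sextic_form (f a) (f b) (f c) (f x) (f y) (f z).
Proof. by rewrite /sextic_form rmorph_trigonal rmorphD rmorphXn rmorph_conic. Qed.

Definition trigonal_dY (R : comNzRingType) (x Y z : R) : R :=
  12 * Y ^+ 2 - 3 * (x ^+ 4 - 12 * x ^+ 3 * z + 14 * x ^+ 2 * z ^+ 2
             + 12 * x * z ^+ 3 + z ^+ 4).

Lemma trigonal_form_addY (R : comNzRingType) (x Y w z : R) :
  trigonal_form x (w + Y) z =
  trigonal_form x Y z + w * (trigonal_dY x Y z + 12 * Y * w + 4 * w ^+ 2).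
Proof. by rewrite /trigonal_form /trigonal_dY; ring. Qed.

Lemma rmorph_trigonal_dY (R S : comNzRingType) (f : {rmorphism R -> S}) x Y z :
  f (trigonal_dY x Y z) = trigonal_dY (f x) (f Y) (f z).
Proof. by rewrite /trigonal_dY !(rmorphD, rmorphN, rmorphM, rmorphXn, rmorph_nat, rmorph1). Qed.

Section GermTangency.
Variable K : numClosedFieldType.
Implicit Types (s t u v w x y X Y g : pser K) (a b c e : K).

(** The value of [f] along the section [Y = s(x)]; its roots are the abscissas of the intersections
    with the trigonal curve, counted in the coordinate [x]. *)
Definition section_poly a b c : {poly K} :=
  trigonal_form 'X (conic_form a%:P b%:P c%:P 'X 1) 1.

(** Taylor expansion in [Y] gives [f(x, s + y^2) = f(x, s) + y^2 H], with [H] a unit because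
    [f_Y != 0]. Contact of order [p + 1] thus becomes A_p; multiplying by [H] makes [H * y] the
    squared coordinate. *)
Lemma germ_tangency p a b c e x y (q : {poly K}) : local_coordinates x y ->
  section_poly a b c = ('X - e%:P) ^+ p.+1 * q -> q.[e] != 0 ->
  trigonal_dY e (conic_form a b c e 1) 1 != 0 ->
  germ_A p (sextic_form (pserC a) (pserC b) (pserC c) (pserC e + x) y 1).
Proof.
move=> lc gE q0 dY0; have [cx cy x0 y0 lin] := lc.
set z := pserC e + x; have cz : convergent z by rewrite /z; conv.
have z0 : z 0%N 0%N = e by rewrite /z pserD x0 addr0.
set s := conic_form (pserC a) (pserC b) (pserC c) z 1.
have sE : s = series_eval z (conic_form a%:P b%:P c%:P 'X 1).
  by rewrite rmorph_conic /= !series_evalC series_evalX rmorph1.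
pose H := trigonal_dY z s 1 + 12 * s * y ^+ 2 + 4 * (y ^+ 2) ^+ 2.
have cs : convergent s by rewrite sE; exact: convergent_series_eval.
have cH : convergent H by rewrite /H /trigonal_dY; conv.
have H0 : H 0%N 0%N = trigonal_dY e (conic_form a b c e 1) 1.
  rewrite /H !pserD !pserM00 !pserX00 y0 !expr0n /= !mulr0 !addr0.
  have -> : trigonal_dY z s 1 = series_eval z (trigonal_dY 'X (conic_form a%:P b%:P c%:P 'X 1) 1).
    by rewrite rmorph_trigonal_dY /= -sE series_evalX rmorph1.
  rewrite series_eval0 z0 -[_.[e]]/(horner_eval e _).
  rewrite rmorph_trigonal_dY rmorph_conic /= /horner_eval.
  by rewrite !hornerC hornerX.
have uH : series_unit H by split; rewrite // H0.
have [k [ck k0 Hk]] := unit_inverse uH.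
set g := series_eval z q; have cg : convergent g by exact: convergent_series_eval.
have fE : sextic_form (pserC a) (pserC b) (pserC c) z y 1 =
    x ^+ p.+1 * g + y ^+ 2 * H.
  rewrite /sextic_form trigonal_form_addY -/s -/H; congr (_ + _).
  have -> : trigonal_form z s 1 = series_eval z (section_poly a b c).
    by rewrite rmorph_trigonal /= -sE series_evalX rmorph1.
  rewrite gE rmorphM rmorphXn rmorphB /= series_evalX series_evalC.
  by rewrite /z addrC addKr.
apply: (@germ_A_of _ p _ k (g * H) (H * y) x).
- split=> //; first by conv.
    by rewrite pserM00 y0 mulr0.
  rewrite !pserM10 !pserM01 y0 !mulr0 !addr0 -!mulrA -mulrBr mulf_neq0 ?H0 //.
  by rewrite -oppr_eq0 opprB [X in _ - X]mulrC [X in X - _]mulrC.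
- by split; rewrite // k0 invr_eq0 H0.
- split; first by conv.
  by rewrite pserM00 mulf_neq0 ?H0 // /g series_eval0 z0.
rewrite fE; transitivity (H * k * (x ^+ p.+1 * g + y ^+ 2 * H)).
  by rewrite Hk mul1r.
by move: (x ^+ _) => xp; ring.
Qed.

End GermTangency.

(** * Germs of polynomials as power series *)

Section GermOf.
Variable K : numClosedFieldType.
Implicit Types (s t u v w x y X Y g : pser K) (a b c e : K).

Definition pserX : pser K := fun i j => ((i == 1) && (j == 0))%N%:R.
Definition pserY : pser K := fun i j => ((i == 0) && (j == 1))%N%:R.

Lemma pserXM s i j : (pserX * s) i j = if i is i'.+1 then s i' j else 0.
Proof.
case: i => [|i].
  rewrite pserM big_ord1 big1 // => l _; by rewrite mul0r.
rewrite pserM big_ord_recl big1 ?add0r => [|l _]; last by rewrite mul0r.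
rewrite big_ord_recl [X in _ + X]big1 ?addr0 => [|k _]; last first.
  by rewrite big1 // => l _; rewrite mul0r.
rewrite big_ord_recl big1 ?addr0 => [|l _]; last by rewrite /pserX /= mul0r.
by rewrite /pserX /= mul1r subSS !subn0.
Qed.

Lemma pserYM s i j : (pserY * s) i j = if j is j'.+1 then s i j' else 0.
Proof.
rewrite pserM big_ord_recl /= [X in _ + X]big1 ?addr0 => [|k _]; last first.
  by rewrite big1 // => l _; rewrite mul0r.
case: j => [|j]; first by rewrite big_ord1 mul0r.
rewrite big_ord_recl big_ord_recl big1 ?addr0 => [|l _].
  by rewrite /pserY /= mul0r add0r mul1r subSS !subn0.
by rewrite /pserY /= mul0r.
Qed.

Lemma pserXnM n s i j :
  (pserX ^+ n * s) i j = if (n <= i)%N then s (i - n)%N j else 0.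
Proof.
elim: n i => [|n IH] i; first by rewrite mul1r subn0.
by rewrite exprS -mulrA pserXM; case: i => [|i] //; rewrite IH subSS.
Qed.

Lemma pserYnM n s i j :
  (pserY ^+ n * s) i j = if (n <= j)%N then s i (j - n)%N else 0.
Proof.
elim: n j => [|n IH] j; first by rewrite mul1r subn0.
by rewrite exprS -mulrA pserYM; case: j => [|j] //; rewrite IH subSS.
Qed.

Lemma pser_monomial k l i j :
  (pserX ^+ k * pserY ^+ l) i j = ((i == k) && (j == l))%N%:R.
Proof.
rewrite pserXnM -[pserY ^+ l]mulr1; case: (leqP k i) => [ki|ik].
  rewrite pserYnM; case: (leqP l j) => [lj|jl].
    rewrite pser1 !subn_eq0; congr ((_ && _)%:R); rewrite eqn_leq.
      by rewrite ki andbT.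
    by rewrite lj andbT.
  by rewrite [(j == l)](ltn_eqF jl) andbF.
by rewrite (ltn_eqF ik).
Qed.

Definition germ_coords (i : 'I_2) : pser K :=
  if i == ord0 then pserX else pserY.

(** Reading off coefficients is the evaluation morphism at the two coordinate series; hence germs
    commute with all the forms used here. *)
Lemma germ_ofE (p : {mpoly K[2]}) :
  germ_of p = mmap (@pserC K) germ_coords p :> pser K.
Proof.
apply: series_ext => i j; rewrite /germ_of /mmap.
set m0 := [multinom _].
have pser_sum (I : Type) (r : seq I) (F : I -> pser K) :
    (\sum_(k <- r) F k) i j = \sum_(k <- r) F k i j.
  by elim: r => [|k r IH]; rewrite ?big_nil // !big_cons pserD IH.
rewrite pser_sum.
have term m : (pserC p@_m * mmap1 germ_coords m) i j = p@_m * (m == m0)%:R.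
  rewrite pserCM /mmap1 !big_ord_recl big_ord0 mulr1 pser_monomial.
  congr (_ * _%:R); congr nat_of_bool; apply/idP/eqP => [/andP[/eqP ei /eqP ej]|->].
    apply/mnmP => k; rewrite /m0 [RHS]mnm_tnth.
    have [->|->] : k = ord0 \/ k = lift ord0 ord0.
      by case: k => -[|[|//]] k2; [left | right]; apply: val_inj.
      by rewrite /tnth /= -ei.
    by rewrite /tnth /= -ej.
  by rewrite !mnm_tnth; apply/andP; split; apply/eqP.
under eq_bigr => m _ do rewrite term.
have [m0p|m0p] := boolP (m0 \in msupp p); last first.
  rewrite (memN_msupp_eq0 m0p) big1_seq // => m /= mp.
  by case: eqP mp => [->|_ _]; [rewrite (negPf m0p) | rewrite mulr0].
rewrite (bigD1_seq m0) ?msupp_uniq //= eqxx mulr1 big1 ?addr0 // => m /negPf->.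
by rewrite mulr0.
Qed.

Lemma germ_ofC e : germ_of e%:MP = pserC e :> pser K.
Proof. by rewrite germ_ofE mmapC. Qed.

Lemma germ_of_is_zmod_morphism :
  zmod_morphism (@germ_of K : {mpoly K[2]} -> pser K).
Proof. by move=> p q; rewrite !germ_ofE raddfB. Qed.

Lemma germ_of_is_monoid_morphism :
  monoid_morphism (@germ_of K : {mpoly K[2]} -> pser K).
Proof.
by split=> [|p q]; rewrite !germ_ofE ?rmorph1 ?rmorphM.
Qed.

HB.instance Definition _ := GRing.isZmodMorphism.Build {mpoly K[2]} (pser K)
  (@germ_of K : _ -> pser K) germ_of_is_zmod_morphism.
HB.instance Definition _ := GRing.isMonoidMorphism.Build {mpoly K[2]} (pser K)
  (@germ_of K : _ -> pser K) germ_of_is_monoid_morphism.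

Lemma germ_ofX i : germ_of 'X_i = germ_coords i :> pser K.
Proof. by rewrite germ_ofE mmapX mmap1U. Qed.

Lemma local_coordinatesXY : local_coordinates pserX pserY.
Proof.
split=> //; try by exists 1, 1 => k l; rewrite expr1n mulr1 normr_nat lern1 leq_b1.
by rewrite /pserX /pserY /= mulr1 mulr0 subr0 oner_eq0.
Qed.

(** In the chart [x = 1] the coordinates are [(y, z)], and the symmetry of the sextic puts [- z] in
    the place of [x]. *)
Lemma local_coordinatesYNX : local_coordinates (- pserY) pserX.
Proof.
have [cX cY _ _ _] := local_coordinatesXY.
split=> //; first exact: convergentN.
  by rewrite pserN oppr0.
by rewrite !pserN /pserX /pserY /= oppr0 mul0r sub0r mulr1 opprK oner_eq0.
Qed.

Lemma series_compE (h X Y : pser K) i j : series_comp h X Y i j =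
  \sum_(k < (i + j).+1) \sum_(l < (i + j).+1)
    h k l * (X ^+ k * Y ^+ l) i j.
Proof.
by apply: eq_bigr => k _; apply: eq_bigr => l _; rewrite -!series_expE.
Qed.

Lemma series_compXY (h : pser K) : series_comp h pserX pserY = h :> pser K.
Proof.
apply: series_ext => i j; rewrite series_compE.
have ii : (i < (i + j).+1)%N by rewrite ltnS leq_addr.
have jj : (j < (i + j).+1)%N by rewrite ltnS leq_addl.
rewrite (bigD1 (Ordinal ii)) //= (bigD1 (Ordinal jj)) //=.
rewrite pser_monomial !eqxx mulr1 big1 ?addr0 => [|l lj].
  rewrite big1 ?addr0 // => k ki; rewrite big1 // => l _.
  rewrite pser_monomial.
  by rewrite -val_eqE /= eq_sym in ki; rewrite (negPf ki) mulr0.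
rewrite pser_monomial.
by rewrite -val_eqE /= eq_sym in lj; rewrite (negPf lj) andbF mulr0.
Qed.

Definition series_swap s : pser K := fun i j => s j i.

Lemma series_swap_is_zmod_morphism : zmod_morphism series_swap.
Proof. by move=> s t; apply: series_ext. Qed.

Lemma series_swap_is_monoid_morphism : monoid_morphism series_swap.
Proof.
split=> [|s t]; apply: series_ext => i j.
  by rewrite /series_swap !pser1 andbC.
by rewrite /series_swap !pserM exchange_big.
Qed.

HB.instance Definition _ := GRing.isZmodMorphism.Build (pser K) (pser K)
  series_swap series_swap_is_zmod_morphism.
HB.instance Definition _ := GRing.isMonoidMorphism.Build (pser K) (pser K)
  series_swap series_swap_is_monoid_morphism.

Lemma series_swapX : series_swap pserX = pserY.
Proof. by apply: series_ext => i j; rewrite /series_swap /pserX andbC. Qed.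

Lemma series_swapY : series_swap pserY = pserX.
Proof. by apply: series_ext => i j; rewrite /series_swap /pserY andbC. Qed.

Lemma series_swapC e : series_swap (pserC e) = pserC e.
Proof. by apply: series_ext => i j; rewrite /series_swap /pserC andbC. Qed.

Lemma series_compYX (h : pser K) :
  series_comp h pserY pserX = series_swap h :> pser K.
Proof.
rewrite -[in RHS](series_compXY h); apply: series_ext => i j.
rewrite /series_swap !series_compE addnC; apply: eq_bigr => k _.
apply: eq_bigr => l _; congr (_ * _).
suff -> : pserY ^+ k * pserX ^+ l = series_swap (pserX ^+ k * pserY ^+ l) by [].
by rewrite rmorphM !rmorphXn /= series_swapX series_swapY.
Qed.

End GermOf.

Section GermW12.
Variable K : numClosedFieldType.
Implicit Types (a b c e : K).

(** For the osculating parabola [W = 2 y^2], so only multiples of [y^4], [x^3 y^2] and [x^5] occur.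
    With weight 5 for [y] and 4 for [x] the middle one has weight 22 > 20. The sign [sg] serves the
    two A_4 points at once. *)
Lemma semiquasihomogeneous_at_cusp a b c (sg : K) :
  2 * c = 1 -> b = 3 -> 2 * a + 11 = 0 -> sg != 0 ->
  let h := affine_germ a b c 0 (pserC sg * pserY K) (pserX K) in
  convergent h /\ semiquasihomogeneous_4_5 h.
Proof.
move=> c2 b3 a0 sg0; set x := pserC sg * _; set y := pserX K => /=.
have [cy cx' y0 x'0 _] := local_coordinatesXY K.
have cx : convergent x by rewrite /x; conv.
have x0 : x 0%N 0%N = 0 by rewrite /x pserCM x'0 mulr0.
have ec : 2 * (0 ^+ 2 + c) = 1 by rewrite expr0n /= add0r.
have [cW W0 [u [[cu u0] uE]]] := affine_germ_unit a b cx cy x0 y0 ec.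
have XE := cuspX_through a b x y c2.
set W := cusp_coord a b c 0 x y in cW W0 uE XE.
have [cD D0 cV V0] := jet_cusp cx cW x0 W0.
have b0 : 2 * b - 6 = 0 by rewrite b3 -natrM subrr.
rewrite b0 a0 rmorph0 !(add0r, mul0r, mulr0) in XE.
set D := cuspD x W in cD D0 XE; set V := cuspV x W in cV V0 uE.
pose t1 := u * (4 * D) ^+ 2.
pose t2 := u * (- (2880 * D * (1 - x))) * pserC sg ^+ 3.
pose t3 := u * (V + x * (360 * (1 - x)) ^+ 2) * pserC sg ^+ 5.
have hE : affine_germ a b c 0 x y =
    pserX K ^+ 4 * t1 + pserX K ^+ 2 * (pserY K ^+ 3 * t2) + pserY K ^+ 5 * t3.
  rewrite uE XE /t1 /t2 /t3.
  have assoc n (A B t : pser K) : B ^+ n * (t * A ^+ n) = (A * B) ^+ n * t.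
    by rewrite exprMn [t * _]mulrC mulrA [B ^+ n * _]mulrC.
  rewrite !assoc -/x.
  rewrite -/D -/y; move: (D) (V) (x) (y) => D' V' x' y'; ring.
have t10 : t1 0%N 0%N != 0.
  by rewrite /t1 !jet0 D0 /= mulf_neq0 // expf_neq0 // mulf_neq0 ?pnatr_eq0.
have t30 : t3 0%N 0%N != 0.
  by rewrite /t3 !jet0 x0 V0 /pserC /= mul0r addr0 !mulf_neq0 ?expf_neq0 ?pnatr_eq0.
split.
  by rewrite hE /t1 /t2 /t3; conv.
rewrite hE; split=> [k l kl||]; rewrite !pserD !pserXnM !pserYnM /=.
- rewrite ifF; last by apply: contraTF kl => k4; rewrite -leqNgt -[20%N]addn0 leq_add // (leq_mul2l 5 4).
  rewrite [X in _ + X]ifF; last first.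
    by apply: contraTF kl => l5; rewrite -leqNgt -[20%N]add0n leq_add // (leq_mul2l 4 5).
  case: ifP => [k2|_]; last by rewrite !addr0.
  case: ifP => [l3|_]; last by rewrite !addr0.
  move: kl; rewrite ltnNge (leq_trans _ (leq_add (leq_mul (leqnn 5) k2) (leq_mul (leqnn 4) l3))) //.
- by rewrite !addr0.
- by rewrite !add0r.
Qed.

Lemma affine_germ_swap a b c e x y :
  series_swap (affine_germ a b c e x y) =
  affine_germ a b c e (series_swap x) (series_swap y) :> pser K.
Proof. by rewrite rmorph_sextic /= rmorphD rmorph1 /= !series_swapC. Qed.

Lemma germ_W12_XY a b c : 2 * c = 1 -> b = 3 -> 2 * a + 11 = 0 ->
  germ_W12 (affine_germ a b c 0 (pserX K) (pserY K)).
Proof.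
move=> c2 b3 a0.
have [ch hh] := semiquasihomogeneous_at_cusp c2 b3 a0 (oner_neq0 K).
rewrite rmorph1 mul1r in ch hh.
exists (pserY K), (pserX K), (affine_germ a b c 0 (pserY K) (pserX K)).
split=> //; first exact/local_coordinatesC/local_coordinatesXY.
by move=> i j; rewrite series_compYX affine_germ_swap series_swapX series_swapY.
Qed.

Lemma germ_W12_YNX a b c : 2 * c = 1 -> b = 3 -> 2 * a + 11 = 0 ->
  germ_W12 (affine_germ a b c 0 (- pserY K) (pserX K)).
Proof.
move=> c2 b3 a0.
have n1 : -1 != 0 :> K by rewrite oppr_eq0 oner_eq0.
have [ch hh] := semiquasihomogeneous_at_cusp c2 b3 a0 n1.
rewrite rmorphN rmorph1 mulN1r in ch hh.
exists (pserX K), (pserY K), (affine_germ a b c 0 (- pserY K) (pserX K)).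
split=> //; first exact: local_coordinatesXY.
by move=> i j; rewrite series_compXY.
Qed.

End GermW12.

(** * Singular points of the sextic *)

Section Homogenization.
Variable K : numClosedFieldType.

Definition mnm3 (i j k : nat) : 'X_{1..3} := [multinom [tuple i; j; k]].

Lemma mnm3_eta (m : 'X_{1..3}) :
  m = mnm3 (m 0%R) (m 1%R) (m 2%R).
Proof.
apply/mnmP => i; rewrite /mnm3 [RHS]mnm_tnth.
by case: i => -[|[|[|//]]] h; rewrite /tnth /=; congr (m _); apply: val_inj.
Qed.

Lemma mdeg3 (m : 'X_{1..3}) : mdeg m = (m 0%R + m 1%R + m 2%R)%N.
Proof.
rewrite mdegE !big_ord_recl big_ord0 addn0 addnA.
by congr (_ + _ + _)%N; congr (m _); apply: val_inj.
Qed.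

Lemma mnm2_eta (m : 'X_{1..2}) : m = [multinom [tuple m 0%R; m 1%R]].
Proof.
apply/mnmP => i; rewrite [RHS]mnm_tnth.
by case: i => -[|[|//]] h; rewrite /tnth /=; congr (m _); apply: val_inj.
Qed.

Lemma mnm2E (i j : nat) :
  ([multinom [tuple i; j]] 0%R = i) * ([multinom [tuple i; j]] 1%R = j).
Proof. by rewrite !mnm_tnth. Qed.

Lemma mnm3E (i j k : nat) :
  (mnm3 i j k 0%R = i) * (mnm3 i j k 1%R = j) * (mnm3 i j k 2%R = k).
Proof. by rewrite /mnm3 !mnm_tnth. Qed.

Lemma mdeg2 (m : 'X_{1..2}) : mdeg m = (m 0%R + m 1%R)%N.
Proof.
rewrite mdegE !big_ord_recl big_ord0 addn0.
by congr (_ + _)%N; congr (m _); apply: val_inj.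
Qed.

Definition dehomogenization (F : {mpoly K[3]}) : {mpoly K[2]} :=
  F \mPo [tuple 'X_0; 'X_1; 1].

Lemma mcoeff_dehomogenization d F (m : 'X_{1..2}) : F \is d.-homog ->
  (dehomogenization F)@_m =
  if (m 0%R + m 1%R <= d)%N then F@_(mnm3 (m 0%R) (m 1%R) (d - mdeg m)) else 0.
Proof.
move=> Fd; rewrite /dehomogenization comp_mpolyEX raddf_sum /=.
set m' := mnm3 _ _ _.
have term n : n \in msupp F ->
    (F@_n *: ('X_[n] \mPo [tuple 'X_0; 'X_1; 1]))@_m
    = F@_n * ((mdeg m <= d)%N && (n == m'))%:R.
  move=> nF; have nd : mdeg n = d by apply/eqP; move/dhomogP: Fd => /(_ n nF) ->.
  rewrite comp_mpolyX !big_ord_recl big_ord0 /= mulr1 mcoeffZ.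
  rewrite (_ : tnth _ ord0 = 'X_0) // (_ : tnth _ (lift ord0 ord0) = 'X_1) //.
  rewrite (_ : tnth _ (lift ord0 (lift ord0 ord0)) = 1) // expr1n mulr1.
  rewrite (_ : _ * _ = 'X_[[multinom [tuple n 0%R; n 1%R]]]); last first.
    rewrite [RHS]mpolyXE_id !big_ord_recl big_ord0 mulr1.
    by congr (_ ^+ _ * _ ^+ _); first
      [exact: val_inj | (rewrite mnm_tnth /tnth /=; congr (n _); exact: val_inj)].
  rewrite mcoeffX; congr (_ * _%:R); congr nat_of_bool.
  rewrite -nd mdeg3 mdeg2; apply/eqP/andP => [e|[md /eqP->]].
    rewrite /m' -nd mdeg3 mdeg2 -e !mnm2E leq_addr addKn; split=> //.
    by apply/eqP; exact: mnm3_eta.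
  by rewrite [RHS]mnm2_eta /m' !mnm3E.
rewrite big_seq (eq_bigr (fun n => F@_n * ((mdeg m <= d)%N && (n == m'))%:R)) //.
rewrite -big_seq -mdeg2; case: ifP => md /=; last by rewrite big1 // => n _; rewrite mulr0.
have [mF|mF] := boolP (m' \in msupp F).
  rewrite (bigD1_seq m') ?msupp_uniq //= eqxx mulr1 big1 ?addr0 // => n /negPf->.
  by rewrite mulr0.
rewrite (memN_msupp_eq0 mF) big1_seq // => n /= nF.
by case: eqP nF => [->|_ _]; [rewrite (negPf mF) | rewrite mulr0].
Qed.

Lemma mcoeff_homogenization (p : {mpoly K[2]}) (n : 'X_{1..3}) :
  (homogenization p)@_n =
  if (mdeg n == (msize p).-1)%N then p@_[multinom [tuple n 0%R; n 1%R]] else 0.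
Proof.
rewrite /homogenization raddf_sum /=; set d := (msize p).-1.
set m0 := [multinom [tuple n _; _]].
have term m : m \in msupp p -> (p@_m *: 'X_[[multinom
    [tuple m 0%R; m 1%R; (d - mdeg m)%N]]])@_n = p@_m * ((mdeg n == d) && (m == m0))%:R.
  move=> mp; rewrite mcoeffZ mcoeffX; congr (_ * _%:R); congr nat_of_bool.
  have md : (mdeg m <= d)%N.
    have := msize_mdeg_lt mp; rewrite /d; by case: (msize p).
  rewrite -[[multinom [tuple m 0%R; _; _]]]/(mnm3 _ _ _).
  apply/eqP/andP => [e|[nd /eqP->]].
    rewrite /m0 -e mdeg3 !mnm3E -mdeg2 subnKC //; split=> //.
    by apply/eqP; exact: mnm2_eta.
  by rewrite [RHS]mnm3_eta mdeg2 -(eqP nd) mdeg3 /m0 !mnm2E addKn.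
rewrite big_seq (eq_bigr (fun m => p@_m * ((mdeg n == d)%N && (m == m0))%:R)) //.
rewrite -big_seq; case: ifP => md /=; last by rewrite big1 // => m _; rewrite mulr0.
have [mF|mF] := boolP (m0 \in msupp p).
  rewrite (bigD1_seq m0) ?msupp_uniq //= eqxx mulr1 big1 ?addr0 // => m /negPf->.
  by rewrite mulr0.
rewrite (memN_msupp_eq0 mF) big1_seq // => m /= mp.
by case: eqP mp => [->|_ _]; [rewrite (negPf mF) | rewrite mulr0].
Qed.

(** The monomial [y ^ d] survives setting [z = 1], so the degree does not drop and homogenizing
    restores the same power of [z] everywhere. *)
Lemma dehomogenizationK d F : F \is d.-homog -> F@_(mnm3 0%N d 0%N) != 0 ->
  homogenization (dehomogenization F) = F.
Proof.
move=> Fd F0; set p := dehomogenization F.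
have size_p : msize p = d.+1.
  apply/eqP; rewrite eqn_leq; apply/andP; split.
    rewrite msizeE; apply/bigmax_leqP_seq => m mp _; rewrite ltnS mdeg2.
    move: mp; rewrite mcoeff_msupp (mcoeff_dehomogenization _ Fd).
    by case: ifP => //; rewrite eqxx.
  have : [multinom [tuple 0%N; d]] \in msupp p.
    rewrite mcoeff_msupp (mcoeff_dehomogenization _ Fd) mdeg2 !mnm2E.
    by rewrite add0n leqnn subnn.
  by move/msize_mdeg_lt; rewrite mdeg2 !mnm2E add0n.
apply/mpolyP => n; rewrite mcoeff_homogenization size_p /=.
case: ifP => nd; last by rewrite (dhomog_nemf_coeff Fd) // nd.
rewrite (mcoeff_dehomogenization _ Fd) mdeg2 !mnm2E -(eqP nd) mdeg3.
by rewrite leq_addr addKn -mnm3_eta.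
Qed.

End Homogenization.

(** * The trigonal curve and its rational parametrization *)

Section FormDerivatives.
Variable R : comNzRingType.
Implicit Types x Y z : R.

Definition trigonal_dx x Y z : R :=
  - (3 * Y * (4 * x ^+ 3 - 36 * x ^+ 2 * z + 28 * x * z ^+ 2 + 12 * z ^+ 3))
  + 2 * x * (x ^+ 4 - 18 * x ^+ 3 * z + 74 * x ^+ 2 * z ^+ 2
             + 18 * x * z ^+ 3 + z ^+ 4)
  + (x ^+ 2 + z ^+ 2) * (4 * x ^+ 3 - 54 * x ^+ 2 * z + 148 * x * z ^+ 2
                         + 18 * z ^+ 3).

Definition trigonal_dz x Y z : R :=
  - (3 * Y * (- (12 * x ^+ 3) + 28 * x ^+ 2 * z + 36 * x * z ^+ 2 + 4 * z ^+ 3))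
  + 2 * z * (x ^+ 4 - 18 * x ^+ 3 * z + 74 * x ^+ 2 * z ^+ 2
             + 18 * x * z ^+ 3 + z ^+ 4)
  + (x ^+ 2 + z ^+ 2) * (- (18 * x ^+ 3) + 148 * x ^+ 2 * z + 54 * x * z ^+ 2
                         + 4 * z ^+ 3).

(* [P ^+ 3 - Q ^+ 2] is the discriminant of [4 Y^3 - 3 P Y + Q]. *)
Lemma trigonal_discriminant x z :
  (x ^+ 4 - 12 * x ^+ 3 * z + 14 * x ^+ 2 * z ^+ 2 + 12 * x * z ^+ 3
   + z ^+ 4) ^+ 3
  - ((x ^+ 2 + z ^+ 2) * (x ^+ 4 - 18 * x ^+ 3 * z + 74 * x ^+ 2 * z ^+ 2
                         + 18 * x * z ^+ 3 + z ^+ 4)) ^+ 2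
  = 1728 * x ^+ 5 * z ^+ 5 * (x ^+ 2 - 11 * x * z - z ^+ 2).
Proof. by ring. Qed.

Lemma trigonal_euler x Y z :
  x * trigonal_dx x Y z + z * trigonal_dz x Y z + 2 * Y * trigonal_dY x Y z =
  6 * trigonal_form x Y z.
Proof.
by rewrite /trigonal_dx /trigonal_dz /trigonal_dY /trigonal_form; ring.
Qed.

End FormDerivatives.

Section TrigonalCurve.
Variable K : numClosedFieldType.
Implicit Types x y z Y t l a b c : K.

(** A double root [Y] gives [P = 4 Y^2] and [Q = 8 Y^3], so the discriminant vanishes and
    [x^2 - 11 x z - z^2 = 0]. If [f_x] vanishes as well, so does the [x]-derivative of the
    discriminant, which gives [2 x = 11 z]; the two equations are incompatible. *)
Lemma trigonal_singular x Y z : trigonal_form x Y z = 0 ->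
  trigonal_dY x Y z = 0 -> trigonal_dx x Y z = 0 -> x != 0 -> z != 0 -> False.
Proof.
move=> F0 Y0 X0 xn0 zn0.
pose P := x ^+ 4 - 12 * x ^+ 3 * z + 14 * x ^+ 2 * z ^+ 2
             + 12 * x * z ^+ 3 + z ^+ 4.
pose Q := (x ^+ 2 + z ^+ 2) * (x ^+ 4 - 18 * x ^+ 3 * z + 74 * x ^+ 2 * z ^+ 2
                         + 18 * x * z ^+ 3 + z ^+ 4).
have PE : P = 4 * Y ^+ 2.
  have -> : P = 4 * Y ^+ 2 - trigonal_dY x Y z / 3 by rewrite /trigonal_dY /P; field.
  by rewrite Y0 mul0r subr0.
have QE : Q = 8 * Y ^+ 3.
  have -> : Q = trigonal_form x Y z - 4 * Y ^+ 3 + 3 * Y * P.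
    by rewrite /trigonal_form /P /Q; ring.
  by rewrite F0 PE; ring.
have nz : 1728 * x ^+ 5 * z ^+ 5 != 0.
  by rewrite !mulf_neq0 ?expf_neq0 ?pnatr_eq0.
have q0 : x ^+ 2 - 11 * x * z - z ^+ 2 = 0.
  have := trigonal_discriminant x z; rewrite -/P -/Q PE QE.
  rewrite (_ : _ - _ = 0); last by ring.
  by move=> /esym /eqP; rewrite mulf_eq0 (negPf nz) => /eqP.
have d0 : 1728 * x ^+ 5 * z ^+ 5 * (2 * x - 11 * z) = 0.
  transitivity (16 * Y ^+ 3 * - trigonal_dx x Y z
     - 1728 * 5 * x ^+ 4 * z ^+ 5 * (x ^+ 2 - 11 * x * z - z ^+ 2)); last first.
    by rewrite X0 q0; ring.
  pose Px := 4 * x ^+ 3 - 36 * x ^+ 2 * z + 28 * x * z ^+ 2 + 12 * z ^+ 3.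
  pose Qx := 2 * x * (x ^+ 4 - 18 * x ^+ 3 * z + 74 * x ^+ 2 * z ^+ 2
             + 18 * x * z ^+ 3 + z ^+ 4)
  + (x ^+ 2 + z ^+ 2) * (4 * x ^+ 3 - 54 * x ^+ 2 * z + 148 * x * z ^+ 2
                         + 18 * z ^+ 3).
  have -> : 16 * Y ^+ 3 * - trigonal_dx x Y z =
      3 * (4 * Y ^+ 2) ^+ 2 * Px - 2 * (8 * Y ^+ 3) * Qx.
    by rewrite /trigonal_dx /Px /Qx; ring.
  by rewrite -PE -QE /P /Q /Px /Qx; ring.
have {}d0 : x = 11 / 2 * z.
  move/eqP: d0; rewrite mulf_eq0 (negPf nz) subr_eq0 /= => /eqP e.
  by rewrite mulrAC -e; field.
have : - (125 / 4) * z ^+ 2 = 0 by rewrite -q0 d0; field.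
move/eqP; apply/negP; rewrite mulf_neq0 ?expf_neq0 //.
by rewrite oppr_eq0 mulf_neq0 ?invr_eq0 ?pnatr_eq0.
Qed.

(* The curve is rational: [x / z = t^2 (t - 1) / (t + 1)]. *)
Definition param_x t : K := t ^+ 2 * (t - 1).
Definition param_z t : K := t + 1.
Definition param_Y t : K :=
  (t ^+ 6 - 2 * t ^+ 5 - 5 * t ^+ 4 - 5 * t ^+ 2 + 2 * t + 1) / 2.

Lemma trigonal_param t : trigonal_form (param_x t) (param_Y t) (param_z t) = 0.
Proof. by rewrite /trigonal_form /param_x /param_Y /param_z; field. Qed.

Lemma trigonal_dY_param t : trigonal_dY (param_x t) (param_Y t) (param_z t) =
  144 * t ^+ 5 * (t ^+ 2 + t - 1).
Proof. by rewrite /trigonal_dY /param_x /param_Y /param_z; field. Qed.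

Lemma trigonal_form_scale l x Y z :
  trigonal_form (l * x) (l ^+ 2 * Y) (l * z) = l ^+ 6 * trigonal_form x Y z.
Proof. by rewrite /trigonal_form; ring. Qed.

(* Norm of [A + B t + C t^2] from the three roots to their elementary symmetric
   functions. *)
Lemma cubic_norm (A B C t1 t2 t3 : K) :
  (A + B * t1 + C * t1 ^+ 2) * (A + B * t2 + C * t2 ^+ 2)
    * (A + B * t3 + C * t3 ^+ 2) =
  let e1 := t1 + t2 + t3 in let e2 := t1 * t2 + t1 * t3 + t2 * t3 in
  let e3 := t1 * t2 * t3 in
  A ^+ 3 + A ^+ 2 * B * e1 + A ^+ 2 * C * (e1 ^+ 2 - 2 * e2)
  + A * B ^+ 2 * e2 + A * B * C * (e1 * e2 - 3 * e3)
  + A * C ^+ 2 * (e2 ^+ 2 - 2 * e1 * e3)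
  + B ^+ 3 * e3 + B ^+ 2 * C * e1 * e3 + B * C ^+ 2 * e2 * e3 + C ^+ 3 * e3 ^+ 2.
Proof. by move=> /=; ring. Qed.

(** These are the parameters above [X], the roots of [t^3 - t^2 - X t - X], described by the
    symmetric functions that [cubic_norm] takes. *)
Lemma param_cubic_roots (X : K) : exists t1 t2 t3 : K,
  [/\ t1 + t2 + t3 = 1, t1 * t2 + t1 * t3 + t2 * t3 = - X & t1 * t2 * t3 = X].
Proof.
pose p : {poly K} := 'X^3 - ('X^2 + X *: 'X + X%:P).
have sq : (size ('X^2 + X *: 'X + X%:P : {poly K})%R < 4)%N.
  rewrite ltnS; apply: leq_trans (size_polyD _ _) _; rewrite geq_max.
  rewrite (leq_trans (size_polyC_leq1 _)) // andbT.
  apply: leq_trans (size_polyD _ _) _; rewrite geq_max size_polyXn leqnn /=.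
  by rewrite (leq_trans (size_scale_leq _ _)) // size_polyX.
have sp : size p = 4 by rewrite /p size_polyDl size_polyXn // size_polyN.
have lp : lead_coef p = 1.
  by rewrite /p lead_coefDl ?lead_coefXn // size_polyN size_polyXn.
have [r rE] := closed_field_poly_normal p.
rewrite lp scale1r in rE.
have : size r = 3 by move: sp; rewrite rE size_prod_XsubC => -[].
case: r rE => [|t1 [|t2 [|t3 [|//]]]] // rE _.
have pE u : u ^+ 3 - (u ^+ 2 + X * u + X) = (u - t1) * ((u - t2) * (u - t3)).
  have := congr1 (fun q => q.[u]) rE.
  rewrite /p !big_cons big_nil mulr1 !(hornerE, hornerXn) => ->.
  by [].
exists t1, t2, t3.
(* The three symmetric functions are recovered from the values of the cubic at 0, 1 and -1. *)
have e0 := pE 0; have e1 := pE 1; have e2 := pE (-1).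
have e3E : t1 * t2 * t3 = X.
  transitivity (- ((0 - t1) * ((0 - t2) * (0 - t3)))); first by ring.
  by rewrite -e0; ring.
have s1 : t1 + t2 + t3 + (t1 * t2 + t1 * t3 + t2 * t3) = 1 - X.
  transitivity (- ((-1 - t1) * ((-1 - t2) * (-1 - t3))) - 1 - t1 * t2 * t3).
    by ring.
  by rewrite -e2 e3E; ring.
have s2 : - (t1 + t2 + t3) + (t1 * t2 + t1 * t3 + t2 * t3) = - X - 1.
  transitivity ((1 - t1) * ((1 - t2) * (1 - t3)) - 1 + t1 * t2 * t3).
    by ring.
  by rewrite -e1 e3E; ring.
split=> //.
  set u := t1 + t2 + t3 in s1 s2 *; set v := t1 * t2 + _ + _ in s1 s2.
  transitivity ((u + v - (- u + v)) / 2); first by field.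
  by rewrite s1 s2; field.
set u := t1 + t2 + t3 in s1 s2 *; set v := t1 * t2 + _ + _ in s1 s2 *.
transitivity ((u + v + (- u + v)) / 2); first by field.
by rewrite s1 s2; field.
Qed.

(** Modulo the cubic of the parameter, the ordinate of the parametrization is a quadratic in [t]
    with coefficients in [X]. [A], [B], [C] describe [Y] minus this quadratic; its norm over the
    three parameters above [X] is [f(X, Y) / 4], so one factor vanishes. *)
Lemma trigonal_param_affine (X Y : K) : trigonal_form X Y 1 = 0 ->
  exists2 t, t + 1 != 0
    & X * (t + 1) = param_x t /\ Y * (t + 1) ^+ 2 = param_Y t.
Proof.
move=> F0; have [t1 [t2 [t3 [e1 e2 e3]]]] := param_cubic_roots X.
pose A := Y - (1 / 2 + 3 / 2 * X - X ^+ 2); pose B := 3 * X.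
pose C := - (3 / 2 * (X - 1)).
pose f t := A + B * t + C * t ^+ 2.
have f0 : f t1 * f t2 * f t3 = 0.
  rewrite /f cubic_norm /= e1 e2 e3.
  transitivity (trigonal_form X Y 1 / 4); last by rewrite F0 mul0r.
  by rewrite /A /B /C /trigonal_form; field.
have root t : t ^+ 3 - t ^+ 2 - X * t - X = 0 -> f t = 0 ->
    exists2 t, t + 1 != 0 & X * (t + 1) = param_x t /\
                            Y * (t + 1) ^+ 2 = param_Y t.
  move=> ct ft; exists t.
    apply/eqP => /eqP; rewrite addr_eq0 => /eqP t1'.
    move: ct; rewrite t1' (_ : _ - _ = - 2%:R); last by ring.
    by move/eqP; rewrite oppr_eq0 pnatr_eq0.
  have Xt : X * (t + 1) = param_x t.
    rewrite /param_x; apply/eqP; rewrite -subr_eq0.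
    rewrite (_ : _ - _ = - (t ^+ 3 - t ^+ 2 - X * t - X)); last by ring.
    by rewrite ct oppr0.
  split=> //.
  have YE : Y = 1 / 2 + 3 / 2 * X - X ^+ 2 - 3 * X * t + 3 / 2 * (X - 1) * t ^+ 2.
    by apply/eqP; rewrite -subr_eq0 -ft; apply/eqP; rewrite /f /A /B /C; ring.
  rewrite YE.
  transitivity ((1 / 2 - 3 / 2 * t ^+ 2) * (t + 1) ^+ 2
     + (X * (t + 1)) * (t + 1) * (3 / 2 - 3 * t + 3 / 2 * t ^+ 2)
     - (X * (t + 1)) ^+ 2); first by field.
  by rewrite Xt /param_x /param_Y; field.
have char u v w : u + v + w = 1 -> u * v + u * w + v * w = - X ->
    u * v * w = X -> u ^+ 3 - u ^+ 2 - X * u - X = 0.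
  move=> h1 h2 h3; rewrite -{2}h3.
  rewrite (_ : X * u = - ((u * v + u * w + v * w) * u)); last by rewrite h2; ring.
  rewrite (_ : u ^+ 2 = (u + v + w) * u ^+ 2); last by rewrite h1 mul1r.
  by ring.
move/eqP: f0; rewrite !mulf_eq0 -orbA => /or3P[] /eqP ft; apply: root ft.
- exact: char e1 e2 e3.
- apply: (char t2 t1 t3).
  + by rewrite -e1; ring.
  + by rewrite -e2; ring.
  + by rewrite -e3; ring.
- apply: (char t3 t1 t2).
  + by rewrite -e1; ring.
  + by rewrite -e2; ring.
  + by rewrite -e3; ring.
Qed.

(** The A_4 point on [z = 0] has parameter infinity and forms the first alternative; the other point
    on that line is [t = -1]. *)
Lemma trigonal_param_exists x Y z : trigonal_form x Y z = 0 ->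
  (x != 0) || (z != 0) -> (z = 0 /\ Y = x ^+ 2 / 2) \/
  exists l t, [/\ l != 0, x = l * param_x t, Y = l ^+ 2 * param_Y t
                & z = l * param_z t].
Proof.
move=> F0; have [z0 | z0 _] := eqVneq z 0.
  rewrite z0 orbF in F0 * => x0; move: F0.
  have -> : trigonal_form x Y 0 = (2 * Y - x ^+ 2) ^+ 2 * (Y + x ^+ 2).
    by rewrite /trigonal_form; ring.
  move=> /eqP; rewrite mulf_eq0 expf_eq0 /= subr_eq0 addr_eq0.
  case/orP=> /eqP YE; first by left; split=> //; rewrite -YE; field.
  right; exists (- x / 2), (-1); split.
  - by rewrite mulf_neq0 ?oppr_eq0 ?invr_eq0 ?pnatr_eq0.
  - by rewrite /param_x; field.
  - by rewrite YE /param_Y; field.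
  - by rewrite /param_z addNr mulr0.
right; have : trigonal_form (x / z) (Y / z ^+ 2) 1 = 0.
  have := trigonal_form_scale z (x / z) (Y / z ^+ 2) 1.
  rewrite ![z * _]mulrC ![z ^+ 2 * _]mulrC mul1r !divfK ?expf_neq0 // F0.
  by move=> /esym/eqP; rewrite mulf_eq0 expf_eq0 (negPf z0) /= => /eqP.
case/trigonal_param_affine => t t1 [Xt Yt]; exists (z / (t + 1)), t; split.
- by rewrite mulf_neq0 ?invr_eq0.
- by rewrite -Xt; field; rewrite z0 t1.
- by rewrite -Yt; field; rewrite z0 t1.
- by rewrite /param_z divfK.
Qed.

End TrigonalCurve.

(** * Equations of the singular points in terms of the parameter *)

Section SingularPoints.
Variable K : numClosedFieldType.
Implicit Types x y z Y t l a b c : K.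

(* [(t + 1)^2 (Y - a x^2 - b x - c)] along the parametrization of the trigonal
   curve; [section_slope] is its derivative in [t]. *)
Definition section_value a b c t : K :=
  param_Y t - conic_form a b c (param_x t) (param_z t).

Definition section_slope a b c t : K :=
  3 * t ^+ 5 - 5 * t ^+ 4 - 10 * t ^+ 3 - 5 * t + 1
  - ((2 * a * param_x t + b * param_z t) * (3 * t ^+ 2 - 2 * t)
     + (b * param_x t + 2 * c * param_z t)).

Definition tangency a b c t : Prop :=
  [/\ t != 0, section_value a b c t = 0 & section_slope a b c t = 0].

Definition singular_eqs a b c x y z : Prop :=
  let Y := y ^+ 2 + conic_form a b c x z in
  [/\ trigonal_form x Y z = 0, y * trigonal_dY x Y z = 0,
      trigonal_dx x Y z + trigonal_dY x Y z * (2 * a * x + b * z) = 0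
    & trigonal_dz x Y z + trigonal_dY x Y z * (b * x + 2 * c * z) = 0].

Lemma trigonal_singular_points x Y z : (x != 0) || (z != 0) ->
  trigonal_form x Y z = 0 -> trigonal_dY x Y z = 0 -> trigonal_dx x Y z = 0 ->
  (x = 0 /\ Y = z ^+ 2 / 2) \/ (z = 0 /\ Y = x ^+ 2 / 2).
Proof.
move=> xz F0 Y0 X0; have [x0|x0] := eqVneq x 0.
  left; split=> //; move: xz F0 Y0; rewrite x0 eqxx /= => z0.
  have -> : trigonal_form 0 Y z = (2 * Y - z ^+ 2) ^+ 2 * (Y + z ^+ 2).
    by rewrite /trigonal_form; ring.
  move=> /eqP; rewrite mulf_eq0 expf_eq0 /= subr_eq0 addr_eq0.
  case/orP=> /eqP YE; first by rewrite -YE => _; field.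
  have -> : trigonal_dY 0 Y z = 9 * z ^+ 4 by rewrite /trigonal_dY YE; ring.
  by move=> /eqP; rewrite mulf_eq0 expf_eq0 pnatr_eq0 (negPf z0).
right; have [z0|z0] := eqVneq z 0; last first.
  by case: (trigonal_singular F0 Y0 X0 x0 z0).
split=> //; move: F0 Y0; rewrite z0.
have -> : trigonal_form x Y 0 = (2 * Y - x ^+ 2) ^+ 2 * (Y + x ^+ 2).
  by rewrite /trigonal_form; ring.
move=> /eqP; rewrite mulf_eq0 expf_eq0 /= subr_eq0 addr_eq0.
case/orP=> /eqP YE; first by rewrite -YE => _; field.
have -> : trigonal_dY x Y 0 = 9 * x ^+ 4 by rewrite /trigonal_dY YE; ring.
by move=> /eqP; rewrite mulf_eq0 expf_eq0 pnatr_eq0 (negPf x0).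
Qed.

Lemma conic_form_scale a b c l x z :
  conic_form a b c (l * x) (l * z) = l ^+ 2 * conic_form a b c x z.
Proof. by rewrite /conic_form; ring. Qed.

Lemma trigonal_dx_scale l x Y z :
  trigonal_dx (l * x) (l ^+ 2 * Y) (l * z) = l ^+ 5 * trigonal_dx x Y z.
Proof. by rewrite /trigonal_dx; ring. Qed.

Lemma trigonal_dz_scale l x Y z :
  trigonal_dz (l * x) (l ^+ 2 * Y) (l * z) = l ^+ 5 * trigonal_dz x Y z.
Proof. by rewrite /trigonal_dz; ring. Qed.

Lemma trigonal_dY_scale l x Y z :
  trigonal_dY (l * x) (l ^+ 2 * Y) (l * z) = l ^+ 4 * trigonal_dY x Y z.
Proof. by rewrite /trigonal_dY; ring. Qed.

(* Derivative in [t] of the equation of the curve along its parametrization. *)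
Lemma trigonal_param_slope t :
  trigonal_dx (param_x t) (param_Y t) (param_z t) * (3 * t ^+ 2 - 2 * t)
  + trigonal_dY (param_x t) (param_Y t) (param_z t)
    * (3 * t ^+ 5 - 5 * t ^+ 4 - 10 * t ^+ 3 - 5 * t + 1)
  + trigonal_dz (param_x t) (param_Y t) (param_z t) = 0.
Proof.
by rewrite /trigonal_dx /trigonal_dY /trigonal_dz /param_x /param_Y /param_z; field.
Qed.

(** At the roots of [t^2 + t - 1] the trigonal curve has a vertical tangent, which a section cannot
    share. Up to a power of [t + 1], the combination of slope and value used here is the derivative
    of [N / (t + 1)^2]; modulo [t^2 + t - 1] it equals [- 12 t]. *)
Lemma tangency_not_vertical a b c t : tangency a b c t -> t ^+ 2 + t - 1 != 0.
Proof.
move=> [t0 N0 dN0]; apply/eqP => h.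
have : (t + 1) * section_slope a b c t - 2 * section_value a b c t =
    (t ^+ 2 + t - 1) * (2 * t ^+ 4 - 2 * t ^+ 3 - 6 * t ^+ 2 - 6 * t
       - 2 * t * (2 * a * param_x t + b * param_z t)) - 12 * t.
  by rewrite /section_slope /section_value /conic_form /param_x /param_Y /param_z; field.
rewrite N0 dN0 h !mulr0 mul0r subr0 sub0r => /eqP.
by rewrite eq_sym oppr_eq0 mulf_eq0 pnatr_eq0 (negPf t0).
Qed.

Lemma singular_eqs_scale a b c l x y z : singular_eqs a b c x y z ->
  singular_eqs a b c (l * x) (l * y) (l * z).
Proof.
rewrite /singular_eqs /= conic_form_scale exprMn -mulrDr.
set Y := y ^+ 2 + _ => -[F0 Y0 X0 Z0].
rewrite trigonal_form_scale trigonal_dx_scale trigonal_dz_scale trigonal_dY_scale.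
split.
- by rewrite F0 mulr0.
- by rewrite mulrACA Y0 mulr0.
- rewrite [LHS](_ : _ = l ^+ 5 * (trigonal_dx x Y z + trigonal_dY x Y z * (2 * a * x + b * z))).
    by rewrite X0 mulr0.
  by ring.
- rewrite [LHS](_ : _ = l ^+ 5 * (trigonal_dz x Y z + trigonal_dY x Y z * (b * x + 2 * c * z))).
    by rewrite Z0 mulr0.
  by ring.
Qed.

(** The gradient components [Gx] and [Gz] satisfy two linear equations, Euler's relation and the
    chain rule along the parametrization, with determinant [2 t (t^2 + t - 1) != 0]. *)
Lemma tangency_singular_eqs a b c t : tangency a b c t ->
  singular_eqs a b c (param_x t) 0 (param_z t).
Proof.
move=> T; have tn := tangency_not_vertical T; case: T => t0 N0 dN0.
have sE : conic_form a b c (param_x t) (param_z t) = param_Y t.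
  by apply/esym/eqP; rewrite -subr_eq0; apply/eqP.
rewrite /singular_eqs expr0n /= add0r sE mul0r trigonal_param.
set x := param_x t in sE *; set z := param_z t in sE *.
set Y := param_Y t in sE *.
set Gx := trigonal_dx x Y z + _; set Gz := trigonal_dz x Y z + _.
have eu : x * Gx + z * Gz = 0.
  transitivity (6 * trigonal_form x Y z + 2 * trigonal_dY x Y z * (conic_form a b c x z - Y)).
    by rewrite -trigonal_euler /Gx /Gz /conic_form; ring.
  by rewrite trigonal_param sE subrr !mulr0 addr0.
have ch : Gx * (3 * t ^+ 2 - 2 * t) + Gz = 0.
  transitivity (0 - trigonal_dY x Y z * section_slope a b c t).
    by rewrite -(trigonal_param_slope t) /Gx /Gz /section_slope -/x -/Y -/z; ring.
  by rewrite dN0 mulr0 subr0.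
have dn : z * (3 * t ^+ 2 - 2 * t) - x != 0.
  rewrite (_ : _ - _ = 2 * t * (t ^+ 2 + t - 1)); last first.
    by rewrite /x /z /param_x /param_z; ring.
  by rewrite !mulf_neq0 ?pnatr_eq0.
have Gx0 : Gx = 0.
  apply: (mulfI dn); rewrite mulr0.
  transitivity (z * (Gx * (3 * t ^+ 2 - 2 * t) + Gz) - (x * Gx + z * Gz)).
    by ring.
  by rewrite ch eu mulr0 subrr.
by split=> //; move: ch; rewrite Gx0 mul0r add0r.
Qed.

Lemma cusp0_singular_eqs a b c y z : y ^+ 2 = (1 / 2 - c) * z ^+ 2 ->
  singular_eqs a b c 0 y z.
Proof.
move=> yE; rewrite /singular_eqs.
have -> : y ^+ 2 + conic_form a b c 0 z = z ^+ 2 / 2.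
  by rewrite yE /conic_form; field.
have Y0 : trigonal_dY 0 (z ^+ 2 / 2) z = 0 by rewrite /trigonal_dY; field.
rewrite /= Y0 mulr0 !mul0r !addr0; split=> //.
- by rewrite /trigonal_form; field.
- by rewrite /trigonal_dx; field.
- by rewrite /trigonal_dz; field.
Qed.

Lemma cuspoo_singular_eqs a b c x y : y ^+ 2 = (1 / 2 - a) * x ^+ 2 ->
  singular_eqs a b c x y 0.
Proof.
move=> yE; rewrite /singular_eqs.
have -> : y ^+ 2 + conic_form a b c x 0 = x ^+ 2 / 2.
  by rewrite yE /conic_form; field.
have Y0 : trigonal_dY x (x ^+ 2 / 2) 0 = 0 by rewrite /trigonal_dY; field.
rewrite /= Y0 mulr0 !mul0r !addr0; split=> //.
- by rewrite /trigonal_form; field.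
- by rewrite /trigonal_dx; field.
- by rewrite /trigonal_dz; field.
Qed.

(** Where [y != 0] the covering is unramified and the trigonal curve itself must be singular below.
    Where [y = 0] the section meets the curve, either at an A_4 point or at a parameter where it
    turns out to be tangent. *)
Lemma singular_eqs_cases a b c x y z : [|| x != 0, y != 0 | z != 0] ->
  singular_eqs a b c x y z ->
  [\/ [/\ x = 0, z != 0 & y ^+ 2 = (1 / 2 - c) * z ^+ 2],
      [/\ z = 0, x != 0 & y ^+ 2 = (1 / 2 - a) * x ^+ 2]
    | exists l t, [/\ l != 0, tangency a b c t, x = l * param_x t, y = 0
                    & z = l * param_z t]].
Proof.
move=> xyz; rewrite /singular_eqs; set Y := y ^+ 2 + _ => -[F0 yY0 X0 Z0].
have xz : (x != 0) || (z != 0).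
  apply: contraLR xyz; rewrite negb_or !negbK => /andP[/eqP x0 /eqP z0].
  move: F0; rewrite /Y x0 z0 eqxx /= orbF negbK.
  rewrite (_ : trigonal_form _ _ _ = 4 * y ^+ 6).
    by move=> /eqP; rewrite mulf_eq0 expf_eq0 pnatr_eq0.
  by rewrite /trigonal_form /conic_form; ring.
have cusps : trigonal_dY x Y z = 0 -> trigonal_dx x Y z = 0 ->
  [\/ [/\ x = 0, z != 0 & y ^+ 2 = (1 / 2 - c) * z ^+ 2],
      [/\ z = 0, x != 0 & y ^+ 2 = (1 / 2 - a) * x ^+ 2]
    | exists l t, [/\ l != 0, tangency a b c t, x = l * param_x t, y = 0
                    & z = l * param_z t]].
  move=> dY0 dX0.
  have [[x0 YE]|[z0 YE]] := trigonal_singular_points xz F0 dY0 dX0.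
    apply: Or31; split=> //; first by move: xz; rewrite x0 eqxx.
    move: YE; rewrite /Y /conic_form x0 => /(canRL (addrK _)) ->; by field.
  apply: Or32; split=> //; first by move: xz; rewrite z0 eqxx orbF.
  move: YE; rewrite /Y /conic_form z0 => /(canRL (addrK _)) ->; by field.
have [y0|y0] := eqVneq y 0; last first.
  move/eqP: yY0; rewrite mulf_eq0 (negPf y0) /= => /eqP dY0.
  by apply: cusps => //; move: X0; rewrite dY0 mul0r addr0.
have YE : Y = conic_form a b c x z by rewrite /Y y0 expr0n add0r.
have [[z0 YE']|[l [t [l0 xE YE' zE]]]] := trigonal_param_exists F0 xz.
  apply: Or32; split=> //; first by move: xz; rewrite z0 eqxx orbF.
  have e : a * x ^+ 2 = x ^+ 2 / 2.
    by rewrite -YE' YE /conic_form z0; ring.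
  by rewrite mulrBl e y0 expr0n /=; field.
have sE : conic_form a b c (param_x t) (param_z t) = param_Y t.
  apply: (mulfI (expf_neq0 2 l0)).
  by rewrite -conic_form_scale -xE -zE -YE YE'.
have [t0|t0] := eqVneq t 0.
  apply: Or31; rewrite xE zE y0 t0 /param_x /param_z expr0n /= !mul0r mulr0.
  rewrite add0r mulr1; split=> //.
  have : c = 1 / 2.
    move: sE; rewrite t0 /conic_form /param_x /param_z /param_Y => e.
    by transitivity (a * (0 ^+ 2 * (0 - 1)) ^+ 2 + b * (0 ^+ 2 * (0 - 1)) * (0 + 1) +
     c * (0 + 1) ^+ 2); [ring | rewrite e; field].
  by move=> ->; rewrite subrr mul0r.
rewrite xE zE YE' in X0 Z0.
rewrite trigonal_dx_scale trigonal_dY_scale in X0.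
rewrite trigonal_dz_scale trigonal_dY_scale in Z0.
set dx := trigonal_dx _ _ _ in X0; set dY := trigonal_dY _ _ _ in X0 Z0.
set dz := trigonal_dz _ _ _ in Z0.
have {}X0 : dx + dY * (2 * a * param_x t + b * param_z t) = 0.
  apply: (mulfI (expf_neq0 5 l0)); rewrite mulr0 -[RHS]X0; by ring.
have {}Z0 : dz + dY * (b * param_x t + 2 * c * param_z t) = 0.
  apply: (mulfI (expf_neq0 5 l0)); rewrite mulr0 -[RHS]Z0; by ring.
have sl : dY * section_slope a b c t = 0.
  transitivity (0 - ((dx + dY * (2 * a * param_x t + b * param_z t)) * (3 * t ^+ 2 - 2 * t)
     + (dz + dY * (b * param_x t + 2 * c * param_z t)))).
    by rewrite -(trigonal_param_slope t) -/dx -/dY -/dz /section_slope; ring.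
  by rewrite X0 Z0 mul0r addr0 subr0.
apply: Or33; exists l, t; split=> //; split=> //.
  by rewrite /section_value sE subrr.
(* If the slope did not vanish, then [dY = dx = 0], and the trigonal curve would be singular away
   from its two A_4 points. *)
move/eqP: sl; rewrite mulf_eq0 => /orP[dY0|/eqP //].
have dX0 : dx = 0 by move: X0; rewrite (eqP dY0) mul0r addr0.
have : t ^+ 2 + t - 1 = 0.
  move: dY0; rewrite /dY trigonal_dY_param mulf_eq0 => /orP[|/eqP //].
  by rewrite mulf_eq0 expf_eq0 pnatr_eq0 (negPf t0).
move=> h; exfalso; apply: (@trigonal_singular _ (param_x t) (param_Y t) (param_z t)) => //.
- exact: trigonal_param.
- exact/eqP.
- rewrite /param_x mulf_neq0 ?expf_neq0 // subr_eq0; apply/eqP => t1.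
  by move: h; rewrite t1 expr1n addrK => /eqP; rewrite oner_eq0.
- rewrite /param_z addr_eq0; apply/eqP => t1.
  by move: h; rewrite t1 sqrrN expr1n addrN sub0r => /eqP; rewrite oppr_eq0 oner_eq0.
Qed.

End SingularPoints.

Section Derivations.
Variables (R : comNzRingType) (d : R -> R).
Hypothesis dD : {morph d : x y / x + y}.
Hypothesis dM : forall x y, d (x * y) = d x * y + x * d y.

Lemma derivation0 : d 0 = 0.
Proof. by apply: (addrI (d 0)); rewrite -dD !addr0. Qed.

Lemma derivationN x : d (- x) = - d x.
Proof. by apply: (addrI (d x)); rewrite -dD !addrN derivation0. Qed.

Lemma derivation1 : d 1 = 0.
Proof. by apply: (addrI (d 1)); rewrite addr0 -{3}[1]mulr1 dM mulr1 mul1r. Qed.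

Lemma derivation_nat n : d n%:R = 0.
Proof.
elim: n => [|n IH]; first exact: derivation0.
by rewrite mulrS dD derivation1 IH addr0.
Qed.

Lemma derivationX x n : d (x ^+ n.+1) = n.+1%:R * x ^+ n * d x.
Proof.
elim: n => [|n IH]; first by rewrite expr1 expr0 mulr1 mul1r.
rewrite exprS dM IH [n.+2%:R]mulrS exprS.
by move: (d x) (x ^+ n) (n.+1%:R) => dx q N; ring.
Qed.

Lemma derivation_trigonal x Y z : d (trigonal_form x Y z) =
  trigonal_dx x Y z * d x + trigonal_dY x Y z * d Y + trigonal_dz x Y z * d z.
Proof.
rewrite /trigonal_form.
rewrite !(dD, derivationN, derivationX, derivation_nat, dM).
move: (d x) (d Y) (d z) => dx dY dz.
by rewrite /trigonal_dx /trigonal_dY /trigonal_dz; ring.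
Qed.

Lemma derivation_conic x z y a b c : d a = 0 -> d b = 0 -> d c = 0 ->
  d (y ^+ 2 + conic_form a b c x z) =
  2 * y * d y + (2 * a * x + b * z) * d x + (b * x + 2 * c * z) * d z.
Proof.
move=> a0 b0 c0; rewrite /conic_form !(dD, derivationX, dM) a0 b0 c0.
by move: (d x) (d y) (d z) => dx dy dz; ring.
Qed.

End Derivations.

Section SexticForm.
Variable K : numClosedFieldType.
Implicit Types a b c : K.

Lemma homogM d e f (p q : {mpoly K[3]}) : p \is d.-homog -> q \is e.-homog ->
  (d + e = f)%N -> p * q \is f.-homog.
Proof. by move=> hp hq <-; exact: dhomogM. Qed.

Lemma homogD d e f (p q : {mpoly K[3]}) : p \is d.-homog -> q \is e.-homog ->
  d = f -> e = f -> p + q \is f.-homog.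
Proof. by move=> hp hq df ef; subst; exact: dhomogD. Qed.

Lemma homogN d (p : {mpoly K[3]}) : p \is d.-homog -> - p \is d.-homog.
Proof. by move=> hp; rewrite rpredN. Qed.

Lemma homogX d f n (p : {mpoly K[3]}) : p \is d.-homog -> (d * n = f)%N ->
  p ^+ n \is f.-homog.
Proof. by move=> hp <-; exact: dhomogMn. Qed.

Lemma homogC (e : K) : (e%:MP : {mpoly K[3]}) \is 0.-homog.
Proof. by rewrite -[e%:MP]mulr1 mul_mpolyC rpredZ // dhomog1. Qed.

Lemma homog_nat n : (n%:R : {mpoly K[3]}) \is 0.-homog.
Proof. by rewrite -(rmorph_nat (@mpolyC 3 K)); exact: homogC. Qed.

Lemma homogXU (i : 'I_3) : ('X_i : {mpoly K[3]}) \is 1.-homog.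
Proof. by rewrite dhomogX /= mdeg1. Qed.

Ltac degrees := lazymatch goal with
  | |- is_true (GRing.add _ _ \in _) => eapply homogD; [degrees | degrees | reflexivity | reflexivity]
  | |- is_true (GRing.opp _ \in _) => eapply homogN; degrees
  | |- is_true (GRing.mul _ _ \in _) => eapply homogM; [degrees | degrees | reflexivity]
  | |- is_true (GRing.exp _ _ \in _) => eapply homogX; [degrees | reflexivity]
  | |- is_true (GRing.natmul (GRing.one _) _ \in _) => apply homog_nat
  | |- is_true (mpolyC _ _ \in _) => apply homogC
  | |- is_true (mpolyX _ _ \in _) => apply homogXU
  end.

Definition projective_form a b c : {mpoly K[3]} :=
  sextic_form a%:MP b%:MP c%:MP 'X_(0 : 'I_3) 'X_(1 : 'I_3) 'X_(2 : 'I_3).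

Lemma projective_form_homog a b c : projective_form a b c \is 6.-homog.
Proof.
by rewrite /projective_form /sextic_form /trigonal_form /conic_form; degrees.
Qed.

Lemma meval_form a b c (w : 'I_3 -> K) :
  (projective_form a b c).@[w] = sextic_form a b c (w 0) (w 1) (w 2).
Proof.
rewrite /projective_form rmorph_sextic /=.
by rewrite !mevalC !mevalXU.
Qed.

(** Provides the coefficient of [y ^ 6] in the sextic, as required by [dehomogenizationK], from the
    value at [(0 : 1 : 0)]. *)
Lemma meval_homog d (F : {mpoly K[3]}) : F \is d.-homog ->
  F.@[fun i => (i == 1)%:R] = F@_(mnm3 0%N d 0%N).
Proof.
move=> Fd; rewrite mevalE; set m0 := mnm3 _ _ _.
have term m : m \in msupp F ->
    F@_m * \prod_(i < 3) (i == 1)%:R ^+ m i = F@_m * (m == m0)%:R :> K.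
  move=> mF; congr (_ * _).
  have md := dhomog_mf Fd mF; rewrite /= mdeg3 in md.
  rewrite !big_ord_recl big_ord0 mulr1 /= expr1n mul1r !expr0n -natrM mulnb.
  congr (_%:R); congr nat_of_bool; apply/andP/eqP => [[/eqP e0 /eqP e2]|->].
    have m0E : m 0 = 0%N by rewrite -[RHS]e0; congr (m _); exact: val_inj.
    have m2E : m 2 = 0%N by rewrite -[RHS]e2; congr (m _); exact: val_inj.
    by rewrite [LHS]mnm3_eta /m0 m0E m2E -md m0E m2E add0n addn0.
  by rewrite /m0 /mnm3 !mnm_tnth.
rewrite big_seq (eq_bigr (fun m => F@_m * (m == m0)%:R)) // -big_seq.
have [mF|mF] := boolP (m0 \in msupp F).
  rewrite (bigD1_seq m0) ?msupp_uniq //= eqxx mulr1 big1 ?addr0 // => n /negPf->.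
  by rewrite mulr0.
rewrite (memN_msupp_eq0 mF) big1_seq // => n /= nF.
by case: eqP nF => [->|_ _]; [rewrite (negPf mF) | rewrite mulr0].
Qed.

Lemma comp_sextic_form m (lq : 3.-tuple {mpoly K[m]}) (a b c x y z : {mpoly K[3]}) :
  sextic_form a b c x y z \mPo lq = sextic_form (a \mPo lq) (b \mPo lq)
    (c \mPo lq) (x \mPo lq) (y \mPo lq) (z \mPo lq).
Proof. exact: (rmorph_sextic (comp_mpoly lq)). Qed.

Lemma comp_trigonal_form m (lq : 2.-tuple {mpoly K[m]}) (x Y z : {mpoly K[2]}) :
  trigonal_form x Y z \mPo lq =
  trigonal_form (x \mPo lq) (Y \mPo lq) (z \mPo lq).
Proof. exact: (rmorph_trigonal (comp_mpoly lq)). Qed.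

Lemma trigonalE : @trigonal K = trigonal_form 'X_0 'X_1 1.
Proof.
by rewrite /trigonal /trigonal_form; move: ('X_0) ('X_1) => x y; ring.
Qed.

Lemma sexticE a b c : sextic a b c = projective_form a b c.
Proof.
rewrite -[RHS](@dehomogenizationK _ 6) ?projective_form_homog //; last first.
  rewrite -(meval_homog (projective_form_homog a b c)) meval_form /=.
  rewrite (_ : sextic_form _ _ _ _ _ _ = 4%:R) ?pnatr_eq0 //.
  by rewrite /sextic_form /trigonal_form /conic_form; ring.
rewrite /sextic; congr homogenization; rewrite /dehomogenization.
rewrite [RHS]comp_sextic_form !comp_mpolyC !comp_mpolyXU /=.
rewrite /sextic_form trigonalE comp_trigonal_form !comp_mpolyXU comp_mpoly1 /=.
by congr trigonal_form; rewrite -!mul_mpolyC /conic_form; ring.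
Qed.

Lemma mderiv_trigonal (p q r : {mpoly K[3]}) i :
  (trigonal_form p q r)^`M(i) = trigonal_dx p q r * p^`M(i)
    + trigonal_dY p q r * q^`M(i) + trigonal_dz p q r * r^`M(i).
Proof. exact: (derivation_trigonal (mderivD i) (mderivM i)). Qed.

Lemma mderiv_conic (p q : {mpoly K[3]}) (y : {mpoly K[3]}) a b c i :
  (y ^+ 2 + conic_form a%:MP b%:MP c%:MP p q)^`M(i) =
  2 * y * y^`M(i) + (2 * a%:MP * p + b%:MP * q) * p^`M(i)
  + (b%:MP * p + 2 * c%:MP * q) * q^`M(i).
Proof.
exact: (derivation_conic (mderivD i) (mderivM i) _ _ _ (mderivC i a) (mderivC i b) (mderivC i c)).
Qed.

Lemma mderivXi (i j : 'I_3) : ('X_i : {mpoly K[3]})^`M(j) = (i == j)%:R.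
Proof.
rewrite mderivX mnm1E; case: eqP => [->|_]; last by rewrite scale0r.
rewrite scale1r (_ : (_ - _)%MM = 0%MM) ?mpolyX0 //.
by apply/mnmP => k; rewrite mnmBE subnn mnm0E.
Qed.

End SexticForm.

Section Gradient.
Variables (R S : comNzRingType) (f : {rmorphism R -> S}).

Let f_morph : exists2 g : R -> S, g =1 f & [/\ {morph g : x y / x + y},
  {morph g : x y / x * y}, {morph g : x / - x},
  forall n, {morph g : x / x ^+ n} & forall n, g n%:R = n%:R].
Proof.
exists f => //; split; [exact: rmorphD | exact: rmorphM | exact: rmorphN | |].
  by move=> n; exact: rmorphXn.
exact: rmorph_nat.
Qed.

Lemma rmorph_trigonal_dx x Y z :
  f (trigonal_dx x Y z) = trigonal_dx (f x) (f Y) (f z).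
Proof.
have [g gf [gD gM gN gX gn]] := f_morph.
by rewrite -!gf /trigonal_dx !(gD, gN, gM, gX, gn).
Qed.

Lemma rmorph_trigonal_dz x Y z :
  f (trigonal_dz x Y z) = trigonal_dz (f x) (f Y) (f z).
Proof.
have [g gf [gD gM gN gX gn]] := f_morph.
by rewrite -!gf /trigonal_dz !(gD, gN, gM, gX, gn).
Qed.

End Gradient.

Lemma rmorph_form_gradient (R S : comNzRingType) (f : {rmorphism R -> S})
    (dx dY dz x y z a b c : R) (d0 d1 d2 : nat) :
  f (dx * d0%:R + dY * (2 * y * d1%:R + (2 * a * x + b * z) * d0%:R
       + (b * x + 2 * c * z) * d2%:R) + dz * d2%:R) =
  f dx * d0%:R + f dY * (2 * f y * d1%:R + (2 * f a * f x + f b * f z) * d0%:R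
       + (f b * f x + 2 * f c * f z) * d2%:R) + f dz * d2%:R.
Proof. by rewrite !(rmorphD, rmorphM, rmorph_nat). Qed.

Section PointTypes.
Variable K : numClosedFieldType.
Implicit Types a b c x y z : K.

Lemma mderiv_form a b c i : (projective_form a b c)^`M(i) =
  let x := 'X_(0 : 'I_3) in let y := 'X_(1 : 'I_3) in let z := 'X_(2 : 'I_3) in
  let Y := y ^+ 2 + conic_form a%:MP b%:MP c%:MP x z in
  trigonal_dx x Y z * (0 == i)%:R + trigonal_dY x Y z *
    (2 * y * (1 == i)%:R + (2 * a%:MP * x + b%:MP * z) * (0 == i)%:R
       + (b%:MP * x + 2 * c%:MP * z) * (2 == i)%:R)
  + trigonal_dz x Y z * (2 == i)%:R.
Proof.
by rewrite /projective_form /sextic_form mderiv_trigonal mderiv_conic !mderivXi.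
Qed.

Lemma row3_eq0 (v : 'rV[K]_3) :
  (v != 0) = [|| v 0 0 != 0, v 0 1 != 0 | v 0 2 != 0].
Proof.
apply/idP/idP; last first.
  by apply: contraTneq => ->; rewrite !mxE eqxx.
apply: contraNT; rewrite !negb_or !negbK => /and3P[/eqP v0 /eqP v1 /eqP v2].
apply/eqP/rowP => i; rewrite mxE.
have [->|->|->] : [\/ i = 0, i = 1 | i = 2] by
  case: i => -[|[|[|//]]] h; [apply: Or31|apply: Or32|apply: Or33]; apply: val_inj.
all: by [].
Qed.

Lemma singular_pointE a b c (v : 'rV[K]_3) :
  singular_point (sextic a b c) v <->
  v != 0 /\ singular_eqs a b c (v 0 0) (v 0 1) (v 0 2).
Proof.
rewrite /singular_point sexticE meval_form /singular_eqs /sextic_form /=.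
set x := v 0 0; set y := v 0 1; set z := v 0 2.
set Y := y ^+ 2 + _.
have dE i : ((projective_form a b c)^`M(i)).@[v 0] =
  trigonal_dx x Y z * (0 == i)%:R + trigonal_dY x Y z *
    (2 * y * (1 == i)%:R + (2 * a * x + b * z) * (0 == i)%:R
       + (b * x + 2 * c * z) * (2 == i)%:R)
  + trigonal_dz x Y z * (2 == i)%:R.
  have YE : ('X_(1 : 'I_3) ^+ 2 + conic_form a%:MP b%:MP c%:MP
      'X_(0 : 'I_3) 'X_(2 : 'I_3)).@[v 0] = Y.
    rewrite mevalD (rmorphXn (meval (v 0))) (rmorph_conic (meval (v 0))) /=.
    by rewrite !mevalC !mevalXU.
  rewrite mderiv_form /= (rmorph_form_gradient (meval (v 0))) /=.
  rewrite (rmorph_trigonal_dx (meval (v 0))) (rmorph_trigonal_dz (meval (v 0))).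
  rewrite (rmorph_trigonal_dY (meval (v 0))) /= YE.
  by rewrite !mevalC !mevalXU -/x -/y -/z.
split=> [[v0 F0 d0]|[v0 [F0 yY X0 Z0]]].
  have := (dE 0, (dE 1, dE 2)); rewrite !d0 => -[e0 [e1 e2]].
  split=> //; split=> //.
  - apply: (mulfI (_ : 2 != 0)); first by rewrite pnatr_eq0.
    by rewrite [RHS]mulr0 [RHS]e1 /=; ring.
  - by rewrite [RHS]e0 /=; ring.
  - by rewrite [RHS]e2 /=; ring.
split=> // i; rewrite dE.
have [->|->|->] : [\/ i = 0, i = 1 | i = 2] by
  case: i => -[|[|[|//]]] h; [apply: Or31|apply: Or32|apply: Or33]; apply: val_inj.
- by rewrite /= -X0; ring.
- by rewrite /=; transitivity (2 * (y * trigonal_dY x Y z)); [ring | rewrite yY mulr0].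
- by rewrite /= -Z0; ring.
Qed.

Definition row3 x y z : 'rV[K]_3 := \row_k nth 0 [:: x; y; z] k.

Lemma row3E x y z :
  (row3 x y z 0 0 = x) * (row3 x y z 0 1 = y) * (row3 x y z 0 2 = z).
Proof. by rewrite /row3 !mxE. Qed.

Lemma germ_of_comp a b c (lq : 3.-tuple {mpoly K[2]}) :
  germ_of (projective_form a b c \mPo lq) =
  sextic_form (pserC a) (pserC b) (pserC c) (germ_of (tnth lq 0))
    (germ_of (tnth lq 1)) (germ_of (tnth lq 2)) :> pser K.
Proof.
rewrite comp_sextic_form !comp_mpolyC !comp_mpolyXU -!tnth_nth rmorph_sextic /=.
by rewrite !germ_ofC.
Qed.

Lemma point_type_affine a b c x y T :
  germ_type T (sextic_form (pserC a) (pserC b) (pserC c) (pserC x + pserX K)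
                (pserC y + pserY K) 1) ->
  point_type (sextic a b c) (row3 x y 1) T.
Proof.
move=> gT; exists 2; first by rewrite row3E oner_eq0.
rewrite sexticE /local_equation; set lq := [tuple _ | _ < _].
suff -> : germ_of (projective_form a b c \mPo lq) =
  sextic_form (pserC a) (pserC b) (pserC c) (pserC x + pserX K)
                (pserC y + pserY K) 1 :> pser K by [].
rewrite germ_of_comp /lq !tnth_mktuple !row3E !divr1.
have -> : unlift (2 : 'I_3) 0 = Some 0.
  by rewrite (_ : 0 = lift (2 : 'I_3) 0) ?liftK //; exact: val_inj.
have -> : unlift (2 : 'I_3) 1 = Some 1.
  by rewrite (_ : 1 = lift (2 : 'I_3) 1) ?liftK //; exact: val_inj.
rewrite unlift_none !rmorphD !rmorph0 /= !germ_ofC !germ_ofX rmorph1 addr0.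
by [].
Qed.

(** The symmetry turns the chart [x = 1] into the affine chart of the sextic with parameters
    [(c, - b, a)], so every local result over [x = 0] applies over infinity. *)
Lemma point_type_infinity a b c y T :
  germ_type T (affine_germ c (- b) a y (- pserY K) (pserX K)) ->
  point_type (sextic a b c) (row3 1 y 0) T.
Proof.
move=> gT; exists 0; first by rewrite row3E oner_eq0.
rewrite sexticE /local_equation; set lq := [tuple _ | _ < _].
suff -> : germ_of (projective_form a b c \mPo lq) =
  affine_germ c (- b) a y (- pserY K) (pserX K) :> pser K by [].
rewrite germ_of_comp /affine_germ rmorphN.
rewrite /lq !tnth_mktuple !row3E !divr1.
have -> : unlift (0 : 'I_3) 1 = Some 0.
  by rewrite (_ : 1 = lift (0 : 'I_3) 0) ?liftK //; exact: val_inj.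
have -> : unlift (0 : 'I_3) 2 = Some 1.
  by rewrite (_ : 2 = lift (0 : 'I_3) 1) ?liftK //; exact: val_inj.
rewrite unlift_none !rmorphD !rmorph0 /= !germ_ofC !germ_ofX rmorph1 addr0.
by rewrite add0r [LHS]sextic_form_sym.
Qed.

End PointTypes.

(** * Tangencies of the section *)

Section SectionPolynomial.
Variable K : numClosedFieldType.
Implicit Types (a b c t e x y z : K) (p q : {poly K}).

Lemma poly_all_roots p : (forall t, p.[t] = 0) -> p = 0.
Proof.
move=> p0; apply/eqP; apply: contraT => pn0.
have := @max_poly_roots _ p [seq i%:R | i <- iota 0 (size p)] pn0.
rewrite size_map size_iota ltnn; apply.
  by apply/allP => x _; rewrite /root p0.
by rewrite map_inj_uniq ?iota_uniq // => i j /eqP; rewrite eqr_nat => /eqP.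
Qed.

Lemma poly_eq_away p q e : (forall t, t != e -> p.[t] = q.[t]) -> p = q.
Proof.
move=> pq; apply/eqP; rewrite -subr_eq0.
have : ('X - e%:P) * (p - q) = 0.
  apply: poly_all_roots => t; rewrite hornerM hornerXsubC hornerD hornerN.
  by have [->|/pq->] := eqVneq t e; rewrite subrr ?mul0r ?mulr0.
by move/eqP; rewrite mulf_eq0 polyXsubC_eq0.
Qed.

Lemma root_factor p t : p.[t] = 0 ->
  exists2 q, p = q * ('X - t%:P) & q.[t] = p^`().[t].
Proof.
move=> pt; have /factor_theorem[q pE] : root p t by apply/eqP.
exists q => //; by rewrite pE derivM derivXsubC mulr1 !hornerE subrr mulr0 add0r.
Qed.

Lemma double_root_factor p t : p.[t] = 0 -> p^`().[t] = 0 ->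
  exists2 q, p = q * ('X - t%:P) ^+ 2 & 2 * q.[t] = p^`()^`().[t].
Proof.
move=> /root_factor [q pE qE] dp; move: qE; rewrite dp.
move=> /root_factor [r qE rE]; exists r; first by rewrite pE qE expr2 mulrA.
have -> : p = r * ('X - t%:P) ^+ 2 by rewrite pE qE expr2 mulrA.
by rewrite !derivE !hornerE /= subrr; ring.
Qed.

(** The polynomial [N] with its coefficients displayed. That it has no cubic term, and that its two
    highest and its two lowest coefficients are in the ratios -2 and 2, is what makes double
    tangencies so rigid. *)
Definition secpoly a b c : {poly K} :=
  (1 / 2 - a)%:P * 'X^6 - (1 - 2 * a)%:P * 'X^5 - (5 / 2 + a + b)%:P * 'X^4
  + (b - 5 / 2 - c)%:P * 'X^2 + (1 - 2 * c)%:P * 'X + (1 / 2 - c)%:P.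

Definition section_curvature a b c t : K :=
  15 * t ^+ 4 - 20 * t ^+ 3 - 30 * t ^+ 2 - 5
  - (2 * a * ((3 * t ^+ 2 - 2 * t) ^+ 2 + param_x t * (6 * t - 2))
     + b * ((6 * t - 2) * param_z t + 2 * (3 * t ^+ 2 - 2 * t)) + 2 * c).

Lemma horner_secpoly a b c t : (secpoly a b c).[t] = section_value a b c t.
Proof.
rewrite /secpoly !hornerE /= /section_value /conic_form.
by rewrite /param_Y /param_x /param_z; field.
Qed.

Lemma deriv_secpoly a b c : (secpoly a b c)^`() =
  (1 / 2 - a)%:P * ('X^5 *+ 6) - (1 - 2 * a)%:P * ('X^4 *+ 5)
  - (5 / 2 + a + b)%:P * ('X^3 *+ 4) + (b - 5 / 2 - c)%:P * ('X *+ 2)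
  + (1 - 2 * c)%:P.
Proof.
rewrite /secpoly !(derivD, derivN, deriv_mulC, derivXn, derivX, derivC) /=.
by rewrite mulr1 addr0.
Qed.

Lemma horner_deriv_secpoly a b c t :
  (secpoly a b c)^`().[t] = section_slope a b c t.
Proof.
rewrite deriv_secpoly !(hornerD, hornerN, hornerCM, hornerMn, hornerXn, hornerX, hornerC).
by rewrite /section_slope /param_x /param_z; field.
Qed.

Lemma horner_deriv2_secpoly a b c t :
  (secpoly a b c)^`()^`().[t] = section_curvature a b c t.
Proof.
rewrite deriv_secpoly !(derivD, derivN, deriv_mulC, derivMn, derivXn, derivX, derivC) /=.
rewrite !(hornerD, hornerN, hornerCM, hornerMn, hornerXn, hornerX, hornerC).
by rewrite /section_curvature /param_x /param_z; field.
Qed.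

End SectionPolynomial.

Section Multiplicity.
Variable K : numClosedFieldType.
Implicit Types (a b c t e x y z : K) (p q : {poly K}).

Lemma multiplicity_unique (u v : {poly K}) t m n :
  u * ('X - t%:P) ^+ m = v * ('X - t%:P) ^+ n ->
  u.[t] != 0 -> v.[t] != 0 -> m = n.
Proof.
wlog mn : u v m n / (m <= n)%N => [H e u0 v0|].
  case/orP: (leq_total m n) => h; first exact: (H u v).
  by apply/esym/(H v u) => //; exact/esym.
rewrite -(subnK mn) exprD mulrA => /mulIf e u0 v0.
have {}e : u = v * ('X - t%:P) ^+ (n - m).
  by apply: e; rewrite expf_neq0 // polyXsubC_eq0.
move: mn; rewrite leq_eqVlt => /orP[/eqP -> //|]; first by rewrite subnn.
rewrite -subn_gt0; move: e; case: (n - m)%N => // k e _.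
by move: u0; rewrite e exprSr mulrA hornerM hornerXsubC subrr mulr0 eqxx.
Qed.

Definition param_xp : {poly K} := 'X^2 * ('X - 1).
Definition param_zp : {poly K} := 'X + 1.

Lemma horner_param_xp t : param_xp.[t] = param_x t.
Proof. by rewrite /param_xp /param_x !hornerE. Qed.

Lemma horner_param_zp t : param_zp.[t] = param_z t.
Proof. by rewrite /param_zp /param_z !hornerE. Qed.

Lemma clear_denominators p : exists d (q : {poly K}),
  forall t, param_z t != 0 ->
    q.[t] = param_z t ^+ d * p.[param_x t / param_z t].
Proof.
elim/poly_ind: p => [|p e [d [q qE]]].
  by exists 0%N, 0 => t _; rewrite !horner0 mulr0.
exists d.+1, (q * param_xp + e%:P * param_zp ^+ d.+1) => t zt.
rewrite !(horner_param_xp, horner_param_zp, hornerD, hornerM, horner_exp, hornerC, hornerX).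
by rewrite qE // exprS; field.
Qed.

(** The line over [x] meets the curve at three points: the one of parameter [t] accounts for the
    factor [N], the other two for the second factor, which is [f_Y] where [N = 0]. *)
Lemma section_poly_param a b c t : param_z t != 0 ->
  param_z t ^+ 6 * (section_poly a b c).[param_x t / param_z t] =
  - section_value a b c t * (144 * t ^+ 5 * (t ^+ 2 + t - 1)
    - 12 * param_Y t * section_value a b c t + 4 * section_value a b c t ^+ 2).
Proof.
move=> zt; set x := _ / _.
have -> : (section_poly a b c).[x] = trigonal_form x (conic_form a b c x 1) 1.
  rewrite -[_.[x]]/(horner_eval x _) /section_poly.
  rewrite (rmorph_trigonal (horner_eval x)) (rmorph_conic (horner_eval x)) /=.
  by rewrite /horner_eval !hornerC hornerX.
rewrite -trigonal_form_scale -conic_form_scale mulr1 mulrC divfK //.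
set s := conic_form _ _ _ _ _.
have -> : s = - section_value a b c t + param_Y t.
  by rewrite /section_value -/s opprB subrK.
by rewrite trigonal_form_addY trigonal_param trigonal_dY_param; ring.
Qed.

Definition residual a b c : {poly K} :=
  144%:P * 'X ^+ 5 * ('X ^+ 2 + 'X - 1)
  - 12%:P * (2^-1%:P * ('X ^+ 6 - 2%:P * 'X ^+ 5 - 5%:P * 'X ^+ 4
             - 5%:P * 'X ^+ 2 + 2%:P * 'X + 1)) * secpoly a b c
  + 4%:P * secpoly a b c ^+ 2.

Lemma horner_residual a b c t : (residual a b c).[t] =
  144 * t ^+ 5 * (t ^+ 2 + t - 1)
    - 12 * param_Y t * section_value a b c t + 4 * section_value a b c t ^+ 2.
Proof.
rewrite /residual -horner_secpoly; set S := secpoly a b c.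
rewrite !(hornerD, hornerN, hornerM, horner_exp, hornerX, hornerC).
by rewrite /param_Y; move: (S.[t]) => s; field.
Qed.

(* The contact of the section with the curve is the same in the coordinate [x]
   and in the parameter [t] where the parametrization has [dx / dt != 0]. *)
Lemma section_poly_factor a b c t m n : tangency a b c t -> param_z t != 0 ->
  secpoly a b c = n * ('X - t%:P) ^+ m -> n.[t] != 0 ->
  let x := param_x t / param_z t in
  exists2 q, section_poly a b c = ('X - x%:P) ^+ m * q & q.[x] != 0.
Proof.
move=> T zt nE n0 x; have tn := tangency_not_vertical T.
case: T => t0 N0 dN0.
have [k [q q0 gE]] := multiplicity_XsubC (section_poly a b c) x.
have [d [q' q'E]] := clear_denominators q.
(* The roots of [L] are the two other parameters above [x]; [L.[t] != 0] expresses that [t] is not a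
   ramification point. *)
pose L : {poly K} := 'X^2 + (t - 1)%:P * 'X + (t ^+ 2 - t - x)%:P.
have xz : x * param_z t = param_x t by rewrite /x divfK.
have LE u : param_x u - x * param_z u = (u - t) * L.[u].
  rewrite /L !hornerE /=.
  transitivity ((u - t) * (u ^+ 2 + (t - 1) * u + (t ^+ 2 - t - x)) + (param_x t - x * param_z t)).
    by rewrite /param_x /param_z; ring.
  by rewrite xz subrr addr0; ring.
have L0 : L.[t] != 0.
  have : L.[t] * param_z t = 2 * t * (t ^+ 2 + t - 1).
    rewrite /L !hornerE /=.
    transitivity ((3 * t ^+ 2 - 2 * t) * param_z t - x * param_z t); first by ring.
    by rewrite xz /param_x /param_z; ring.
  move=> e; apply: contra_neq t0 => L0; move: e; rewrite L0 mul0r => /esym/eqP.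
  by rewrite !mulf_eq0 pnatr_eq0 (negPf tn) orbF /= => /eqP.
have R0 : (residual a b c).[t] != 0.
  by rewrite horner_residual N0 !mulr0 expr0n /= mulr0 subr0 addr0 !mulf_neq0 ?expf_neq0 ?pnatr_eq0.
(* Both sides are [f] along the section at the parameter [u], cleared of denominators: the left
   shows order [m] at [t], the right order [k]. *)
have key : (- (param_zp ^+ (d + k) * n * residual a b c)) * ('X - t%:P) ^+ m =
    (param_zp ^+ 6 * q' * L ^+ k) * ('X - t%:P) ^+ k.
  apply: (@poly_eq_away _ _ _ (-1)) => u un1.
  have zu : param_z u != 0 by rewrite /param_z addr_eq0.
  have secE := horner_secpoly a b c u.
  rewrite nE hornerM in secE.
  rewrite !(horner_param_zp, hornerM, hornerN, horner_exp) q'E // horner_residual.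
  rewrite hornerXsubC horner_exp hornerXsubC in secE *.
  transitivity (param_z u ^+ (d + k) * (param_z u ^+ 6 * (section_poly a b c).[param_x u / param_z u])).
    by rewrite section_poly_param // -secE; ring.
  rewrite gE hornerM horner_exp hornerXsubC exprD.
  transitivity (param_z u ^+ d * param_z u ^+ 6 * q.[param_x u / param_z u] * (param_z u * (param_x u / param_z u - x)) ^+ k).
    by rewrite exprMn; ring.
  have -> : param_z u * (param_x u / param_z u - x) = (u - t) * L.[u].
    by rewrite -LE mulrBr [_ * (_ / _)]mulrC divfK // [x * _]mulrC.
  by rewrite exprMn; ring.
have zE := horner_param_zp t.
have A0 : (- (param_zp ^+ (d + k) * n * residual a b c)).[t] != 0.
  by rewrite hornerN oppr_eq0 !hornerM horner_exp zE !mulf_neq0 ?expf_neq0.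
have g0 : section_poly a b c != 0.
  apply/eqP => g0; have s0 : secpoly a b c * residual a b c = 0.
    apply: (@poly_eq_away _ _ _ (-1)) => u un1.
    have zu : param_z u != 0 by rewrite /param_z addr_eq0.
    rewrite hornerM horner_secpoly horner_residual horner0.
    apply/eqP; rewrite -oppr_eq0 -mulNr -section_poly_param //.
    by rewrite g0 horner0 mulr0.
  move/eqP: s0; rewrite nE !mulf_eq0 expf_eq0 polyXsubC_eq0 andbF orbF.
  by case/orP => /eqP e0; move: n0 R0; rewrite e0 horner0 eqxx.
have {}q0 : q.[x] != 0 by move: q0; rewrite g0.
have mk : m = k.
  apply: multiplicity_unique key A0 _.
  by rewrite !hornerM !horner_exp zE q'E // !mulf_neq0 ?expf_neq0.
by exists q; rewrite // mk gE mulrC.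
Qed.

End Multiplicity.

(** * Sections with two tangencies *)

Section DoubleTangency.
Variable K : numClosedFieldType.
Implicit Types (a b c t u x y z : K) (p q : K).

Lemma sextic_coefficients (d0 d1 d2 d3 d4 d5 d6 : K) :
  (forall t, d6 * t ^+ 6 + d5 * t ^+ 5 + d4 * t ^+ 4 + d3 * t ^+ 3
             + d2 * t ^+ 2 + d1 * t + d0 = 0) ->
  [/\ d0 = 0, d1 = 0, d2 = 0 & d3 = 0] /\ [/\ d4 = 0, d5 = 0 & d6 = 0].
Proof.
move=> d0E; pose s := [:: d0; d1; d2; d3; d4; d5; d6].
have s0 : Poly s = 0.
  apply: poly_all_roots => t; rewrite -[RHS](d0E t) horner_Poly /=; ring.
have c i : s`_i = 0 by rewrite -coef_Poly s0 coef0.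
by split; split; [exact: c 0%N | exact: c 1%N | exact: c 2%N | exact: c 3%N
  | exact: c 4%N | exact: c 5%N | exact: c 6%N].
Qed.

(** Comparing coefficients leaves four relations free of [a], [b], [c]: the ratios -2 and 2 at the
    two ends, the missing cubic term, and the affine relation [phi]. They cut the five unknowns down
    to a one-parameter family. *)
Lemma double_double_coefficients a b c p q n0 n1 n2 : q != 0 ->
  (forall t, section_value a b c t =
     (n2 * t ^+ 2 + n1 * t + n0) * (t ^+ 2 + p * t + q) ^+ 2) ->
  [/\ q = - p ^+ 2, (1 / 2 - a) * ((p - 1) * (p ^+ 2 + 3 * p + 1) ^+ 2) = - 6,
      n2 = 1 / 2 - a, n1 = - (2 * (1 + p) * (1 / 2 - a))
    & n0 = - (p * (1 / 2 - a))] /\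
  (c = 1 / 2 + (1 / 2 - a) * p ^+ 5 /\
   b = - 3 + (1 / 2 - a) * (5 * p ^+ 2 + 5 * p + 1)).
Proof.
move=> q0 NE; set A := 1 / 2 - a.
pose C := 1 / 2 - c; pose e4 := - (5 / 2 + a + b); pose e2 := b - 5 / 2 - c.
have [|[E0 E1 E2 E3] [E4 E5 E6]] := @sextic_coefficients
  (n0 * q ^+ 2 - C) (n1 * q ^+ 2 + 2 * p * q * n0 - 2 * C)
  (n2 * q ^+ 2 + 2 * p * q * n1 + (p ^+ 2 + 2 * q) * n0 - e2)
  (2 * p * q * n2 + (p ^+ 2 + 2 * q) * n1 + 2 * p * n0)
  ((p ^+ 2 + 2 * q) * n2 + 2 * p * n1 + n0 - e4)
  (2 * p * n2 + n1 + 2 * A) (n2 - A).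
  move=> t; have := NE t => /eqP; rewrite eq_sym -subr_eq0 => /eqP <-.
  rewrite /section_value /conic_form /param_Y /param_x /param_z.
  by rewrite /A /C /e4 /e2; field.
have {E6} n2E : n2 = A by apply/eqP; rewrite -subr_eq0 E6.
have {E5} n1E : n1 = - (2 * (1 + p) * A).
  by apply/eqP; rewrite -subr_eq0 -E5 n2E; apply/eqP; ring.
have CE : C = n0 * q ^+ 2 by apply/esym/eqP; rewrite -subr_eq0 E0.
have e4E : e4 = (p ^+ 2 + 2 * q) * n2 + 2 * p * n1 + n0.
  by apply/esym/eqP; rewrite -subr_eq0 E4.
have e2E : e2 = n2 * q ^+ 2 + 2 * p * q * n1 + (p ^+ 2 + 2 * q) * n0.
  by apply/esym/eqP; rewrite -subr_eq0 E2.
(* The only inhomogeneous relation; its -6 excludes the zero solution as well as the spurious branch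
   below. *)
have phi : e4 + e2 - A - C = - 6 by rewrite /e4 /e2 /A /C; field.
have F1 : n0 * (q - p) = - (A * q * (1 + p)).
  apply: (mulfI q0); apply: (mulfI (_ : 2 != 0)); first by rewrite pnatr_eq0.
  apply/eqP; rewrite -subr_eq0 -oppr_eq0 -E1 CE n1E; apply/eqP; ring.
have F2 : p * n0 = A * ((1 + p) * (p ^+ 2 + 2 * q) - p * q).
  apply: (mulfI (_ : 2 != 0)); first by rewrite pnatr_eq0.
  apply/eqP; rewrite -subr_eq0 -E3 n1E n2E; apply/eqP; ring.
have A0 : A != 0.
  apply/eqP => A0; have n00 : n0 = 0.
    rewrite A0 mul0r in F2; rewrite A0 !mul0r oppr0 in F1.
    apply: (mulfI q0); rewrite mulr0.
    by transitivity (n0 * (q - p) + p * n0); [ring | rewrite F1 F2 addr0].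
  move: phi; rewrite e4E e2E CE n2E n1E n00 A0.
  rewrite (_ : _ - _ = 0); last by ring.
  by move=> /eqP; rewrite eq_sym oppr_eq0 pnatr_eq0.
(* Obtained by eliminating [n0] between [F1] and [F2]. *)
have F3 : (q + p ^+ 2) * ((p + 2) * q - p * (p + 1)) = 0.
  apply: (mulfI A0); rewrite mulr0.
  transitivity ((q - p) * (A * ((1 + p) * (p ^+ 2 + 2 * q) - p * q)) - p * (- (A * q * (1 + p)))).
    by ring.
  by rewrite -F1 -F2; ring.
have qE : q = - p ^+ 2.
  move/eqP: F3; rewrite mulf_eq0 => /orP[|]; first by rewrite addr_eq0 => /eqP.
  (* On the second branch the coefficients make the left side of [phi] vanish. *)
  rewrite subr_eq0 => /eqP F3; exfalso.
  have p20 : p + 2 != 0.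
    apply/eqP => p2; move: F3; rewrite p2 mul0r => /esym/eqP.
    rewrite (_ : p = - 2); last by apply/eqP; rewrite -addr_eq0 p2.
    by rewrite (_ : _ * _ = 2%:R) ?pnatr_eq0 //; ring.
  have p0 : p != 0.
    apply: contra_neq q0 => p0; apply: (mulfI p20).
    by rewrite F3 p0 !mul0r mulr0.
  have n0E : n0 = A * (1 + p) ^+ 2.
    apply: (mulfI p0).
    transitivity (- (n0 * ((p + 2) * q - (p + 2) * p))).
      by rewrite F3; ring.
    transitivity (- ((p + 2) * (n0 * (q - p)))); first by ring.
    rewrite F1; transitivity (A * ((p + 2) * q) * (1 + p)); first by ring.
    by rewrite F3; ring.
  have qF : q = p * (p + 1) / (p + 2).
    by apply: (mulfI p20); rewrite F3; field.
  have : e4 + e2 - A - C = 0.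
    by rewrite e4E e2E CE n2E n1E n0E qF; field.
  by rewrite phi => /eqP; rewrite oppr_eq0 pnatr_eq0.
have p0 : p != 0.
  by apply: contra_neq q0 => p0; rewrite qE p0 expr0n oppr0.
have n0E : n0 = - (p * A).
  by apply: (mulfI p0); rewrite F2 qE; ring.
split; [split=> // | split].
- by rewrite -phi e4E e2E CE n2E n1E n0E qE; ring.
- transitivity (1 / 2 - C); first by rewrite /C; ring.
  by rewrite CE n0E qE; ring.
- transitivity (- e4 - 3 + A); first by rewrite /e4 /A; field.
  by rewrite e4E n2E n1E n0E qE; ring.
Qed.

End DoubleTangency.

Section Tangencies.
Variable K : numClosedFieldType.
Implicit Types (a b c t u x y z : K) (p q : K).

Lemma size_secpoly a b c : (size (secpoly a b c) <= 7)%N.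
Proof.
have -> : secpoly a b c = Poly [:: 1 / 2 - a *+ 0 - c; 1 - 2 * c; b - 5 / 2 - c; 0;
   - (5 / 2 + a + b); - (1 - 2 * a); 1 / 2 - a].
  apply: (@poly_eq_away _ _ _ 0) => u _.
  rewrite horner_Poly horner_secpoly /section_value /conic_form /=.
  by rewrite /param_Y /param_x /param_z mulr0n; field.
exact: size_Poly.
Qed.

Lemma quadratic_cofactor a b c (s m : {poly K}) : secpoly a b c = s * m ->
  m \is monic -> size m = 5 -> exists n0 n1 n2,
    forall u, s.[u] = n2 * u ^+ 2 + n1 * u + n0.
Proof.
move=> sE mm sm; have [s0|s0] := eqVneq s 0.
  by exists 0, 0, 0 => u; rewrite s0 horner0; ring.
have ss : (size s <= 3)%N.
  have := size_secpoly a b c; rewrite sE size_Mmonic // sm addnC /=.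
  by rewrite -(leq_add2l 4).
exists s`_0, s`_1, s`_2 => u; rewrite (horner_coef_wide _ ss).
by rewrite !big_ord_recl big_ord0 /=; ring.
Qed.

Lemma secpoly_double a b c t : tangency a b c t -> exists2 n,
  secpoly a b c = n * ('X - t%:P) ^+ 2 & 2 * n.[t] = section_curvature a b c t.
Proof.
move=> [_ N0 dN0]; rewrite -horner_deriv2_secpoly.
by apply: double_root_factor; rewrite ?horner_secpoly ?horner_deriv_secpoly.
Qed.

Lemma tangency_simple a b c t : tangency a b c t ->
  section_curvature a b c t != 0 ->
  exists2 n, secpoly a b c = n * ('X - t%:P) ^+ 2 & n.[t] != 0.
Proof.
move=> /secpoly_double [n nE n2] cn; exists n => //.
by apply: contra_neq cn => n0; rewrite -n2 n0 mulr0.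
Qed.

(** A quadruple root is the confluent case [p = - 2 t], [q = t^2] of two double roots; there
    [q = - p^2] reads [5 t^2 = 0]. *)
Lemma no_quadruple_contact a b c t (s : {poly K}) : t != 0 ->
  secpoly a b c = s * ('X - t%:P) ^+ 4 -> False.
Proof.
move=> t0 sE.
have [||n0 [n1 [n2 nE]]] := quadratic_cofactor sE.
- by rewrite monic_exp // monicXsubC.
- by rewrite size_exp_XsubC.
have [] := @double_double_coefficients _ a b c (- (2 * t)) (t ^+ 2) n0 n1 n2.
- by rewrite expf_neq0.
- move=> u; rewrite -horner_secpoly sE hornerM nE horner_exp hornerXsubC.
  by ring.
move=> [e _ _ _ _] _; move: e => /eqP; rewrite -subr_eq0.
rewrite (_ : _ - _ = 5 * t ^+ 2); last by ring.
by rewrite mulf_eq0 pnatr_eq0 expf_eq0 (negPf t0).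
Qed.

Lemma tangency_triple a b c t : tangency a b c t ->
  section_curvature a b c t = 0 ->
  exists2 n, secpoly a b c = n * ('X - t%:P) ^+ 3 & n.[t] != 0.
Proof.
move=> T c0; have [n nE n2] := secpoly_double T.
have n0 : n.[t] = 0.
  by apply: (mulfI (_ : 2 != 0)); rewrite ?pnatr_eq0 // n2 c0 mulr0.
have [r rE _] := root_factor n0; exists r.
  by rewrite nE rE -mulrA -exprS.
apply/eqP => r0; have [s sE _] := root_factor r0.
case: T => t0 _ _; apply: (@no_quadruple_contact a b c t s t0).
by rewrite nE rE sE -!mulrA -!exprS.
Qed.

Lemma two_tangencies a b c t1 t2 : t1 != t2 -> tangency a b c t1 ->
  tangency a b c t2 -> let p := - (t1 + t2) in
  [/\ t1 * t2 = - p ^+ 2,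
      (1 / 2 - a) * ((p - 1) * (p ^+ 2 + 3 * p + 1) ^+ 2) = - 6,
      c = 1 / 2 + (1 / 2 - a) * p ^+ 5,
      b = - 3 + (1 / 2 - a) * (5 * p ^+ 2 + 5 * p + 1)
    & exists2 n : {poly K},
        secpoly a b c = n * (('X - t1%:P) * ('X - t2%:P)) ^+ 2
      & forall u, n.[u] = (1 / 2 - a) * (u ^+ 2 - 2 * (1 + p) * u - p)].
Proof.
move=> t12 T1 T2 p; have [r rE _] := secpoly_double T1.
have d0 : t2 - t1 != 0 by rewrite subr_eq0 eq_sym.
case: (T1) (T2) => t10 _ _ [t20 N0 dN0].
have [m mE m0] : exists2 m, secpoly a b c = r * m & m.[t2] != 0.
  exists (('X - t1%:P) ^+ 2); rewrite // horner_exp hornerXsubC.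
  by rewrite expf_neq0.
rewrite -horner_secpoly mE hornerM in N0.
have r0 : r.[t2] = 0.
  by move/eqP: N0; rewrite mulf_eq0 (negPf m0) orbF => /eqP.
rewrite -horner_deriv_secpoly mE derivM hornerD !hornerM r0 mul0r addr0 in dN0.
have dr0 : r^`().[t2] = 0.
  by move/eqP: dN0; rewrite mulf_eq0 (negPf m0) orbF => /eqP.
have [n nE _] := double_root_factor r0 dr0.
have sE : secpoly a b c = n * (('X - t1%:P) * ('X - t2%:P)) ^+ 2.
  by rewrite rE nE exprMn -mulrA [_ ^+ 2 * _ ^+ 2]mulrC.
have [||n0 [n1 [n2 hE]]] := quadratic_cofactor sE.
- by rewrite monic_exp // monicMl ?monicXsubC.
- by rewrite exprMn size_Mmonic ?monic_exp ?monicXsubC // ?size_exp_XsubC //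
    expf_neq0 // polyXsubC_eq0.
have [] := @double_double_coefficients _ a b c p (t1 * t2) n0 n1 n2.
- by rewrite mulf_neq0.
- move=> u; rewrite -horner_secpoly sE hornerM hE horner_exp hornerM !hornerXsubC.
  by rewrite /p; ring.
move=> [qE AE n2E n1E n0E] [cE bE]; split=> //; exists n => // u.
by rewrite hE n2E n1E n0E; ring.
Qed.

Lemma double_tangency_neq0 (A p : K) :
  A * ((p - 1) * (p ^+ 2 + 3 * p + 1) ^+ 2) = - 6 ->
  [/\ A != 0, p - 1 != 0 & p ^+ 2 + 3 * p + 1 != 0].
Proof.
move=> AE; have : A * ((p - 1) * (p ^+ 2 + 3 * p + 1) ^+ 2) != 0.
  by rewrite AE oppr_eq0 pnatr_eq0.
move=> H; split; apply: contraNneq H => ->;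
  by rewrite ?expr0n /= ?mulr0 ?mul0r ?mulr0.
Qed.

(** A triple root would be common to [t^2 + p t - p^2] and the residual quadratic. Their difference
    is linear in [t], and the resultant is [5 p^2 (p^2 + 3 p + 1)] up to sign, with no factor
    zero. *)
Lemma two_tangencies_curvature a b c t1 t2 : t1 != t2 -> tangency a b c t1 ->
  tangency a b c t2 -> section_curvature a b c t1 != 0.
Proof.
move=> t12 T1 T2; have [qE AE _ _ [n sE nE]] := two_tangencies t12 T1 T2.
set p := - (t1 + t2) in qE AE nE; set A := 1 / 2 - a in AE nE.
have [A0 _ D0] := double_tangency_neq0 AE.
have t10 : t1 != 0 by case: T1.
have p0 : p != 0.
  apply: contra_neq t10 => p0; move: qE; rewrite p0 expr0n oppr0 => /eqP.
  by rewrite mulf_eq0 => /orP[/eqP //|]; case: T2 => /negPf->.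
have [m mE m2] := secpoly_double T1; rewrite -m2 mulf_neq0 ?pnatr_eq0 //.
have mE' : m = n * ('X - t2%:P) ^+ 2.
  apply: (mulIf (_ : ('X - t1%:P) ^+ 2 != 0)).
    by rewrite expf_neq0 // polyXsubC_eq0.
  by rewrite -mE sE; move: ('X - t1%:P) ('X - t2%:P) => x y; ring.
rewrite mE' hornerM horner_exp hornerXsubC mulf_neq0 //; last first.
  by rewrite expf_neq0 // subr_eq0.
rewrite nE mulf_neq0 //; apply/eqP => h.
have t1E : t1 ^+ 2 + p * t1 - p ^+ 2 = 0.
  by rewrite -qE /p; ring.
have h1 : t1 * (3 * p + 2) = p * (p - 1).
  apply/eqP; rewrite -subr_eq0 -[X in _ == X]t1E -subr_eq0.
  rewrite (_ : _ - _ = - (t1 ^+ 2 - 2 * (1 + p) * t1 - p)); last by ring.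
  by rewrite h oppr0.
have : - (5 * p ^+ 2 * (p ^+ 2 + 3 * p + 1)) = 0.
  transitivity ((t1 * (3 * p + 2)) ^+ 2 + p * (3 * p + 2) * (t1 * (3 * p + 2)) - p ^+ 2 * (3 * p + 2) ^+ 2).
    by rewrite h1; ring.
  by transitivity ((3 * p + 2) ^+ 2 * (t1 ^+ 2 + p * t1 - p ^+ 2)); [ring | rewrite t1E mulr0].
move/eqP; rewrite oppr_eq0; apply/negP.
by rewrite !mulf_neq0 ?expf_neq0 ?pnatr_eq0.
Qed.

(** A third tangency would be a double root of the residual quadratic, whose discriminant is
    [4 (p^2 + 3 p + 1) != 0]. *)
Lemma no_three_tangencies a b c t1 t2 t3 : t1 != t2 -> t1 != t3 -> t2 != t3 ->
  tangency a b c t1 -> tangency a b c t2 -> tangency a b c t3 -> False.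
Proof.
move=> t12 t13 t23 T1 T2 T3.
have [qE AE _ _ [n sE nE]] := two_tangencies t12 T1 T2.
set p := - (t1 + t2) in qE AE nE; set A := 1 / 2 - a in AE nE.
have [A0 _ D0] := double_tangency_neq0 AE.
have [m mE m0] : exists2 m, secpoly a b c = n * m & m.[t3] != 0.
  exists ((('X - t1%:P) * ('X - t2%:P)) ^+ 2); rewrite // horner_exp hornerM.
  by rewrite !hornerXsubC expf_neq0 // mulf_neq0 // subr_eq0 eq_sym.
case: T3 => _ N0 dN0.
have n0 : n.[t3] = 0.
  move: N0; rewrite -horner_secpoly mE hornerM => /eqP.
  by rewrite mulf_eq0 (negPf m0) orbF => /eqP.
have dn0 : n^`().[t3] = 0.
  move: dN0; rewrite -horner_deriv_secpoly mE derivM hornerD !hornerM n0 mul0r.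
  by rewrite addr0 => /eqP; rewrite mulf_eq0 (negPf m0) orbF => /eqP.
have nP : n = A *: ('X^2 - (2 * (1 + p)) *: 'X - p%:P).
  apply: (@poly_eq_away _ _ _ 0) => u _; rewrite nE.
  by rewrite !(hornerZ, hornerD, hornerN, hornerXn, hornerX, hornerC).
move: n0; rewrite nE => /eqP; rewrite mulf_eq0 (negPf A0) /= => /eqP n0.
move: dn0; rewrite nP derivZ !derivB derivXn derivZ derivX derivC hornerZ => /eqP.
rewrite mulf_eq0 (negPf A0) /= !(hornerD, hornerN, hornerMn, hornerZ, hornerC, hornerX).
move=> /eqP dn0.
move/eqP: D0; apply; rewrite -[RHS](oppr0) -[in RHS]n0.
have -> : t3 = 1 + p.
  apply: (mulfI (_ : 2 != 0)); rewrite ?pnatr_eq0 //.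
  by apply/eqP; rewrite -subr_eq0 -dn0; apply/eqP; ring.
by ring.
Qed.

End Tangencies.

(** * The conditions on the parameters as statements about tangencies *)

Section Conditions.
Variable K : numClosedFieldType.
Implicit Types (a b c t u x y z s p : K).

(** Everything is expressed by [t_ s], a root of [h^2 = 1 - h], so that subsequent computations are
    polynomial in [h] and both signs are treated alike. *)
Lemma golden_constants s : s = 1 \/ s = -1 ->
  [/\ t_ s ^+ 2 = 1 - t_ s, t_ (- s) = - 1 - t_ s, eps s = - 2 - t_ s,
      eps (- s) = t_ s - 1 & t'_ s = 1 - 2 * t_ s].
Proof.
have r5 : sqrtC 5 ^+ 2 = 5 :> K by rewrite sqrtCK.
case=> ->; rewrite /t_ /eps /t'_; move: (sqrtC 5) r5 => r r5; split; try by field.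
  transitivity (1 / 4 + r / 2 + r ^+ 2 / 4); first by field.
  by rewrite r5; field.
transitivity (1 / 4 - r / 2 + r ^+ 2 / 4); first by field.
by rewrite r5; field.
Qed.

Lemma golden_factor t : t ^+ 2 + t - 1 = (t - t_ 1) * (t - t_ (-1)).
Proof.
have [e1 e2 _ _ _] := golden_constants (or_introl (erefl (1 : K))).
by rewrite e2; transitivity (t ^+ 2 + t - (t_ 1 ^+ 2 + t_ 1)); [rewrite e1|]; ring.
Qed.

Lemma golden_eq0 t :
  (t ^+ 2 + t - 1 == 0) = (t == t_ 1) || (t == t_ (-1)).
Proof. by rewrite golden_factor mulf_eq0 !subr_eq0. Qed.

(** At [t = 1] the curve lies over [x = 0] again, so [a] drops out of value and slope, and the star
    formulas degenerate; [t = -1] is the analogue over infinity, where [c] drops out. *)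
Lemma tangency_at1 a b c : tangency a b c 1 <-> b = - 6 /\ c = - 1.
Proof.
rewrite /tangency /section_value /section_slope /conic_form /param_Y /param_x /param_z.
split=> [[_ N0 dN0]|[-> ->]]; last by split; [exact: oner_neq0 | field | ring].
have cE : c = - 1.
  apply/eqP; rewrite -subr_eq0 -[X in _ == X](mul0r (- (4^-1))) -[X in _ == X * _]N0.
  by apply/eqP; field.
split=> //; apply/eqP; rewrite -subr_eq0 -[X in _ == X](mul0r (- (2^-1))).
by rewrite -[X in _ == X * _]dN0 cE; apply/eqP; field.
Qed.

Lemma tangency_atN1 a b c : tangency a b c (-1) <-> a = - 1 /\ b = 6.
Proof.
rewrite /tangency /section_value /section_slope /conic_form /param_Y /param_x /param_z.
split=> [[_ N0 dN0]|[-> ->]]; last first.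
  by split; [rewrite oppr_eq0 oner_neq0 | field | ring].
have aE : a = - 1.
  apply/eqP; rewrite -subr_eq0 -[X in _ == X](mul0r (- (4^-1))) -[X in _ == X * _]N0.
  by apply/eqP; field.
split=> //; apply/eqP; rewrite -subr_eq0 -[X in _ == X](mul0r (2^-1)).
by rewrite -[X in _ == X * _]dN0 aE; apply/eqP; field.
Qed.

(** Value and slope are linear in [a] and [c]. This is Cramer's rule, whose determinant is
    [4 t x z (t^2 + t - 1)] up to sign, with [x] and [z] the coordinates of the parametrization. *)
Lemma tangency_star a b c t : t != 0 -> t != 1 -> t != -1 ->
  t ^+ 2 + t - 1 != 0 ->
  tangency a b c t <-> a = star_a b t /\ c = star_c b t.
Proof.
move=> t0 t1 tn1 tau.
have t1' : t - 1 != 0 by rewrite subr_eq0.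
have tn1' : t + 1 != 0 by rewrite addr_eq0.
rewrite /tangency /section_value /section_slope /conic_form /param_Y /param_x /param_z.
rewrite /star_a /star_c.
split=> [[_ N0 dN0]|[-> ->]]; last first.
  by split=> //; field; rewrite ?t0 ?t1' ?tn1' ?tau.
set N := (X in X = 0) in N0; set dN := (X in X = 0) in dN0.
split; apply/eqP; rewrite -subr_eq0; apply/eqP.
  transitivity (- ((t + 1) * dN - 2 * N) / (2 * t * (2 * t ^+ 2 * (t - 1) * (t ^+ 2 + t - 1)))).
    by rewrite /N /dN; field; rewrite ?t0 ?t1' ?tn1' ?tau.
  by rewrite N0 dN0 !mulr0 subrr oppr0 mul0r.
transitivity ((t ^+ 2 * (t - 1) * dN - 2 * (3 * t ^+ 2 - 2 * t) * N) / (4 * t * (t + 1) * (t ^+ 2 + t - 1))).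
  by rewrite /N /dN; field; rewrite ?t0 ?t1' ?tn1' ?tau.
by rewrite N0 dN0 !mulr0 subrr !mul0r.
Qed.

Lemma cond_4A4_A1P a b c : cond S_4A4_A1 a b c <-> exists t, tangency a b c t.
Proof.
split=> [[[t [tn aE cE]]|bc|ab]|[t T]].
- exists t; move: tn; rewrite !inE !negb_or => /and5P[t0 t1 tn1 tp tm].
  by apply/tangency_star => //; rewrite golden_eq0 negb_or tp.
- by exists 1; apply/tangency_at1.
- by exists (-1); apply/tangency_atN1.
have tau := tangency_not_vertical T.
have [t1|t1] := eqVneq t 1; first by rewrite t1 in T; apply: Or32; apply/(tangency_at1 a b c).
have [tn1|tn1] := eqVneq t (-1).
  by rewrite tn1 in T; apply: Or33; apply/(tangency_atN1 a b c).
have t0 : t != 0 by case: T.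
apply: Or31; exists t; have [h _] := tangency_star a b c t0 t1 tn1 tau.
have [aE cE] := h T; split=> //; rewrite !inE !negb_or t0 t1 tn1 /=.
by rewrite golden_eq0 negb_or in tau.
Qed.

(* Cramer's rule, as Wronskian determinants in [t], for the three equations
   linear in [(a, b, c)] of a triple root at [t]. *)
Lemma cond_4A4_A2P a b c : cond S_4A4_A2 a b c <->
  exists t, tangency a b c t /\ section_curvature a b c t = 0.
Proof.
split=> [[t [tn -> -> ->]]|[t [T R0]]].
  move: tn; rewrite !inE !negb_or => /and3P[t0 tp tm]; exists t.
  have tau : t ^+ 2 + t - 1 != 0 by rewrite golden_eq0 negb_or tp.
  rewrite /tangency /section_value /section_slope /section_curvature.
  rewrite /conic_form /param_Y /param_x /param_z.
  by do ?split=> //; field; rewrite ?tau.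
have tau := tangency_not_vertical T; exists t; case: T => t0 N0 dN0.
(* Up to sign this is the Wronskian of [x^2], [x z], [z^2], namely [2 (x' z - x z')^3] with
   [x' z - x z' = 2 t (t^2 + t - 1)]. *)
have w0 : 16 * t ^+ 3 * (t ^+ 2 + t - 1) ^+ 3 != 0.
  by rewrite !mulf_neq0 ?expf_neq0 ?pnatr_eq0.
have tt : 16 * t ^+ 3 * (t ^+ 2 + t - 1) ^+ 3 / (16 * t ^+ 3 * (t ^+ 2 + t - 1) ^+ 3) = 1.
  by rewrite mulfV.
pose N := section_value a b c t; pose N1 := section_slope a b c t.
pose N2 := section_curvature a b c t.
pose x := param_x t; pose z := param_z t; pose x1 := 3 * t ^+ 2 - 2 * t.
pose x2 := 6 * t - 2.
pose W (f f1 f2 g g1 g2 : K) :=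
  N * (f1 * g2 - f2 * g1) - N1 * (f * g2 - f2 * g) + N2 * (f * g1 - f1 * g).
have W0 f f1 f2 g g1 g2 : W f f1 f2 g g1 g2 = 0.
  by rewrite /W /N /N1 /N2 N0 dN0 R0 !mul0r subrr addr0.
pose P := [:: x ^+ 2; 2 * x * x1; 2 * (x1 ^+ 2 + x * x2)].
pose Q := [:: x * z; x1 * z + x; x2 * z + 2 * x1].
pose R := [:: z ^+ 2; 2 * z; 2].
pose w (f g : seq K) := W f`_0 f`_1 f`_2 g`_0 g`_1 g`_2.
split.
- by rewrite !inE !negb_or t0 -negb_or -golden_eq0.
- apply/eqP; rewrite -subr_eq0; apply/eqP.
  transitivity (w Q R / (16 * t ^+ 3 * (t ^+ 2 + t - 1) ^+ 3)); last first.
    by rewrite /w W0 mul0r.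
  rewrite /w /W /P /Q /R /N /N1 /N2 /section_value /section_slope /section_curvature.
  rewrite /conic_form /x1 /x2 /x /z /param_Y /param_x /param_z /=.
  by field; rewrite ?tau ?t0.
- apply/eqP; rewrite -subr_eq0; apply/eqP.
  transitivity (- w P R / (16 * t ^+ 3 * (t ^+ 2 + t - 1) ^+ 3)); last first.
    by rewrite /w W0 ?oppr0 mul0r.
  rewrite /w /W /P /Q /R /N /N1 /N2 /section_value /section_slope /section_curvature.
  rewrite /conic_form /x1 /x2 /x /z /param_Y /param_x /param_z /=.
  by field; rewrite ?tau ?t0.
- apply/eqP; rewrite -subr_eq0; apply/eqP.
  transitivity (w P Q / (16 * t ^+ 3 * (t ^+ 2 + t - 1) ^+ 3)); last first.
    by rewrite /w W0 ?oppr0 mul0r.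
  rewrite /w /W /P /Q /R /N /N1 /N2 /section_value /section_slope /section_curvature.
  rewrite /conic_form /x1 /x2 /x /z /param_Y /param_x /param_z /=.
  by field; rewrite ?tau ?t0.
Qed.

End Conditions.

Section SpecialConditions.
Variable K : numClosedFieldType.
Implicit Types (a b c t u x y z s p : K).

Definition cond_A9 a b c : Prop := c = 1 / 2 \/ a = 1 / 2.

(** Fixing [c] or [a] at [1 / 2] leaves two linear equations for the other two parameters; each of
    the two rational families is their solution by Cramer's rule. *)
Lemma cond_A9_2A4_A1P a b c : cond S_A9_2A4_A1 a b c <->
  cond_A9 a b c /\ exists t, tangency a b c t.
Proof.
rewrite /= /cond_A9_2A4_A1; split.
  case=> -[t []]; rewrite !inE !negb_or => /and4P[t0 t1 tp tm];
    have tau : t ^+ 2 + t - 1 != 0 by [rewrite golden_eq0 negb_or tp].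
    move=> -> -> ->; split; [by left | exists t].
    have t1' : t - 1 != 0 by rewrite subr_eq0.
    rewrite /tangency /section_value /section_slope.
    rewrite /conic_form /param_Y /param_x /param_z.
    by split=> //; field; rewrite ?tau ?t1'.
  move=> -> -> ->; split; [by right | exists t].
  have t1' : t + 1 != 0 by rewrite addr_eq0.
  rewrite /tangency /section_value /section_slope.
  rewrite /conic_form /param_Y /param_x /param_z.
  by split=> //; field; rewrite ?tau ?t1'.
case=> ac [t T]; have tau := tangency_not_vertical T.
have [t0 N0 dN0] := T.
have tl : (t != t_ 1) && (t != t_ (-1)) by rewrite -negb_or -golden_eq0.
pose N := section_value a b c t; pose N1 := section_slope a b c t.
pose x := param_x t; pose z := param_z t; pose x1 := 3 * t ^+ 2 - 2 * t.
pose P := [:: x ^+ 2; 2 * x * x1].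
pose Q := [:: x * z; x1 * z + x].
pose R := [:: z ^+ 2; 2 * z].
pose w (f : seq K) := N * f`_1 - N1 * f`_0.
have w0 f : w f = 0 by rewrite /w /N /N1 N0 dN0 !mul0r subrr.
case: ac => [cE|aE].
  (* A tangency at [t = 1] forces [c = - 1], against [c = 1 / 2]; likewise [t = -1] forces [a = - 1]
     in the other case. *)
  have t1 : t != 1.
    apply/eqP => t1; have [_ c1] : b = - 6 /\ c = - 1.
      by apply/(tangency_at1 a b c); rewrite -t1.
    have : (3 : K) = 0.
      transitivity (2 * (1 / 2 - - 1) : K); first by field.
      by rewrite -cE c1 subrr mulr0.
    by move/eqP; rewrite pnatr_eq0.
  have t1' : t - 1 != 0 by rewrite subr_eq0.
  left; exists t; split=> //.
  - by rewrite !inE !negb_or t0 t1 tl.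
  - apply/eqP; rewrite -subr_eq0; apply/eqP.
    transitivity (w Q / (2 * t * (t ^+ 2 + t - 1) * (t ^+ 2 * (t - 1)) ^+ 2)); last first.
      by rewrite w0 mul0r.
    rewrite /w /P /Q /R /N /N1 /section_value /section_slope.
    rewrite cE /conic_form /x1 /x /z /param_Y /param_x /param_z /=.
    by field; rewrite ?tau ?t0 ?t1'.
  - apply/eqP; rewrite -subr_eq0; apply/eqP.
    transitivity (- w P / (2 * t * (t ^+ 2 + t - 1) * (t ^+ 2 * (t - 1)) ^+ 2)); last first.
      by rewrite w0 oppr0 mul0r.
    rewrite /w /P /Q /R /N /N1 /section_value /section_slope.
    rewrite cE /conic_form /x1 /x /z /param_Y /param_x /param_z /=.
    by field; rewrite ?tau ?t0 ?t1'.
have tn1 : t != -1.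
  apply/eqP => t1; have [a1 _] : a = - 1 /\ b = 6.
    by apply/(tangency_atN1 a b c); rewrite -t1.
  have : (3 : K) = 0.
    transitivity (2 * (1 / 2 - - 1) : K); first by field.
    by rewrite -aE a1 subrr mulr0.
  by move/eqP; rewrite pnatr_eq0.
have t1' : t + 1 != 0 by rewrite addr_eq0.
right; exists t; split=> //.
- by rewrite !inE !negb_or t0 tn1 tl.
- apply/eqP; rewrite -subr_eq0; apply/eqP.
  transitivity (w R / (2 * t * (t ^+ 2 + t - 1) * (t + 1) ^+ 2)); last first.
    by rewrite w0 mul0r.
  rewrite /w /P /Q /R /N /N1 /section_value /section_slope.
  rewrite aE /conic_form /x1 /x /z /param_Y /param_x /param_z /=.
  by field; rewrite ?tau ?t0 ?t1'.
- apply/eqP; rewrite -subr_eq0; apply/eqP.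
  transitivity (- w Q / (2 * t * (t ^+ 2 + t - 1) * (t + 1) ^+ 2)); last first.
    by rewrite w0 oppr0 mul0r.
  rewrite /w /P /Q /R /N /N1 /section_value /section_slope.
  rewrite aE /conic_form /x1 /x /z /param_Y /param_x /param_z /=.
  by field; rewrite ?tau ?t0 ?t1'.
Qed.

Lemma cond_A9_2A4_A2P a b c : cond S_A9_2A4_A2 a b c <-> cond_A9 a b c /\
  exists t, tangency a b c t /\ section_curvature a b c t = 0.
Proof.
split=> [|[ac /cond_4A4_A2P [t [tl aE bE cE]]]].
  case=> -[-> -> ->].
    split; [by left | exists (3 / 4)].
    rewrite /tangency /section_value /section_slope /section_curvature.
    rewrite /conic_form /param_Y /param_x /param_z.
    do ?split; try by field.
    by rewrite mulf_neq0 ?invr_eq0 ?pnatr_eq0.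
  split; [by right | exists (- (4 / 3))].
  rewrite /tangency /section_value /section_slope /section_curvature.
  rewrite /conic_form /param_Y /param_x /param_z.
  do ?split; try by field.
  by rewrite oppr_eq0 mulf_neq0 ?invr_eq0 ?pnatr_eq0.
move: tl; rewrite !inE !negb_or => /and3P[t0 tp tm].
have tau : t ^+ 2 + t - 1 != 0 by rewrite golden_eq0 negb_or tp.
case: ac => [cE'|aE'].
  (* In the family of triple contacts [1 / 2 - c] has numerator [3 t^5 (4 t - 3)]. *)
  left; have tE : t = 3 / 4.
    apply: (mulfI (_ : 12 * t ^+ 5 != 0)).
      by rewrite mulf_neq0 ?expf_neq0 ?pnatr_eq0.
    apply/eqP; rewrite -subr_eq0; apply/eqP.
    transitivity ((1 / 2 - c) * (2 * (t ^+ 2 + t - 1) ^+ 3)).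
      by rewrite cE; field; rewrite ?tau.
    by rewrite cE' subrr mul0r.
  have n : (3 / 4 : K) ^+ 2 + 3 / 4 - 1 = 5 / 16 by field.
  have n5 : (5 / 16 : K) != 0 by rewrite mulf_neq0 ?invr_eq0 ?pnatr_eq0.
  split=> //; [rewrite aE tE n | rewrite bE tE n]; by field.
(* Here [a - 1 / 2] has numerator [3 (3 t + 4)]; the root is the image of [3 / 4] under
   [t -> - 1 / t]. *)
right; have tE : t = - (4 / 3).
  apply: (mulfI (_ : 9 != 0)); first by rewrite pnatr_eq0.
  apply/eqP; rewrite -subr_eq0; apply/eqP.
  transitivity ((a - 1 / 2) * (2 * (t ^+ 2 + t - 1) ^+ 3)).
    by rewrite aE; field; rewrite ?tau.
  by rewrite aE' subrr mul0r.
have n : (- (4 / 3) : K) ^+ 2 + (- (4 / 3)) - 1 = - (5 / 9) by field.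
split=> //; [rewrite bE tE n | rewrite cE tE n]; by field.
Qed.

(* The two tangency points are [p t_ 1] and [p t_ (-1)]. *)
Lemma double_tangency_family a b c p : p != 0 ->
  (1 / 2 - a) * ((p - 1) * (p ^+ 2 + 3 * p + 1) ^+ 2) = - 6 ->
  c = 1 / 2 + (1 / 2 - a) * p ^+ 5 ->
  b = - 3 + (1 / 2 - a) * (5 * p ^+ 2 + 5 * p + 1) ->
  forall u, u ^+ 2 + p * u - p ^+ 2 = 0 -> tangency a b c u.
Proof.
move=> p0 AE cE bE u uE; set A := 1 / 2 - a in AE cE bE.
have aE : a = 1 / 2 - A by rewrite /A; ring.
split.
- apply: contra_neq p0 => u0; move: uE; rewrite u0 mulr0 expr0n /= !add0r => /eqP.
  by rewrite oppr_eq0 expf_eq0 => /eqP.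
- transitivity (A * (u ^+ 2 + p * u - p ^+ 2) ^+ 2 * (u ^+ 2 - 2 * (1 + p) * u - p)
    + (A * ((p - 1) * (p ^+ 2 + 3 * p + 1) ^+ 2) + 6) * (- u ^+ 2)).
    rewrite aE cE bE /section_value /conic_form /param_Y /param_x /param_z.
    by field.
  by rewrite AE uE; ring.
transitivity (2 * A * (u ^+ 2 + p * u - p ^+ 2) * (2 * u + p) * (u ^+ 2 - 2 * (1 + p) * u - p)
    + A * (u ^+ 2 + p * u - p ^+ 2) ^+ 2 * (2 * u - 2 * (1 + p))
    + (A * ((p - 1) * (p ^+ 2 + 3 * p + 1) ^+ 2) + 6) * (- (2 * u))).
  rewrite aE cE bE /section_slope /param_x /param_z.
  by field.
by rewrite AE uE; ring.
Qed.

End SpecialConditions.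

Section DoubleTangencyCondition.
Variable K : numClosedFieldType.
Implicit Types (a b c t u x y z s p h : K).

(** With [t = p h] each factor of the stated [b] is a power of [h] times a polynomial in [p]. The
    conjugate of [h] is [- 1 - h], and conjugate factors multiply to rational polynomials, as in
    [p^2 + 3 p + 1 = (p + 2 + h)(p + 1 - h)]. *)
Lemma double_tangency_b h p : h ^+ 2 = 1 - h -> p - 1 != 0 ->
  p ^+ 2 + 3 * p + 1 != 0 -> let t := p * h in
  - (3 * (t ^+ 2 + (3 * (h - 1) + 1) * t - (h - 1))
       * (t ^+ 2 - (- 2 - h) * t - (h - 1)) * (t + h)
     / ((t - h) * (t - (- 1 - h)) ^+ 2 * (t - (1 - 2 * h)) ^+ 2)) =
  - 3 + - 6 / ((p - 1) * (p ^+ 2 + 3 * p + 1) ^+ 2)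
        * (5 * p ^+ 2 + 5 * p + 1).
Proof.
move=> h2 p1 D0 t; have {}h2 : h ^+ 2 + h - 1 = 0 by rewrite h2; ring.
have h0 : h != 0.
  apply: contra_neq (oner_neq0 K) => h0; move: h2.
  by rewrite h0 expr0n !add0r => /eqP; rewrite oppr_eq0 => /eqP.
(* Reduction modulo the minimal equation of [h]; [w] is the explicit quotient supplied at each
   use. *)
have red (u v w : K) : u = v + (h ^+ 2 + h - 1) * w -> u = v.
  by rewrite h2 mul0r addr0.
have -> : t ^+ 2 + (3 * (h - 1) + 1) * t - (h - 1) =
    h ^+ 2 * (p ^+ 2 + (1 - 2 * h) * p + 1).
  by apply: (red _ _ (2 * p * h - 1)); rewrite /t; ring.
have -> : t ^+ 2 - (- 2 - h) * t - (h - 1) =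
    h ^+ 2 * (p ^+ 2 + (3 + 2 * h) * p + 1).
  by apply: (red _ _ (- (2 * p * h) - 1)); rewrite /t; ring.
have -> : t + h = h * (p + 1) by rewrite /t; ring.
have -> : t - h = h * (p - 1) by rewrite /t; ring.
have -> : t - (- 1 - h) = h * (p + 2 + h).
  by apply: (red _ _ (- 1)); rewrite /t; ring.
have -> : t - (1 - 2 * h) = h * (p + 1 - h).
  by apply: (red _ _ 1); rewrite /t; ring.
have DE : p ^+ 2 + 3 * p + 1 = (p + 2 + h) * (p + 1 - h).
  by apply: (red _ _ 1); ring.
have NE : (p ^+ 2 + (1 - 2 * h) * p + 1) * (p ^+ 2 + (3 + 2 * h) * p + 1) =
    p ^+ 4 + 4 * p ^+ 3 + p ^+ 2 + 4 * p + 1.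
  by apply: (red _ _ (- (4 * p ^+ 2))); ring.
have [f1 f2] : p + 2 + h != 0 /\ p + 1 - h != 0.
  by apply/andP; rewrite -negb_or -mulf_eq0 -DE.
transitivity (- (3 * ((p ^+ 2 + (1 - 2 * h) * p + 1)
    * (p ^+ 2 + (3 + 2 * h) * p + 1)) * (p + 1)
    / ((p - 1) * ((p + 2 + h) * (p + 1 - h)) ^+ 2))).
  by field; rewrite ?f1 ?f2 ?p1 ?h0.
by rewrite NE -DE; field; rewrite ?p1 ?D0.
Qed.

Lemma cond_4A4_2A1P a b c : cond S_4A4_2A1 a b c <->
  exists t1 t2, [/\ t1 != t2, tangency a b c t1 & tangency a b c t2].
Proof.
split=> [[s [t [sE tl bE aE cE]]]|[t1 [t2 [t12 T1 T2]]]].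
  have [h2 hN eE eN t'E] := golden_constants sE.
  move: tl; rewrite !inE !negb_or => /and5P[t0 t1 tn1 tp /andP[tm t's]].
  have tau : t ^+ 2 + t - 1 != 0 by rewrite golden_eq0 negb_or tp.
  have T : tangency a b c t by apply/tangency_star.
  set h := t_ s in h2 hN eE eN t'E bE.
  have h0 : h != 0.
    apply: contra_neq (oner_neq0 K) => h0; move: h2.
    by rewrite h0 expr0n subr0.
  have th0 : (t - h) * (t - (- 1 - h)) != 0.
    rewrite (_ : _ * _ = t ^+ 2 + t - (h ^+ 2 + h)); last by ring.
    by rewrite h2 subrK.
  pose p := t / h; have tE : t = p * h by rewrite divfK.
  have p0 : p != 0 by rewrite mulf_neq0 ?invr_eq0.
  have p1 : p - 1 != 0.
    apply: contra_neq th0 => p1; rewrite tE (_ : p * h - h = (p - 1) * h); last by ring.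
    by rewrite p1 !mul0r.
  have D0 : p ^+ 2 + 3 * p + 1 != 0.
    have -> : p ^+ 2 + 3 * p + 1 = (p + 2 + h) * (p + 1 - h).
      by transitivity ((p + 2 + h) * (p + 1 - h) + h ^+ 2 + h - 1); [ring | rewrite h2; ring].
    apply: mulf_neq0.
      apply: contra_neq th0 => e; rewrite (_ : t - (- 1 - h) = h * (p + 2 + h)).
        by rewrite e !mulr0.
      by transitivity (h * (p + 2 + h) - (h ^+ 2 + h - 1)); [rewrite tE | rewrite h2]; ring.
    rewrite t'E in t's; apply: contra_neq t's => e.
    apply/eqP; rewrite -subr_eq0 -[X in _ == X](mulr0 h) -e; apply/eqP.
    by transitivity (h * (p + 1 - h) + (h ^+ 2 + h - 1)); [rewrite tE | rewrite h2]; ring.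
  rewrite t'E hN eE eN tE (double_tangency_b h2 p1 D0) in bE.
  pose A := - 6 / ((p - 1) * (p ^+ 2 + 3 * p + 1) ^+ 2).
  have AE : A * ((p - 1) * (p ^+ 2 + 3 * p + 1) ^+ 2) = - 6.
    by rewrite divfK // mulf_neq0 ?expf_neq0.
  pose a' := 1 / 2 - A; pose c' := 1 / 2 + A * p ^+ 5.
  have A'E : A = 1 / 2 - a' by rewrite /a'; ring.
  have fam u : u ^+ 2 + p * u - p ^+ 2 = 0 -> tangency a' b c' u.
    by apply: double_tangency_family; rewrite -?A'E.
  have r1 : t ^+ 2 + p * t - p ^+ 2 = 0.
    rewrite tE; transitivity (p ^+ 2 * (h ^+ 2 + h - 1)); first by ring.
    by rewrite h2; ring.
  (* A tangency at [t] determines [a] and [c] from [b] and [t], so the given parameters are the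
     member [p] of the double tangency family. *)
  have [|aE' cE'] := proj1 (tangency_star a' b c' t0 t1 tn1 tau); first exact: fam.
  have {}aE : a = a' by rewrite aE' aE.
  have {}cE : c = c' by rewrite cE' cE.
  exists t, (p * (- 1 - h)); split=> //; last first.
    rewrite aE cE; apply: fam.
    transitivity (p ^+ 2 * (h ^+ 2 + h - 1)); first by ring.
    by rewrite h2; ring.
  apply/eqP => e; have h12 : h = - (1 / 2).
    apply: (mulfI p0); apply: (mulfI (_ : 2 != 0)); first by rewrite pnatr_eq0.
    transitivity (t + p * h); first by rewrite tE; ring.
    by rewrite e; field.
  move: h2; rewrite h12 => /eqP; rewrite -subr_eq0.
  rewrite (_ : _ - _ = - (5 / 4)); last by field.
  by rewrite oppr_eq0 mulf_eq0 invr_eq0 !pnatr_eq0.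
(* The condition requires a tangency parameter other than 1 and -1. As [t1^2 + 3 t1 t2 + t2^2 = 0],
   the two parameters are not both of this kind, so one of them qualifies. *)
wlog [t1n tn1n] : t1 t2 t12 T1 T2 / t1 != 1 /\ t1 != -1.
  move=> H; have [/andP[e1 e2]|] := boolP ((t1 != 1) && (t1 != -1)).
    exact: (H t1 t2).
  rewrite negb_and !negbK => t1E; apply: (H t2 t1) => //; first by rewrite eq_sym.
  have [qE _ _ _ _] := two_tangencies t12 T1 T2.
  have qE' : t1 ^+ 2 + 3 * (t1 * t2) + t2 ^+ 2 = 0.
    by transitivity (t1 * t2 - - (- (t1 + t2)) ^+ 2); [ring | rewrite qE subrr].
  split; apply/eqP => t2E; move: qE'; rewrite t2E; case/orP: t1E => /eqP->;
    move/eqP.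
  + by rewrite (_ : _ + _ = 5%:R) ?pnatr_eq0 //; ring.
  + by rewrite (_ : _ + _ = - 1) ?oppr_eq0 ?oner_eq0 //; ring.
  + by rewrite (_ : _ + _ = - 1) ?oppr_eq0 ?oner_eq0 //; ring.
  + by rewrite (_ : _ + _ = 5%:R) ?pnatr_eq0 //; ring.
have [qE AE cE bE _] := two_tangencies t12 T1 T2.
set p := - (t1 + t2) in qE AE cE bE.
have [A0 p1 D0] := double_tangency_neq0 AE.
have t10 : t1 != 0 by case: T1.
have p0 : p != 0.
  apply: contra_neq t10 => p0; move: qE; rewrite p0 expr0n oppr0 => /eqP.
  by rewrite mulf_eq0 => /orP[/eqP //|]; case: T2 => /negPf->.
(* The sign records which of the roots [p t_ 1] and [p t_ (-1)] the chosen tangency is. *)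
have [s [sE tE]] : exists s : K, (s = 1 \/ s = -1) /\ t1 = p * t_ s.
  have [e1 e2 _ _ _] := golden_constants (or_introl (erefl (1 : K))).
  have : (t1 - p * t_ 1) * (t1 - p * t_ (-1)) = 0.
    rewrite e2; transitivity (t1 ^+ 2 + p * t1 - p ^+ 2 * (t_ 1 ^+ 2 + t_ 1)); first by ring.
    by rewrite e1 subrK mulr1 -qE /p; ring.
  move/eqP; rewrite mulf_eq0 !subr_eq0 => /orP[/eqP->|/eqP->].
    by exists 1; split; [left|].
  by exists (-1); split; [right|].
have [h2 hN eE eN t'E] := golden_constants sE.
have tau := tangency_not_vertical T1.
have [aE' cE'] := proj1 (tangency_star a b c t10 t1n tn1n tau) T1.
exists s, t1; split=> //.
- rewrite !inE !negb_or t10 t1n tn1n /=.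
  move: (tau); rewrite golden_eq0 negb_or => /andP[-> ->] /=.
  rewrite t'E; apply: contra_neq D0 => e.
  have h0 : t_ s != 0 by apply: contra_neq t10 => h0; rewrite tE h0 mulr0.
  have pE : p + 1 - t_ s = 0.
    apply: (mulfI h0); rewrite mulr0.
    transitivity (p * t_ s - (1 - 2 * t_ s) - (t_ s ^+ 2 + t_ s - 1)); first by ring.
    by rewrite -tE e h2; ring.
  transitivity ((p + 2 + t_ s) * (p + 1 - t_ s) + (t_ s ^+ 2 + t_ s - 1)); first by ring.
  by rewrite pE h2; ring.
rewrite t'E hN eE eN {1}tE.
have := double_tangency_b h2 p1 D0; rewrite /= -tE => ->.
rewrite bE; congr (_ + _ * _); apply: (mulIf (_ : (p - 1) * (p ^+ 2 + 3 * p + 1) ^+ 2 != 0)).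
  by rewrite mulf_neq0 ?expf_neq0.
by rewrite AE divfK // mulf_neq0 ?expf_neq0.
Qed.

End DoubleTangencyCondition.

(** * Listing the singular points with their types *)

Section Enumerations.
Variable K : numClosedFieldType.
Implicit Types (F : {mpoly K[3]}) (v w : 'rV[K]_3) (Pr : 'rV[K]_3 -> Prop).

Lemma rV_eqP v w : v != 0 ->
  reflect (exists2 k, k != 0 & v = k *: w) (v == w)%MS.
Proof.
move=> v0; apply: (iffP andP) => [[/sub_rVP[k vE] _]|[k k0 ->]].
  exists k => //; apply: contra_neq v0 => k0; by rewrite vE k0 scale0r.
by split; rewrite eqmx_scale.
Qed.

(** The property of a list in [has_set_of_singularities], relative to a region [Pr], so that lists
    for disjoint regions can be concatenated. *)
Definition enumerates F Pr (P : seq 'rV[K]_3) (Sigma : seq singularity) :=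
  [/\ size P = size Sigma,
      pairwise (fun v w => ~~ (v == w)%MS) P,
      forall v, v \in P -> Pr v,
      forall v, Pr v -> has (fun w => (v == w)%MS) P
    & forall n, (n < size P)%N -> point_type F (nth 0 P n) (nth Y11 Sigma n)].

Lemma enumerates_cat F Pr1 Pr2 P1 P2 S1 S2 :
  (forall v w, Pr1 v -> Pr2 w -> ~~ (v == w)%MS) ->
  enumerates F Pr1 P1 S1 -> enumerates F Pr2 P2 S2 ->
  enumerates F (fun v => Pr1 v \/ Pr2 v) (P1 ++ P2) (S1 ++ S2).
Proof.
move=> dis [s1 p1 a1 c1 t1] [s2 p2 a2 c2 t2]; split.
- by rewrite !size_cat s1 s2.
- rewrite pairwise_cat p1 p2 !andbT; apply/allrelP => v w vP wP.
  by apply: dis; [exact: a1 | exact: a2].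
- by move=> v; rewrite mem_cat => /orP[/a1|/a2]; [left | right].
- by move=> v [/c1|/c2] h; rewrite has_cat h ?orbT.
move=> n; rewrite size_cat !nth_cat -s1 => ns; case: ltnP => [|ge]; first exact: t1.
by apply: t2; rewrite -(ltn_add2l (size P1)) subnKC.
Qed.

Lemma enumerates_eq F Pr1 Pr2 P S : (forall v, Pr1 v <-> Pr2 v) ->
  enumerates F Pr1 P S -> enumerates F Pr2 P S.
Proof.
move=> e [s p a c t]; split=> // [v vP|v /e]; last exact: c.
by apply/e/a.
Qed.

Lemma enumerates1 F Pr v S : Pr v -> (forall w, Pr w -> (w == v)%MS) ->
  point_type F v S -> enumerates F Pr [:: v] [:: S].
Proof.
move=> vP wP vS; split=> // [w|w|].
- by rewrite inE => /eqP->.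
- by move=> /wP h; rewrite /= h.
by case.
Qed.

End Enumerations.

Section SingularPointsOfSextic.
Variable K : numClosedFieldType.
Implicit Types (v w : 'rV[K]_3) (a b c t x y z : K).

Definition over_zero c v :=
  [/\ v 0 0 = 0, v 0 2 != 0 & v 0 1 ^+ 2 = (1 / 2 - c) * v 0 2 ^+ 2].

Definition over_infinity a v :=
  [/\ v 0 2 = 0, v 0 0 != 0 & v 0 1 ^+ 2 = (1 / 2 - a) * v 0 0 ^+ 2].

Definition over_tangency a b c v :=
  exists l t, [/\ l != 0, tangency a b c t, v 0 0 = l * param_x t, v 0 1 = 0
                & v 0 2 = l * param_z t].

Lemma over_tangency_neq0 a b c v : over_tangency a b c v -> v != 0.
Proof.
move=> [l [t [l0 T xE yE zE]]]; have tau := tangency_not_vertical T.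
rewrite row3_eq0 xE zE; have [z0|z0] := eqVneq (param_z t) 0; last first.
  by rewrite [X in [|| _, _ | X]]mulf_neq0 // !orbT.
move/eqP: z0; rewrite /param_z addr_eq0 => /eqP ->.
rewrite mulf_neq0 // /param_x (_ : _ * _ = - 2%:R) ?oppr_eq0 ?pnatr_eq0 //.
by ring.
Qed.

Lemma singular_point_regions a b c v : singular_point (sextic a b c) v <->
  over_zero c v \/ over_infinity a v \/ over_tangency a b c v.
Proof.
rewrite singular_pointE; split=> [[v0 vs]|].
  move: v0; rewrite row3_eq0 => v0.
  by case: (singular_eqs_cases v0 vs) => h; [left | right; left | right; right].
case=> [[x0 z0 yE]|[[z0 x0 yE]|]].
- by split; [rewrite row3_eq0 z0 !orbT | rewrite x0; exact: cusp0_singular_eqs].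
- by split; [rewrite row3_eq0 x0 | rewrite z0; exact: cuspoo_singular_eqs].
move=> D; split; first exact: over_tangency_neq0 D.
case: D => l [t [l0 T xE yE zE]]; rewrite xE yE zE -(mulr0 l).
by apply: singular_eqs_scale; exact: tangency_singular_eqs.
Qed.

Lemma over_zero_neq0 c v : over_zero c v -> v != 0.
Proof. by case=> _ z0 _; rewrite row3_eq0 z0 !orbT. Qed.

Lemma over_infinity_neq0 a v : over_infinity a v -> v != 0.
Proof. by case=> _ x0 _; rewrite row3_eq0 x0. Qed.

Lemma over_zero_infinity c a v w :
  over_zero c v -> over_infinity a w -> ~~ (v == w)%MS.
Proof.
move=> vz; have v0 := over_zero_neq0 vz; case: vz => x0 _ _ [_ wx _].
apply/negP => /(rV_eqP _ v0) [k k0 e]; move: x0; rewrite e mxE => /eqP.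
by rewrite mulf_eq0 (negPf k0) (negPf wx).
Qed.

(** A tangency lying over [x = 0] has [t = 1], hence [c = - 1]; a point there with [y = 0] would
    need [c = 1 / 2]. *)
Lemma over_zero_tangency a b c v w :
  over_zero c v -> over_tangency a b c w -> ~~ (v == w)%MS.
Proof.
move=> vz [l [t [l0 T wx wy wz]]]; have v0 := over_zero_neq0 vz.
case: vz => x0 z0 yE; apply/negP => /(rV_eqP _ v0) [k k0 e].
move: x0 yE z0; rewrite e !mxE wx wy mulr0 expr0n /= => X0 yE z0.
have {}X0 : param_x t = 0.
  by apply: (mulfI l0); apply: (mulfI k0); rewrite !mulr0.
have c2 : 1 / 2 - c = 0.
  move/esym/eqP: yE; rewrite mulf_eq0 => /orP[/eqP //|].
  by rewrite expf_eq0 /= (negPf z0).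
have t1 : t = 1.
  move/eqP: X0; rewrite /param_x mulf_eq0 expf_eq0 /= subr_eq0.
  by case: (T) => /negPf-> _ _ /= => /eqP.
rewrite t1 in T; have [_ c1] := proj1 (tangency_at1 a b c) T.
move: c2; rewrite c1 (_ : _ - _ = 3 / 2); last by field.
by move/eqP; rewrite mulf_eq0 invr_eq0 !pnatr_eq0.
Qed.

Lemma over_infinity_tangency a b c v w :
  over_infinity a v -> over_tangency a b c w -> ~~ (v == w)%MS.
Proof.
move=> vz [l [t [l0 T wx wy wz]]]; have v0 := over_infinity_neq0 vz.
case: vz => z0 x0 yE; apply/negP => /(rV_eqP _ v0) [k k0 e].
move: z0 yE x0; rewrite e !mxE wz wy mulr0 expr0n /= => Z0 yE x0.
have {}Z0 : param_z t = 0.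
  by apply: (mulfI l0); apply: (mulfI k0); rewrite !mulr0.
have a2 : 1 / 2 - a = 0.
  move/esym/eqP: yE; rewrite mulf_eq0 => /orP[/eqP //|].
  by rewrite expf_eq0 /= (negPf x0).
have t1 : t = -1 by apply/eqP; rewrite -addr_eq0; apply/eqP.
rewrite t1 in T; have [a1 _] := proj1 (tangency_atN1 a b c) T.
move: a2; rewrite a1 (_ : _ - _ = 3 / 2); last by field.
by move/eqP; rewrite mulf_eq0 invr_eq0 !pnatr_eq0.
Qed.

Lemma row3_eta v : v = row3 (v 0 0) (v 0 1) (v 0 2).
Proof.
apply/rowP => i; rewrite mxE.
have [->|->|->] : [\/ i = 0, i = 1 | i = 2] by
  case: i => -[|[|[|//]]] h; [apply: Or31|apply: Or32|apply: Or33]; apply: val_inj.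
all: by [].
Qed.

Lemma row3_scale (l : K) x y z : l *: row3 x y z = row3 (l * x) (l * y) (l * z).
Proof. by rewrite [LHS]row3_eta !mxE. Qed.

(** For [c = 1 / 2] the lowest coefficients of [secpoly] are [b - 3] at [t^2], then, if that is
    zero, [- (2 a + 11) / 2] at [t^4], and finally -12 at [t^5]. *)
Definition cusp_type a b : singularity :=
  if b != 3 then A 9 else if 2 * a + 11 != 0 then Y11 else W12.

Lemma enumerates_over_zero a b c : exists P,
  enumerates (sextic a b c) (over_zero c) P
    (if c == 1 / 2 then [:: cusp_type a b] else nseq 2 (A 4)).
Proof.
have lXY := local_coordinatesXY K.
case: eqVneq => [c2|c2].
  exists [:: row3 0 0 1]; apply: enumerates1.
  - by rewrite /over_zero !row3E c2 subrr mul0r expr0n oner_eq0.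
  - move=> w wz; have w0 := over_zero_neq0 wz; case: wz => x0 z0.
    rewrite c2 subrr mul0r => /eqP; rewrite expf_eq0 /= => /eqP y0.
    apply/(rV_eqP _ w0); exists (w 0 2) => //.
    by rewrite row3_scale !mulr0 mulr1 [LHS]row3_eta x0 y0.
  apply: point_type_affine; rewrite rmorph0 !add0r.
  have -> : sextic_form (pserC a) (pserC b) (pserC c) (pserX K) (pserY K) 1 =
      affine_germ a b c 0 (pserX K) (pserY K).
    by rewrite /affine_germ rmorph0 add0r.
  have c2' : 2 * c = 1 by rewrite c2; field.
  rewrite /cusp_type; have [b3|b3] := eqVneq b 3; last exact: germ_A9.
  have [a11|a11] := eqVneq (2 * a + 11) 0; first exact: germ_W12_XY.
  exact: germ_Y11_at_cusp.
pose e := sqrtC (1 / 2 - c); have e2 : e ^+ 2 = 1 / 2 - c by rewrite sqrtCK.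
have e0 : e != 0 by rewrite sqrtC_eq0 subr_eq0 eq_sym.
have T (s : K) : s ^+ 2 = 1 / 2 - c -> s != 0 ->
    point_type (sextic a b c) (row3 0 s 1) (A 4).
  move=> s2 s0; apply: point_type_affine; rewrite rmorph0 !add0r.
  by apply: germ_A4 => //; rewrite s2; field.
exists [:: row3 0 e 1; row3 0 (- e) 1]; split=> //.
- rewrite /= !andbT; apply/negP => /rV_eqP.
  have -> : row3 0 e 1 != 0 by rewrite row3_eq0 !row3E e0 orbT.
  move=> /(_ isT) [k _ eq]; have := congr1 (fun v : 'rV[K]_3 => v 0 2) eq.
  have := congr1 (fun v : 'rV[K]_3 => v 0 1) eq.
  rewrite row3_scale !row3E mulr1 => ee ke; move: ee.
  rewrite -ke mul1r => /eqP; rewrite -addr_eq0 -mulr2n mulrn_eq0 /=.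
  exact/negP.
- move=> v; rewrite !inE => /orP[] /eqP->; rewrite /over_zero !row3E ?sqrrN e2.
    by rewrite oner_eq0 expr1n mulr1.
  by rewrite oner_eq0 expr1n mulr1.
- move=> v vz; have v0 := over_zero_neq0 vz; case: vz => x0 z0 yE.
  have : (v 0 1 - v 0 2 * e) * (v 0 1 + v 0 2 * e) = 0.
    by rewrite -subr_sqr exprMn e2 yE mulrC subrr.
  move/eqP; rewrite mulf_eq0 subr_eq0 addr_eq0 /= orbF => /orP[] /eqP y0.
    apply/orP; left; apply/(rV_eqP _ v0); exists (v 0 2) => //.
    by rewrite row3_scale mulr0 mulr1 [LHS]row3_eta x0 y0.
  apply/orP; right; apply/(rV_eqP _ v0); exists (v 0 2) => //.
  by rewrite row3_scale mulr0 mulr1 mulrN [LHS]row3_eta x0 y0.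
by case=> [|[|//]] _ /=; apply: T; rewrite ?sqrrN ?oppr_eq0.
Qed.

Lemma enumerates_over_infinity a b c : exists P,
  enumerates (sextic a b c) (over_infinity a) P
    (if a == 1 / 2 then [:: cusp_type c (- b)] else nseq 2 (A 4)).
Proof.
have lYX := local_coordinatesYNX K.
case: eqVneq => [c2|c2].
  exists [:: row3 1 0 0]; apply: enumerates1.
  - by rewrite /over_infinity !row3E c2 subrr mul0r expr0n oner_eq0.
  - move=> w wz; have w0 := over_infinity_neq0 wz; case: wz => x0 z0.
    rewrite c2 subrr mul0r => /eqP; rewrite expf_eq0 /= => /eqP y0.
    apply/(rV_eqP _ w0); exists (w 0 0) => //.
    by rewrite row3_scale !mulr0 mulr1 [LHS]row3_eta x0 y0.
  apply: point_type_infinity.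
  have c2' : 2 * a = 1 by rewrite c2; field.
  rewrite /cusp_type; have [b3|b3] := eqVneq (- b) 3; last exact: germ_A9.
  have [a11|a11] := eqVneq (2 * c + 11) 0; first exact: germ_W12_YNX.
  exact: germ_Y11_at_cusp.
pose e := sqrtC (1 / 2 - a); have e2 : e ^+ 2 = 1 / 2 - a by rewrite sqrtCK.
have e0 : e != 0 by rewrite sqrtC_eq0 subr_eq0 eq_sym.
have T (s : K) : s ^+ 2 = 1 / 2 - a -> s != 0 ->
    point_type (sextic a b c) (row3 1 s 0) (A 4).
  move=> s2 s0; apply: point_type_infinity.
  by apply: germ_A4 => //; rewrite s2; field.
exists [:: row3 1 e 0; row3 1 (- e) 0]; split=> //.
- rewrite /= !andbT; apply/negP => /rV_eqP.
  have -> : row3 1 e 0 != 0 by rewrite row3_eq0 !row3E e0 orbT.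
  move=> /(_ isT) [k _ eq]; have := congr1 (fun v : 'rV[K]_3 => v 0 0) eq.
  have := congr1 (fun v : 'rV[K]_3 => v 0 1) eq.
  rewrite row3_scale !row3E mulr1 => ee ke; move: ee.
  rewrite -ke mul1r => /eqP; rewrite -addr_eq0 -mulr2n mulrn_eq0 /=.
  exact/negP.
- move=> v; rewrite !inE => /orP[] /eqP->; rewrite /over_infinity !row3E ?sqrrN e2.
    by rewrite oner_eq0 expr1n mulr1.
  by rewrite oner_eq0 expr1n mulr1.
- move=> v vz; have v0 := over_infinity_neq0 vz; case: vz => x0 z0 yE.
  have : (v 0 1 - v 0 0 * e) * (v 0 1 + v 0 0 * e) = 0.
    by rewrite -subr_sqr exprMn e2 yE mulrC subrr.
  move/eqP; rewrite mulf_eq0 subr_eq0 addr_eq0 /= orbF => /orP[] /eqP y0.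
    apply/orP; left; apply/(rV_eqP _ v0); exists (v 0 0) => //.
    by rewrite row3_scale mulr0 mulr1 [LHS]row3_eta x0 y0.
  apply/orP; right; apply/(rV_eqP _ v0); exists (v 0 0) => //.
  by rewrite row3_scale mulr0 mulr1 mulrN [LHS]row3_eta x0 y0.
by case=> [|[|//]] _ /=; apply: T; rewrite ?sqrrN ?oppr_eq0.
Qed.

End SingularPointsOfSextic.

Section TangencyPoints.
Variable K : numClosedFieldType.
Implicit Types (v w : 'rV[K]_3) (a b c t x y z : K).

Lemma germ_at_tangency a b c t m (n : {poly K}) (x y : pser K) :
  local_coordinates x y -> tangency a b c t -> param_z t != 0 ->
  secpoly a b c = n * ('X - t%:P) ^+ m.+1 -> n.[t] != 0 ->
  germ_A m (sextic_form (pserC a) (pserC b) (pserC c)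
              (pserC (param_x t / param_z t) + x) y 1).
Proof.
move=> lc T zt nE n0; have tau := tangency_not_vertical T.
have [q qE q0] := section_poly_factor T zt nE n0.
apply: (germ_tangency lc qE q0).
case: T => t0 N0 _.
have sE : conic_form a b c (param_x t) (param_z t) = param_Y t.
  by apply/esym/eqP; rewrite -subr_eq0; apply/eqP.
set e := _ / _; have : trigonal_dY (param_z t * e) (param_z t ^+ 2 * conic_form a b c e 1) (param_z t * 1) != 0.
  rewrite -conic_form_scale mulr1 /e mulrC divfK // sE trigonal_dY_param.
  by rewrite !mulf_neq0 ?expf_neq0 ?pnatr_eq0.
by rewrite trigonal_dY_scale mulf_eq0 negb_or => /andP[].
Qed.

Definition tangency_point t : 'rV[K]_3 :=
  if param_z t == 0 then row3 1 0 0 else row3 (param_x t / param_z t) 0 1.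

Definition tangency_type a b c t : singularity :=
  A (if section_curvature a b c t == 0 then 2 else 1).

Lemma tangency_pointE t : t != 0 ->
  exists2 l, l != 0 & tangency_point t = l *: row3 (param_x t) 0 (param_z t).
Proof.
move=> t0; rewrite /tangency_point; case: eqVneq => [z0|z0].
  have tE : t = -1 by apply/eqP; rewrite -addr_eq0; apply/eqP.
  exists (- (1 / 2)); first by rewrite oppr_eq0 mulf_neq0 ?invr_eq0 ?oner_eq0 ?pnatr_eq0.
  rewrite row3_scale z0 !mulr0; congr row3.
  by rewrite tE /param_x; field.
exists (param_z t)^-1; first by rewrite invr_eq0.
by rewrite row3_scale mulr0 mulVf // mulrC.
Qed.

Lemma point_type_tangency a b c t : tangency a b c t ->
  point_type (sextic a b c) (tangency_point t) (tangency_type a b c t).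
Proof.
move=> T; rewrite /tangency_point; case: eqVneq => [z0|z0]; last first.
  apply: point_type_affine; rewrite rmorph0 add0r /tangency_type.
  case: eqP => [c0|/eqP c0].
    have [n nE n0] := tangency_triple T c0.
    exact: (germ_at_tangency (local_coordinatesXY K) T z0 nE n0).
  have [n nE n0] := tangency_simple T c0.
  exact: (germ_at_tangency (local_coordinatesXY K) T z0 nE n0).
apply: point_type_infinity.
have tE : t = -1 by apply/eqP; rewrite -addr_eq0; apply/eqP.
rewrite tE in T *; have [a1 b6] := proj1 (tangency_atN1 a b c) T.
(* The point [t = -1] lies at infinity; the symmetry moves it to [t = 1], where the affine
   computation applies. *)
have T' : tangency c (- b) a 1 by apply/(tangency_at1 c (- b) a); rewrite b6 a1.
have cE : section_curvature a b c (-1) = section_curvature c (- b) a 1.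
  by rewrite /section_curvature /param_x /param_z a1 b6; ring.
have z1 : param_z (1 : K) != 0 by rewrite /param_z -mulr2n pnatr_eq0.
have x1 : param_x (1 : K) = 0 by rewrite /param_x subrr mulr0.
have gE : affine_germ c (- b) a 0 (- pserY K) (pserX K) =
  sextic_form (pserC c) (pserC (- b)) (pserC a)
    (pserC (param_x 1 / param_z 1) + - pserY K) (pserX K) 1.
  by rewrite /affine_germ x1 mul0r !rmorph0 !add0r.
rewrite gE /tangency_type cE; case: eqP => [c0|/eqP c0].
  have [n nE n0] := tangency_triple T' c0.
  exact: (germ_at_tangency (local_coordinatesYNX K) T' z1 nE n0).
have [n nE n0] := tangency_simple T' c0.
exact: (germ_at_tangency (local_coordinatesYNX K) T' z1 nE n0).
Qed.

(** Two parameters with the same point have the same [x / z]. Given [t1 t2 = - p^2], the cross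
    difference of their coordinates is [(t1 - t2) p (p^2 + 3 p + 1)], which is nonzero for two
    distinct tangencies. *)
Lemma tangency_point_inj a b c t1 t2 : tangency a b c t1 -> tangency a b c t2 ->
  (tangency_point t1 == tangency_point t2)%MS -> t1 = t2.
Proof.
move=> T1 T2; have [t10 t20] : t1 != 0 /\ t2 != 0 by case: T1; case: T2.
have over t : tangency a b c t -> over_tangency a b c (tangency_point t).
  move=> T; have [t0 _ _] := T; have [l l0 ->] := tangency_pointE t0.
  by exists l, t; rewrite row3_scale mulr0 !row3E.
have v0 := over_tangency_neq0 (over t1 T1).
move=> /(rV_eqP _ v0) [k k0]; have [l1 l10 ->] := tangency_pointE t10.
have [l2 l20 ->] := tangency_pointE t20; rewrite !row3_scale => e.
have := congr1 (fun v : 'rV[K]_3 => v 0 2) e.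
have := congr1 (fun v : 'rV[K]_3 => v 0 0) e; rewrite !row3E => ex ez.
have cross : param_x t1 * param_z t2 = param_x t2 * param_z t1.
  apply: (mulfI l10); rewrite mulrA ex.
  transitivity (param_x t2 * (k * (l2 * param_z t2))); first by ring.
  by rewrite -ez; ring.
have [//|t12] := eqVneq t1 t2; exfalso.
have [qE AE _ _ _] := two_tangencies t12 T1 T2.
set p := - (t1 + t2) in qE AE; have [_ _ D0] := double_tangency_neq0 AE.
have : (t1 - t2) * (p * (p ^+ 2 + 3 * p + 1)) = 0.
  transitivity (param_x t1 * param_z t2 - param_x t2 * param_z t1
     - (t1 - t2) * ((t1 * t2 + p ^+ 2) * (t1 + t2 - 2))).
    by rewrite /p /param_x /param_z; ring.
  by rewrite cross qE; ring.
apply/eqP; rewrite !mulf_neq0 ?subr_eq0 //.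
apply: contra_neq t10 => p0; move: qE; rewrite p0 expr0n oppr0 => /eqP.
by rewrite mulf_eq0 (negPf t20) orbF => /eqP.
Qed.

Lemma enumerates_over_tangency a b c (ts : seq K) : uniq ts ->
  (forall t, tangency a b c t <-> t \in ts) ->
  enumerates (sextic a b c) (over_tangency a b c) (map tangency_point ts)
    (map (tangency_type a b c) ts).
Proof.
move=> uts tsP; split.
- by rewrite !size_map.
- rewrite pairwise_map; apply: (@sub_in_pairwise _ (mem ts) (fun x y => x != y)).
  + move=> x y /tsP Tx /tsP Ty /= /eqP xy; apply/negP => h.
    exact/xy/(tangency_point_inj Tx Ty).
  + exact/allP.
  + by rewrite -uniq_pairwise.
- move=> v /mapP[t /tsP T ->]; have [t0 _ _] := T.
  have [l l0 ->] := tangency_pointE t0.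
  by exists l, t; rewrite row3_scale mulr0 !row3E.
- move=> v vT; have v0 := over_tangency_neq0 vT; case: vT => l [t [l0 T vx vy vz]].
  rewrite has_map; apply/hasP; exists t; first exact/tsP.
  have [t0 _ _] := T; have [k k0 tE] := tangency_pointE t0.
  rewrite /= tE; apply/(rV_eqP _ v0); exists (l / k).
    by rewrite mulf_neq0 ?invr_eq0.
  rewrite scalerA divfK // row3_scale mulr0.
  by rewrite [LHS]row3_eta vx vy vz.
move=> n; rewrite size_map => nts.
rewrite (nth_map 0) // (nth_map 0) //.
by apply: point_type_tangency; apply/tsP; exact: mem_nth.
Qed.

End TangencyPoints.

(** * Invariants of the types *)

Section Restriction.
Variable K : numClosedFieldType.
Variables al be : K.
Implicit Types (s t u g X Y : pser K).

(* Coefficient of [tau ^ m] in [s(al tau, be tau)]. *)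
Definition rho s m : K := \sum_(k < m.+1) s k (m - k)%N * (al ^+ k * be ^+ (m - k)).

Definition line_poly (p : {poly {poly K}}) : {poly K} :=
  (map_poly (comp_poly (be *: 'X)) p).[al *: 'X].

Lemma coef_comp_scaleX (q : {poly K}) (e : K) j :
  (q \Po (e *: 'X))`_j = q`_j * e ^+ j.
Proof.
rewrite comp_polyE coef_sum.
under eq_bigr => i _ do rewrite coefZ exprZn coefZ coefXn.
have [jq|jq] := ltnP j (size q).
  rewrite (bigD1 (Ordinal jq)) //= eqxx mulr1 big1 ?addr0 // => i ij.
  by rewrite -val_eqE /= eq_sym in ij; rewrite (negPf ij) !mulr0.
rewrite nth_default // mul0r big1 // => i _.
by rewrite gtn_eqF ?mulr0 //; apply: leq_trans jq.
Qed.

Lemma coef_line_poly (p : {poly {poly K}}) m :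
  (line_poly p)`_m = \sum_(k < m.+1) p`_k`_(m - k) * (al ^+ k * be ^+ (m - k)).
Proof.
rewrite /line_poly.
have sz : (size (map_poly (comp_poly (be *: 'X)) p) <= maxn (size p) m.+1)%N.
  by apply: leq_trans (size_poly _ _) _; exact: leq_maxl.
rewrite (horner_coef_wide _ sz) coef_sum.
have mN : (m.+1 <= maxn (size p) m.+1)%N by exact: leq_maxr.
rewrite [RHS](big_ord_widen _ (fun k => p`_k`_(m - k) * (al ^+ k * be ^+ (m - k))) mN).
rewrite [RHS]big_mkcond; apply: eq_bigr => k _.
rewrite coef_map_id0 ?comp_poly0 // exprZn -scalerAr coefZ coefMXn ltnNge.
rewrite [X in _ = if X then _ else _]ltnS; case: leqP => km /=; last by rewrite mulr0.
by rewrite coef_comp_scaleX mulrCA.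
Qed.

Lemma line_polyM p q : line_poly (p * q) = line_poly p * line_poly q.
Proof. by rewrite /line_poly rmorphM hornerM. Qed.

Lemma rho_truncation N s m : (m < N)%N -> rho s m = (line_poly (truncation N s))`_m.
Proof.
move=> mN; rewrite coef_line_poly; apply: eq_bigr => k _.
rewrite coef_truncation //; first by apply: leq_trans mN.
exact: leq_ltn_trans (leq_subr _ _) mN.
Qed.

Lemma rhoM s t m : rho (s * t) m = \sum_(k < m.+1) rho s k * rho t (m - k).
Proof.
transitivity (line_poly (truncation m.+1 s * truncation m.+1 t))`_m.
  rewrite coef_line_poly; apply: eq_bigr => k _.
  by rewrite -(@series_mul_truncation _ m.+1) // ltnS leq_subr.
rewrite line_polyM coefM; apply: eq_bigr => k _.
by rewrite -!rho_truncation // ltnS leq_subr.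
Qed.

Lemma rhoD s t m : rho (s + t) m = rho s m + rho t m.
Proof.
by rewrite /rho -big_split /=; apply: eq_bigr => k _; rewrite pserD mulrDl.
Qed.

Lemma rho0 s : rho s 0 = s 0%N 0%N.
Proof. by rewrite /rho big_ord1 !expr0 !mulr1. Qed.

Lemma rho1 s : rho s 1 = s 1%N 0%N * al + s 0%N 1%N * be.
Proof.
rewrite /rho !big_ord_recl big_ord0 /= addr0 addrC.
by rewrite !expr0 !expr1 mul1r mulr1.
Qed.

Lemma rho2 s : rho s 2 =
  s 2%N 0%N * al ^+ 2 + s 1%N 1%N * (al * be) + s 0%N 2%N * be ^+ 2.
Proof.
transitivity (s 0%N 2%N * (al ^+ 0 * be ^+ 2) + (s 1%N 1%N * (al ^+ 1 * be ^+ 1)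
  + s 2%N 0%N * (al ^+ 2 * be ^+ 0))).
  by rewrite /rho !big_ord_recl big_ord0 addr0.
by ring.
Qed.

Definition vanishes n s := forall m, (m < n)%N -> rho s m = 0.

Lemma vanishesW n m s : (m <= n)%N -> vanishes n s -> vanishes m s.
Proof. by move=> mn h k km; apply: h; apply: leq_trans mn. Qed.

Lemma vanishesM n m s t : vanishes n s -> vanishes m t ->
  vanishes (n + m) (s * t) /\ rho (s * t) (n + m) = rho s n * rho t m.
Proof.
move=> sn tm; split=> [k kn|].
  rewrite rhoM big1 // => i _; case: (ltnP i n) => [/sn ->|ni].
    by rewrite mul0r.
  rewrite tm ?mulr0 //; have := ltn_ord i; rewrite ltnS => ik.
  by rewrite ltn_subLR // (leq_trans kn) // leq_add2r.
have nn : (n < (n + m).+1)%N by rewrite ltnS leq_addr.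
rewrite rhoM (bigD1 (Ordinal nn)) //= addKn big1 ?addr0 // => i.
rewrite -val_eqE /= neq_ltn => /orP[/sn ->|ni]; first by rewrite mul0r.
rewrite tm ?mulr0 //; have := ltn_ord i; rewrite ltnS => ik.
by rewrite ltn_subLR // ltn_add2r.
Qed.

Lemma vanishesD n s t : vanishes n s -> vanishes n t -> vanishes n (s + t).
Proof. by move=> sn tn m mn; rewrite rhoD sn // tn // addr0. Qed.

Lemma vanishes0 s : vanishes 0 s. Proof. by []. Qed.

Lemma vanishes1 s : s 0%N 0%N = 0 -> vanishes 1 s.
Proof. by move=> s0 [|//] _; rewrite rho0. Qed.

Lemma vanishesX n m s : vanishes n s ->
  vanishes (m * n) (s ^+ m) /\ rho (s ^+ m) (m * n) = rho s n ^+ m.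
Proof.
move=> sn; elim: m => [|m [IH1 IH2]].
  by split; [exact: vanishes0 | rewrite mul0n rho0].
by rewrite exprS mulSn; have [h1 h2] := vanishesM sn IH1; rewrite h2 IH2 exprS.
Qed.

Lemma vanishesS n s : vanishes n.+1 s <-> vanishes n s /\ rho s n = 0.
Proof.
split=> [h|[h1 h2] m]; first by split; [exact: vanishesW h | exact: h].
by rewrite ltnS leq_eqVlt => /orP[/eqP->|/h1].
Qed.

Lemma vanishes_unit n u s : series_unit u -> vanishes n (u * s) <-> vanishes n s.
Proof.
move=> uu; split=> [h|h]; last first.
  by have [] := vanishesM (vanishes0 u) h.
have [v [cv v0 uv]] := unit_inverse uu.
have [] := vanishesM (vanishes0 v) h.
by rewrite mulrA [v * u]mulrC uv mul1r.
Qed.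

End Restriction.

Section RestrictedGerms.
Variable K : numClosedFieldType.
Implicit Types (s t u g X Y : pser K) (al be : K).

Lemma germ_AE p (g : pser K) : germ_A p g -> exists X Y u : pser K,
  [/\ local_coordinates X Y, series_unit u & g = u * (X ^+ 2 + Y ^+ p.+1)].
Proof.
move=> [X [Y [u [lc uu gE]]]]; exists X, Y, u; split=> //.
by apply: series_ext => i j; rewrite gE -!series_expE.
Qed.

Lemma linear_direction X Y (r1 r2 : K) : local_coordinates X Y ->
  exists al be, rho al be X 1 = r1 /\ rho al be Y 1 = r2.
Proof.
move=> [_ _ _ _]; move: (X 1%N 0%N) (X 0%N 1%N) (Y 1%N 0%N) (Y 0%N 1%N)
  (fun al be => rho1 al be X) (fun al be => rho1 al be Y) => x1 x2 y1 y2 rX rY d0.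
exists ((r1 * y2 - r2 * x2) / (x1 * y2 - x2 * y1)),
  ((r2 * x1 - r1 * y1) / (x1 * y2 - x2 * y1)).
by rewrite rX rY; split; field.
Qed.

Lemma rho_det X Y (a1 b1 a2 b2 : K) :
  rho a1 b1 X 1 * rho a2 b2 Y 1 - rho a2 b2 X 1 * rho a1 b1 Y 1 =
  (a1 * b2 - a2 * b1) * (X 1%N 0%N * Y 0%N 1%N - X 0%N 1%N * Y 1%N 0%N).
Proof. by rewrite !rho1; ring. Qed.

(** The quadratic term along a direction is [X^2 + Y^2] of the linear parts; its zeros are the
    directions [(1, i)] and [(1, -i)] in these coordinates, and [(1, 0)] is not one. *)
Lemma vanishes_A1 (g : pser K) : germ_A 1 g -> exists a1 b1 a2 b2 a3 b3,
  [/\ a1 * b2 - a2 * b1 != 0, vanishes a1 b1 3 g, vanishes a2 b2 3 g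
    & ~ vanishes a3 b3 3 g].
Proof.
move=> /germ_AE [X [Y [u [lc uu gE]]]]; have [_ _ X0 Y0 d0] := lc.
have key al be : vanishes al be 3 g <->
    rho al be X 1 ^+ 2 + rho al be Y 1 ^+ 2 = 0.
  rewrite gE vanishes_unit // vanishesS rhoD.
  have [x2 ->] := vanishesX 2 (vanishes1 al be X0).
  have [y2 ->] := vanishesX 2 (vanishes1 al be Y0).
  by split=> [[]|] //; split=> //; exact: vanishesD.
have [a1 [b1 [x1 y1]]] := linear_direction 1 'i lc.
have [a2 [b2 [x2 y2]]] := linear_direction 1 (- 'i) lc.
have [a3 [b3 [x3 y3]]] := linear_direction 1 0 lc.
exists a1, b1, a2, b2, a3, b3; split.
- have := rho_det X Y a1 b1 a2 b2; rewrite x1 x2 y1 y2 => e.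
  suff : (a1 * b2 - a2 * b1) * (X 1%N 0%N * Y 0%N 1%N - X 0%N 1%N * Y 1%N 0%N) != 0.
    by rewrite mulf_eq0 negb_or => /andP[].
  rewrite -e !mul1r -opprD oppr_eq0 -mulr2n mulrn_eq0 /=.
  exact: neq0Ci.
- by apply/key; rewrite x1 y1 sqrCi expr1n subrr.
- by apply/key; rewrite x2 y2 sqrrN sqrCi expr1n subrr.
by move/key; rewrite x3 y3 expr0n expr1n addr0 => /eqP; rewrite oner_eq0.
Qed.

(** The quadratic term is the square of the linear part of [X]. On the tangent line [X ^+ 2] has
    order at least 4, so the order of [Y ^+ p.+1] decides: it is exactly 3 for [p = 2] and at least
    4 beyond. *)
Lemma vanishes_A p (g : pser K) : germ_A p g -> (1 < p)%N ->
  exists l1 l2 : K, [/\ (l1 != 0) || (l2 != 0),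
    forall al be, vanishes al be 3 g <-> l1 * al + l2 * be = 0
  & if p == 2 then exists al be, vanishes al be 3 g /\ ~ vanishes al be 4 g
    else forall al be, vanishes al be 3 g -> vanishes al be 4 g].
Proof.
move=> /germ_AE [X [Y [u [lc uu gE]]]] p1; have [_ _ X0 Y0 d0] := lc.
exists (X 1%N 0%N), (X 0%N 1%N).
have Yp al be : vanishes al be p.+1 (Y ^+ p.+1) /\
    rho al be (Y ^+ p.+1) p.+1 = rho al be Y 1 ^+ p.+1.
  by have := vanishesX p.+1 (vanishes1 al be Y0); rewrite muln1.
have key al be : vanishes al be 3 g <-> rho al be X 1 = 0.
  rewrite gE vanishes_unit // vanishesS rhoD.
  have [x2 ->] := vanishesX 2 (vanishes1 al be X0).
  have [yp _] := Yp al be; rewrite (yp 2%N) // addr0.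
  split=> [[_ /eqP]|xz]; first by rewrite expf_eq0 => /eqP.
  split; last by rewrite xz expr0n.
  by apply: vanishesD => //; apply: vanishesW yp; exact: ltnW.
have X4 al be : rho al be X 1 = 0 -> vanishes al be 4 (X ^+ 2).
  move=> xz; have v2 : vanishes al be 2 X.
    by apply/vanishesS; split=> //; exact: vanishes1.
  by have [] := vanishesX 2 v2.
split.
- apply: contraNT d0; rewrite negb_or !negbK => /andP[/eqP-> /eqP->].
  by rewrite !mul0r subrr.
- by move=> al be; rewrite key rho1.
case: eqP => [p2|/eqP p2].
  have [al [be [x1 y1]]] := linear_direction 0 1 lc.
  exists al, be; split; first exact/key.
  rewrite gE vanishes_unit // => /vanishesS[_]; rewrite rhoD (X4 _ _ x1) // add0r.
  have [_] := Yp al be; rewrite p2 => ->; rewrite y1 expr1n => /eqP.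
  by rewrite oner_eq0.
move=> al be /key xz; rewrite gE vanishes_unit //; apply: vanishesD.
  exact: X4.
have [yp _] := Yp al be; apply: vanishesW yp.
by rewrite ltnS ltn_neqAle eq_sym p2.
Qed.

Lemma double_tangent_rho (g : pser K) (l1 l2 al be : K) :
  germ_A 2 g -> double_tangent g l1 l2 ->
  vanishes al be 2 g /\ rho al be g 2 = (l1 * al + l2 * be) ^+ 2.
Proof.
move=> /germ_AE [X [Y [u [[_ _ X0 Y0 _] uu gE]]]] [g20 g11 g02]; split.
  rewrite gE vanishes_unit //; apply: vanishesD.
    by have [] := vanishesX 2 (vanishes1 al be X0).
  by have [h _] := vanishesX 3 (vanishes1 al be Y0); exact: vanishesW h.
by rewrite rho2 g20 g11 g02; ring.
Qed.

(** The quartic term is the product of the squares of the two tangent forms, so contact 5 occurs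
    along the kernels of these forms. *)
Lemma vanishes_Y11 (g : pser K) : germ_Y11 g ->
  (forall al be, vanishes al be 4 g) /\
  exists a1 b1 a2 b2, [/\ a1 * b2 - a2 * b1 != 0, vanishes a1 b1 5 g
                        & vanishes a2 b2 5 g].
Proof.
move=> [g1 [g2 [gE A1 A2 [l1 [m1 [l2 [m2 [T1 T2 d0]]]]]]]].
have {}gE : g = (g1 : pser K) * (g2 : pser K).
  by apply: series_ext => i j; rewrite gE.
have key al be : vanishes al be 4 g /\ rho al be g 4 =
    (l1 * al + m1 * be) ^+ 2 * (l2 * al + m2 * be) ^+ 2.
  have [v1 r1] := double_tangent_rho al be A1 T1.
  have [v2 r2] := double_tangent_rho al be A2 T2.
  by have [v r] := vanishesM v1 v2; rewrite gE r r1 r2.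
split=> [al be|]; first by have [] := key al be.
exists m1, (- l1), m2, (- l2); split.
- rewrite (_ : _ - _ = l1 * m2 - l2 * m1) //.
  by ring.
- apply/vanishesS; have [v ->] := key m1 (- l1); split=> //.
  by rewrite (_ : l1 * m1 + _ = 0); [rewrite expr0n mul0r | ring].
- apply/vanishesS; have [v ->] := key m2 (- l2); split=> //.
  by rewrite (_ : l2 * m2 + _ = 0); [rewrite expr0n mulr0 | ring].
Qed.

Lemma rho_sum al be (I : Type) (r : seq I) (P : pred I) (f : I -> pser K) m :
  rho al be (\sum_(i <- r | P i) f i) m = \sum_(i <- r | P i) rho al be (f i) m.
Proof.
apply: (big_morph (fun s => rho al be s m)); first by move=> s t; exact: rhoD.
by rewrite /rho big1 // => k _; rewrite pser0 mul0r.
Qed.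

Lemma germ_W12E (g : pser K) : germ_W12 g -> exists X Y h : pser K,
  [/\ local_coordinates X Y, semiquasihomogeneous_4_5 h
    & g =2 series_comp h X Y].
Proof. by move=> [X [Y [h [lc _ hh gE]]]]; exists X, Y, h. Qed.

(** The weight condition leaves [X ^+ 4] as the only monomial of degree at most 4, so contact 5
    forces the linear part of [X] to vanish on the direction. *)
Lemma vanishes_W12 (g : pser K) : germ_W12 g ->
  (forall al be, vanishes al be 4 g) /\
  exists l1 l2 : K, [/\ (l1 != 0) || (l2 != 0)
    & forall al be, vanishes al be 5 g -> l1 * al + l2 * be = 0].
Proof.
move=> /germ_W12E [X [Y [h [lc [h0 h40 _] gE]]]]; have [_ _ X0 Y0 d0] := lc.
have gE' al be m : rho al be g m = \sum_(k < m.+1) \sum_(l < m.+1)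
    h k l * rho al be (X ^+ k * Y ^+ l) m.
  rewrite {1}/rho; under eq_bigr => i _.
    have -> : g i (m - i)%N = (\sum_(k < m.+1) \sum_(l < m.+1)
        pserC (h k l) * (X ^+ k * Y ^+ l)) i (m - i)%N.
      rewrite gE series_compE subnKC; last by rewrite -ltnS.
      have sE (J : Type) (r : seq J) (F : J -> pser K) i' j' :
          (\sum_(k <- r) F k) i' j' = \sum_(k <- r) F k i' j'.
        by elim: r => [|k r IH]; rewrite ?big_nil // !big_cons pserD IH.
      rewrite sE; apply: eq_bigr => k _; rewrite sE; apply: eq_bigr => l _.
      by rewrite pserCM.
    over.
  rewrite -/(rho al be _ m) rho_sum; apply: eq_bigr => k _.
  rewrite rho_sum; apply: eq_bigr => l _.
  rewrite /rho mulr_sumr; apply: eq_bigr => i _.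
  by rewrite pserCM -[LHS]mulrA.
have mono al be k l : vanishes al be (k + l) (X ^+ k * Y ^+ l).
  have [xk _] := vanishesX k (vanishes1 al be X0).
  have [yl _] := vanishesX l (vanishes1 al be Y0).
  by have [] := vanishesM xk yl; rewrite !muln1.
have v4 al be : vanishes al be 4 g.
  move=> m m4; rewrite gE' big1 // => k _; rewrite big1 // => l _.
  have [klm|mkl] := leqP (k + l) m; last by rewrite (mono al be k l) ?mulr0.
  rewrite h0 ?mul0r //; apply: (@leq_ltn_trans (5 * (k + l))).
    by rewrite mulnDr leq_add2l leq_mul2r orbT.
  by rewrite (@leq_ltn_trans (5 * m)) ?leq_mul2l ?klm ?orbT // (@ltn_pmul2l 5 m 4).
split=> //; exists (X 1%N 0%N), (X 0%N 1%N); split.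
  apply: contraNT d0; rewrite negb_or !negbK => /andP[/eqP-> /eqP->].
  by rewrite !mul0r subrr.
move=> al be /vanishesS[_]; rewrite gE' (bigD1 (@Ordinal 5 4 isT)) //=.
rewrite (bigD1 (@Ordinal 5 0 isT)) //= expr0 mulr1.
have -> : rho al be (X ^+ 4) 4 = rho al be X 1 ^+ 4.
  by have [_] := vanishesX 4 (vanishes1 al be X0).
rewrite big1 ?addr0 => [|l l0]; last first.
  rewrite (mono al be 4 l) ?mulr0 //; move: l0; rewrite -val_eqE /=.
  by case: (nat_of_ord l).
rewrite big1 ?addr0 => [|k k4].
  move=> /eqP; rewrite mulf_eq0 (negPf h40) /= expf_eq0 /= => /eqP <-.
  by rewrite rho1.
rewrite big1 // => l _.
have [klm|mkl] := leqP (k + l) 4; last by rewrite (mono al be k l) ?mulr0.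
rewrite h0 ?mul0r //.
have k3 : (k < 4)%N.
  by rewrite -val_eqE /= in k4; rewrite ltn_neqAle k4 -ltnS ltn_ord.
have -> : (5 * k + 4 * l = k + 4 * (k + l))%N by rewrite mulnDr addnA -mulSn.
by rewrite -[20%N]/(4 + 4 * 4)%N -addSn leq_add // leq_mul2l.
Qed.

End RestrictedGerms.

(** * Contact with lines in homogeneous coordinates *)

Section Contact.
Variable K : numClosedFieldType.
Variables a b c : K.
Implicit Types (v u w : 'rV[K]_3) (k al be : K).

Definition line_equation v u : {poly K} :=
  sextic_form a%:P b%:P c%:P ((v 0 0)%:P + u 0 0 *: 'X)
    ((v 0 1)%:P + u 0 1 *: 'X) ((v 0 2)%:P + u 0 2 *: 'X).

(** Contact at [v] with the line through [v] and [u]; it is defined on homogeneous vectors in order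
    to compare types found in different charts. *)
Definition contact v u n := forall m, (m < n)%N -> (line_equation v u)`_m = 0.

Lemma contactW v u n m : (m <= n)%N -> contact v u n -> contact v u m.
Proof. by move=> mn h k km; apply: h; apply: leq_trans mn. Qed.

Lemma horner_line_equation v u s : (line_equation v u).[s] =
  sextic_form a b c (v 0 0 + u 0 0 * s) (v 0 1 + u 0 1 * s) (v 0 2 + u 0 2 * s).
Proof.
rewrite -[_.[s]]/(horner_eval s _) (rmorph_sextic (horner_eval s)) /=.
by rewrite /horner_eval !(hornerD, hornerZ, hornerC, hornerX).
Qed.

Lemma sextic_form_scale k x y z : sextic_form a b c (k * x) (k * y) (k * z) =
  k ^+ 6 * sextic_form a b c x y z.
Proof.
by rewrite /sextic_form conic_form_scale exprMn -mulrDr trigonal_form_scale.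
Qed.

Lemma contact_scale v u k n : k != 0 -> contact v u n -> contact (k *: v) u n.
Proof.
move=> k0 h m mn.
have -> : line_equation (k *: v) u =
    k ^+ 6 *: (line_equation v u \Po (k^-1 *: 'X)).
  apply: (@poly_eq_away _ _ _ 0) => s _.
  rewrite hornerZ horner_comp !horner_line_equation -sextic_form_scale !mxE.
  by rewrite hornerZ hornerX; congr sextic_form; field.
by rewrite coefZ coef_comp_scaleX h // mul0r mulr0.
Qed.

Lemma coef0_cancel (p q : {poly K}) n : p`_0 != 0 ->
  (forall m, (m < n)%N -> (p * q)`_m = 0) -> forall m, (m < n)%N -> q`_m = 0.
Proof.
move=> p0 pq m; have [d] := ubnP m; elim: d m => // d IH m md mn.
have := pq m mn; rewrite coefM big_ord_recl subn0 big1 ?addr0 => [/eqP|i _].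
  by rewrite mulf_eq0 (negPf p0) => /eqP.
rewrite IH ?mulr0 //; last by apply: leq_ltn_trans mn; exact: leq_subr.
rewrite ltnS in md; apply: leq_trans md; rewrite ltn_subrL /=.
exact: leq_ltn_trans (ltn_ord i).
Qed.

Lemma clear_projective_denominators (p : {poly K}) k : exists d (q : {poly K}),
  forall s, 1 + k * s != 0 -> q.[s] = (1 + k * s) ^+ d * p.[s / (1 + k * s)].
Proof.
elim/poly_ind: p => [|p e [d [q qE]]].
  by exists 0%N, 0 => t _; rewrite !horner0 mulr0.
exists d.+1, (q * 'X + e%:P * (1 + k *: 'X) ^+ d.+1) => t zt.
rewrite !(hornerD, hornerM, horner_exp, hornerC, hornerX, hornerZ).
by rewrite qE // exprS; field.
Qed.

(** Adding a multiple of [v] to [u] keeps the line and substitutes [s / (1 + k s)] for its parameter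
    [s], up to the unit factor [(1 + k s)^6]. *)
Lemma contact_shift v u k n : contact v u n -> contact v (u + k *: v) n.
Proof.
move=> h; have [-> | k0] := eqVneq k 0; first by rewrite scale0r addr0.
have [q0 lE] : exists q0, line_equation v u = q0 * 'X^n.
  exists (drop_poly n (line_equation v u)).
  rewrite -[LHS](poly_take_drop n) (_ : take_poly n _ = 0) ?add0r //.
  apply/polyP => m; rewrite coef_take_poly coef0; case: ifP => // mn.
  exact: h.
have [d [q qE]] := clear_projective_denominators q0 k.
apply: (@coef0_cancel ((1 + k *: 'X) ^+ (n + d))).
  by rewrite -horner_coef0 horner_exp !(hornerD, hornerC, hornerZ, hornerX) mulr0
    addr0 expr1n oner_eq0.
have -> : (1 + k *: 'X) ^+ (n + d) * line_equation v (u + k *: v) =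
    (1 + k *: 'X) ^+ 6 * q * 'X^n.
  apply: (@poly_eq_away _ _ _ (- k^-1)) => s sk.
  have s0 : 1 + k * s != 0.
    apply: contraNneq sk => e; apply/eqP/(mulfI k0).
    by rewrite mulrN mulfV //; apply/eqP; rewrite -addr_eq0 addrC e.
  rewrite [LHS]hornerM horner_line_equation.
  rewrite !(hornerM, horner_exp, hornerXn, hornerD, hornerC, hornerZ, hornerX) qE //.
  have -> : sextic_form a b c (v 0 0 + (u + k *: v) 0 0 * s)
      (v 0 1 + (u + k *: v) 0 1 * s) (v 0 2 + (u + k *: v) 0 2 * s) =
      (1 + k * s) ^+ 6 * (line_equation v u).[s / (1 + k * s)].
    rewrite horner_line_equation -sextic_form_scale !mxE.
    by congr sextic_form; field.
  rewrite lE hornerM hornerXn exprD.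
  have -> : (s / (1 + k * s)) ^+ n = s ^+ n / (1 + k * s) ^+ n.
    by rewrite expr_div_n.
  have sn : (1 + k * s) ^+ n != 0 by rewrite expf_neq0.
  move: (q0.[_]) (s ^+ n) ((1 + k * s) ^+ d) => A E D.
  by move: ((1 + k * s) ^+ n) sn => B B0; move: (1 + k * s) => C; field.
by move=> m mn; rewrite coefMXn mn.
Qed.

Definition restricts al be (s : pser K) (p : {poly K}) :=
  forall m, rho al be s m = p`_m.

Lemma restrictsD al be s t p q : restricts al be s p -> restricts al be t q ->
  restricts al be (s + t) (p + q).
Proof. by move=> sp tq m; rewrite rhoD sp tq coefD. Qed.

Lemma restrictsM al be s t p q : restricts al be s p -> restricts al be t q ->
  restricts al be (s * t) (p * q).
Proof.
by move=> sp tq m; rewrite rhoM coefM; apply: eq_bigr => k _; rewrite sp tq.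
Qed.

Lemma restrictsC al be e : restricts al be (pserC e) e%:P.
Proof.
move=> m; rewrite coefC /rho big_ord_recl /= big1 ?addr0 => [|k _].
  rewrite subn0 /pserC /=; case: eqP => [->|_]; last by rewrite mul0r.
  by rewrite !mulr1.
by rewrite /pserC /= mul0r.
Qed.

Lemma restricts_nat al be n : restricts al be n%:R n%:R.
Proof.
rewrite -(rmorph_nat (@pserC K)) -(rmorph_nat (@polyC K)); exact: restrictsC.
Qed.

Lemma restrictsN al be s p : restricts al be s p -> restricts al be (- s) (- p).
Proof.
move=> sp; rewrite -mulN1r -[- p]mulN1r -(rmorphN1 (@pserC K)) -(rmorphN1 (@polyC K)).
by apply: restrictsM => //; exact: restrictsC.
Qed.

Lemma restrictsX al be s p n : restricts al be s p ->
  restricts al be (s ^+ n) (p ^+ n).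
Proof.
move=> sp; elim: n => [|n IH]; first exact: (restricts_nat al be 1).
by rewrite !exprS; apply: restrictsM.
Qed.

Ltac restrict := try assumption; lazymatch goal with
  | |- restricts _ _ (GRing.add _ _) _ => apply: restrictsD; restrict
  | |- restricts _ _ (GRing.opp _) _ => apply: restrictsN; restrict
  | |- restricts _ _ (GRing.mul _ _) _ => apply: restrictsM; restrict
  | |- restricts _ _ (GRing.exp _ _) _ => apply: restrictsX; restrict
  | |- restricts _ _ (GRing.natmul _ _) _ => exact: restricts_nat
  | |- restricts _ _ (pserC _) _ => exact: restrictsC
  end.

Lemma restricts_sextic al be X Y Z x y z : restricts al be X x ->
  restricts al be Y y -> restricts al be Z z ->
  restricts al be (sextic_form (pserC a) (pserC b) (pserC c) X Y Z)
    (sextic_form a%:P b%:P c%:P x y z).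
Proof.
move=> hX hY hZ.
by rewrite /sextic_form /trigonal_form /conic_form; restrict.
Qed.

Lemma restricts_coord al be (j : 'I_2) :
  restricts al be (germ_coords K j) ((if j == 0 then al else be) *: 'X).
Proof.
move=> m; rewrite coefZ coefX /germ_coords -[ord0]/(0 : 'I_2).
case: m => [|[|m]].
- by rewrite rho0 mulr0; case: ifP.
- by rewrite rho1 mulr1; case: ifP => _;
    rewrite /pserX /pserY /= !(mul1r, mul0r) ?addr0 ?add0r.
rewrite mulr0 /rho big1 // => k _; case: ifP => _; rewrite /pserX /pserY.
  case: k => -[|[|k]] //= km; rewrite ?subn0 ?subSS ?subn0 /= ?mul0r //.
case: k => -[|k] //= km; rewrite ?mul0r ?subn0 //.
Qed.

Definition chart_direction (i : 'I_3) al be : 'rV[K]_3 :=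
  \row_k (if unlift i k is Some j then (if j == 0 :> 'I_2 then al else be) else 0).

Lemma vanishes_chart (i : 'I_3) v al be n : v 0 i != 0 ->
  vanishes al be n (germ_of (local_equation (sextic a b c) i v)) <->
  contact ((v 0 i)^-1 *: v) (chart_direction i al be) n.
Proof.
move=> vi; rewrite sexticE /local_equation; set lq := [tuple _ | _ < _].
have co (k : 'I_3) : restricts al be (germ_of (tnth lq k))
    ((((v 0 i)^-1 *: v) 0 k)%:P + chart_direction i al be 0 k *: 'X).
  rewrite /lq tnth_mktuple rmorphD /= germ_ofC !mxE [v 0 k / _]mulrC.
  apply: restrictsD; first exact: restrictsC.
  case: unlift => [j|]; first by rewrite germ_ofX; exact: restricts_coord.
  by rewrite rmorph0 scale0r; exact: (restricts_nat al be 0).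
have h := restricts_sextic (co 0) (co 1) (co 2).
rewrite germ_of_comp /vanishes /contact /line_equation.
by split=> h' m /h'; rewrite (h m).
Qed.

Lemma chart_coordinates (i : 'I_3) v u : v 0 i != 0 ->
  exists al be k, u = chart_direction i al be + k *: v.
Proof.
move=> vi; pose k := u 0 i / v 0 i; pose u' := u - k *: v.
exists (u' 0 (lift i 0)), (u' 0 (lift i 1)), k.
apply/rowP => j; rewrite !mxE; case: unliftP => [l ->|->]; last first.
  by rewrite add0r /k divfK.
have [->|->] : l = 0 \/ l = 1.
  by case: l => -[|[|//]] h; [left|right]; apply: val_inj.
all: by rewrite /= subrK.
Qed.

(** The bridge from the germ in an arbitrary chart to homogeneous contact, through which the local
    computations yield invariants of the point. *)
Lemma contact_chart (i : 'I_3) v al be k n : v 0 i != 0 ->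
  contact v (chart_direction i al be + k *: v) n <->
  vanishes al be n (germ_of (local_equation (sextic a b c) i v)).
Proof.
move=> vi; rewrite vanishes_chart //; split=> h.
  have := contact_shift (- k) h; rewrite scaleNr addrK.
  by apply: contact_scale; rewrite invr_eq0.
apply: contact_shift; rewrite -[v](scalerKV vi); exact: contact_scale.
Qed.

End Contact.

Section Invariants.
Variable K : numClosedFieldType.
Variables a b c : K.
Implicit Types (v u w : 'rV[K]_3) (k al be : K).

Definition independent v u1 u2 := forall x y z : K,
  x *: u1 + y *: u2 + z *: v = 0 -> [/\ x = 0, y = 0 & z = 0].

(* A node has two tangent lines, of contact at least 3; a cusp has one, of
   contact exactly 3, whereas the tangent at [A_p], [p >= 3], has contact at
   least 4. The quadruple points [Y11] and [W12] have two tangents and one. *)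
Definition two_directions n v := exists u1 u2,
  [/\ independent v u1 u2, contact a b c v u1 n & contact a b c v u2 n].

(** At a nonzero [v] this expresses multiplicity at least [n]. *)
Definition all_directions n v := forall u, contact a b c v u n.

Definition is_node v := two_directions 3 v /\ ~ all_directions 3 v.

Definition is_cusp v := [/\ ~ two_directions 3 v, ~ all_directions 3 v
  & exists u, contact a b c v u 3 /\ ~ contact a b c v u 4].

Definition is_Y11 v := all_directions 4 v /\ two_directions 5 v.

Definition is_W12 v := all_directions 4 v /\ ~ two_directions 5 v.

Lemma contact_scaleP v u k n : k != 0 ->
  contact a b c (k *: v) u n <-> contact a b c v u n.
Proof.
move=> k0; split=> h; last exact: contact_scale.
by rewrite -[v](scalerK k0); apply: contact_scale; rewrite // invr_eq0.
Qed.

Lemma two_directions_scale n v k : k != 0 ->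
  two_directions n v -> two_directions n (k *: v).
Proof.
move=> k0 [u1 [u2 [i12 h1 h2]]]; exists u1, u2.
split; [| exact/contact_scaleP | exact/contact_scaleP].
move=> x y z; rewrite scalerA => /i12[x0 y0 /eqP].
by rewrite mulf_eq0 (negPf k0) orbF => /eqP.
Qed.

Lemma two_directions_scaleP n v k : k != 0 ->
  two_directions n (k *: v) <-> two_directions n v.
Proof.
move=> k0; split=> h; last exact: two_directions_scale.
by rewrite -[v](scalerK k0); apply: two_directions_scale; rewrite // invr_eq0.
Qed.

Lemma all_directions_scaleP n v k : k != 0 ->
  all_directions n (k *: v) <-> all_directions n v.
Proof. by move=> k0; split=> h u; have := h u; rewrite contact_scaleP. Qed.

Section Chart.
Variables (i : 'I_3) (v : 'rV[K]_3).
Hypothesis vi : v 0 i != 0.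
Let g : pser K := germ_of (local_equation (sextic a b c) i v).

Lemma chart_direction_comb x y (a1 b1 a2 b2 : K) :
  x *: chart_direction i a1 b1 + y *: chart_direction i a2 b2 =
  chart_direction i (x * a1 + y * a2) (x * b1 + y * b2).
Proof.
apply/rowP => j; rewrite !mxE; case: unlift => [l|]; first by case: eqP.
by rewrite !mulr0 addr0.
Qed.

Lemma chart_direction_eq0 al be z :
  chart_direction i al be + z *: v = 0 -> [/\ al = 0, be = 0 & z = 0].
Proof.
move=> e; have z0 : z = 0.
  have := congr1 (fun u : 'rV[K]_3 => u 0 i) e; rewrite !mxE unlift_none add0r.
  by move/eqP; rewrite mulf_eq0 (negPf vi) orbF => /eqP.
rewrite z0 scale0r addr0 in e; split=> //.
  by have := congr1 (fun u : 'rV[K]_3 => u 0 (lift i 0)) e; rewrite !mxE liftK.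
by have := congr1 (fun u : 'rV[K]_3 => u 0 (lift i 1)) e; rewrite !mxE liftK.
Qed.

Lemma all_directions_chart n :
  all_directions n v <-> forall al be, vanishes al be n g.
Proof.
split=> [h al be|h u].
  by apply/(contact_chart a b c al be 0 n vi); exact: h.
have [al [be [k ->]]] := chart_coordinates u vi.
exact/(contact_chart a b c al be k n vi).
Qed.

Lemma two_directions_chart n : two_directions n v <->
  exists a1 b1 a2 b2, [/\ a1 * b2 - a2 * b1 != 0, vanishes a1 b1 n g
                        & vanishes a2 b2 n g].
Proof.
split=> [[u1 [u2 [ind h1 h2]]]|[a1 [b1 [a2 [b2 [d0 h1 h2]]]]]].
  have [a1 [b1 [k1 e1]]] := chart_coordinates u1 vi.
  have [a2 [b2 [k2 e2]]] := chart_coordinates u2 vi.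
  rewrite e1 in h1; rewrite e2 in h2.
  exists a1, b1, a2, b2; split; last 2 first.
  - exact/(contact_chart a b c a1 b1 k1 n vi).
  - exact/(contact_chart a b c a2 b2 k2 n vi).
  apply/eqP => d0.
  have comb x y : x * a1 + y * a2 = 0 -> x * b1 + y * b2 = 0 -> x = 0 /\ y = 0.
    move=> ea eb; have [] := ind x y (- (x * k1 + y * k2)) _.
      rewrite e1 e2 !scalerDr addrACA chart_direction_comb ea eb.
      rewrite !scalerA -scalerDl -addrA -scalerDl addrN scale0r addr0.
      apply/rowP => j; rewrite !mxE; case: unlift => // l.
      by case: eqP.
    by [].
  have [b20 b10] : b2 = 0 /\ - b1 = 0.
    by apply: comb; [rewrite -d0; ring | ring].
  have [a20 a10] : a2 = 0 /\ - a1 = 0.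
    by apply: comb; [ring | rewrite -oppr0 -d0; ring].
  have a10' : a1 = 0 by rewrite -[a1]opprK a10 oppr0.
  have b10' : b1 = 0 by rewrite -[b1]opprK b10 oppr0.
  have [/eqP] : (1 : K) = 0 /\ (0 : K) = 0.
    by apply: comb; rewrite ?a10' ?b10' ?mulr0 ?mul0r addr0.
  by rewrite oner_eq0.
exists (chart_direction i a1 b1), (chart_direction i a2 b2); split.
- move=> x y z; rewrite chart_direction_comb => /chart_direction_eq0[ea eb ->].
  split=> //; apply: (mulIf d0); rewrite mul0r.
    by transitivity ((x * a1 + y * a2) * b2 - (x * b1 + y * b2) * a2); [ring | rewrite ea eb !mul0r subrr].
  by transitivity ((x * b1 + y * b2) * a1 - (x * a1 + y * a2) * b1); [ring | rewrite ea eb !mul0r subrr].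
- by have := proj2 (contact_chart a b c a1 b1 0 n vi) h1; rewrite scale0r addr0.
- by have := proj2 (contact_chart a b c a2 b2 0 n vi) h2; rewrite scale0r addr0.
Qed.

Lemma kernel_det (l1 l2 a1 b1 a2 b2 : K) : (l1 != 0) || (l2 != 0) ->
  l1 * a1 + l2 * b1 = 0 -> l1 * a2 + l2 * b2 = 0 -> a1 * b2 - a2 * b1 = 0.
Proof.
move=> l0 e1 e2; case/orP: l0 => l0; apply: (mulfI l0); rewrite mulr0.
  transitivity ((l1 * a1 + l2 * b1) * b2 - (l1 * a2 + l2 * b2) * b1); first by ring.
  by rewrite e1 e2 !mul0r subrr.
transitivity ((l1 * a2 + l2 * b2) * a1 - (l1 * a1 + l2 * b1) * a2); first by ring.
by rewrite e1 e2 !mul0r subrr.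
Qed.

Lemma no_two_directions n (l1 l2 : K) : (l1 != 0) || (l2 != 0) ->
  (forall al be, vanishes al be n g -> l1 * al + l2 * be = 0) ->
  ~ two_directions n v.
Proof.
move=> l0 h /two_directions_chart[a1 [b1 [a2 [b2 [/eqP d0 /h h1 /h h2]]]]].
exact/d0/(kernel_det l0 h1 h2).
Qed.

Lemma not_all_directions n (l1 l2 : K) : (l1 != 0) || (l2 != 0) ->
  (forall al be, vanishes al be n g -> l1 * al + l2 * be = 0) ->
  ~ all_directions n v.
Proof.
move=> l0 h /all_directions_chart al; case/orP: l0 => /eqP; apply.
  by have := h _ _ (al 1 0); rewrite mulr1 mulr0 addr0.
by have := h _ _ (al 0 1); rewrite mulr1 mulr0 add0r.
Qed.

End Chart.

Lemma all_directionsW n m v : (m <= n)%N ->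
  all_directions n v -> all_directions m v.
Proof. by move=> mn h u; apply: contactW (h u). Qed.

(* The number of singular points and the classes that are present tell the
   strata apart, so [A 4] and [A 9] need not be distinguished. *)
Definition type_class (T : singularity) : nat :=
  match T with A 1 => 1 | A 2 => 2 | A _ => 3 | Y11 => 4 | W12 => 5 end.

(** [A 0] is a smooth germ; [type_class] would put it into the class of [A 4]. *)
Definition occurring_type (T : singularity) : bool :=
  if T is A p then (0 < p)%N else true.

Definition class_spec (n : nat) v : Prop :=
  match n with
  | 1 => is_node v
  | 2 => is_cusp v
  | 4 => is_Y11 v
  | 5 => is_W12 v
  | _ => ~ (is_node v \/ is_cusp v \/ is_Y11 v \/ is_W12 v)
  end.

Lemma point_type_class v T : occurring_type T ->
  point_type (sextic a b c) v T -> class_spec (type_class T) v.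
Proof.
case: T => [p p0|_|_] [i vi] /=.
- set g := germ_of _ => gA; case: p p0 gA => [|[|p]] // _ gA.
    have [a1 [b1 [a2 [b2 [a3 [b3 [d0 h1 h2 h3]]]]]]] := vanishes_A1 gA.
    split; first by apply/(two_directions_chart vi); exists a1, b1, a2, b2.
    by move/(all_directions_chart vi)/(_ a3 b3).
  have [//|l1 [l2 [l0 lE h]]] := vanishes_A gA.
  have n2 : ~ two_directions 3 v.
    by apply: (no_two_directions vi l0) => al be /lE.
  have nall : ~ all_directions 3 v.
    by apply: (not_all_directions vi l0) => al be /lE.
  case: p gA h => [|p] gA /= h.
    split=> //; case: h => al [be [h3 h4]].
    exists (chart_direction i al be + 0 *: v).
    split; first by apply/(contact_chart a b c al be 0 3 vi).
    by move/(contact_chart a b c al be 0 4 vi).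
  case=> [|[|[]]].
  - by case.
  - case=> _ _ [u]; have [al [be [k ->]]] := chart_coordinates u vi.
    case=> /(contact_chart a b c al be k 3 vi) /h h4; apply.
    exact/(contact_chart a b c al be k 4 vi).
  - by case=> /(all_directionsW (isT : (3 <= 4)%N)).
  - by case=> /(all_directionsW (isT : (3 <= 4)%N)).
- move=> gY; have [h4 h5] := vanishes_Y11 gY; split.
    exact/(all_directions_chart vi).
  exact/(two_directions_chart vi).
move=> gW; have [h4 [l1 [l2 [l0 h5]]]] := vanishes_W12 gW; split.
  exact/(all_directions_chart vi).
exact: (no_two_directions vi l0 h5).
Qed.

Lemma class_spec_unique m n v : (0 < m <= 5)%N -> (0 < n <= 5)%N ->
  class_spec m v -> class_spec n v -> m = n.
Proof.
have W := @all_directionsW 4 3 v isT.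
have nc : is_node v -> is_cusp v -> False by case=> h _ [].
have nY : is_node v -> is_Y11 v -> False by case=> _ h [/W].
have nW : is_node v -> is_W12 v -> False by case=> _ h [/W].
have cY : is_cusp v -> is_Y11 v -> False by case=> _ h _ [/W].
have cW : is_cusp v -> is_W12 v -> False by case=> _ h _ [/W].
have YW : is_Y11 v -> is_W12 v -> False by case=> _ h [_ []].
by case: m => [|[|[|[|[|[|m]]]]]] //; case: n => [|[|[|[|[|[|n]]]]]] // _ _;
  rewrite /class_spec; tauto.
Qed.

Lemma class_spec_scale n v k : k != 0 -> class_spec n (k *: v) -> class_spec n v.
Proof.
move=> k0; have D m := propext (two_directions_scaleP m v k0).
have L m := propext (all_directions_scaleP m v k0).
have C : is_cusp (k *: v) = is_cusp v.
  rewrite /is_cusp D L; congr and3; apply: eq_exists => u.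
  by rewrite !(propext (contact_scaleP v u _ k0)).
by case: n => [|[|[|[|[|[|n]]]]]]; rewrite /class_spec ?C;
  rewrite /is_node /is_Y11 /is_W12 ?D ?L.
Qed.

Lemma type_class_bound T : (0 < type_class T <= 5)%N.
Proof. by case: T => [[|[|[|p]]]| |]. Qed.

(** The specification of each class uses contact only, which is unchanged by rescaling [v], and
    distinct classes exclude each other. *)
Lemma equivalent_point_types v w T T' : v != 0 -> (v == w)%MS ->
  occurring_type T -> occurring_type T' ->
  point_type (sextic a b c) v T -> point_type (sextic a b c) w T' ->
  type_class T = type_class T'.
Proof.
move=> v0 /(rV_eqP _ v0) [k k0 vE] oT oT' /(point_type_class oT) h.
move=> /(point_type_class oT') h'.
apply: class_spec_unique (type_class_bound _) (type_class_bound _) _ h'.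
by apply: class_spec_scale k0 _; rewrite -vE.
Qed.

End Invariants.

(** * The strata *)

Section SpecialTangencies.
Variable K : numClosedFieldType.
Implicit Types a b c t : K.

(** For [c = 1 / 2] and [b = 3], [N = t^4 (A (t - 1)^2 - 6)] with [A = 1 / 2 - a], which has no
    nonzero double root. *)
Lemma tangency_zero_b a b c t : c = 1 / 2 -> tangency a b c t -> b != 3.
Proof.
move=> cE [t0 N0 dN0]; apply/eqP => bE.
have e : (1 / 2 - a) * (t - 1) = 0.
  apply: (mulfI (expf_neq0 5 t0)); rewrite mulr0.
  transitivity ((t * section_slope a b c t - 4 * section_value a b c t) / 2).
    rewrite /section_slope /section_value /conic_form /param_Y /param_x /param_z.
    by rewrite cE bE; field.
  by rewrite N0 dN0 !mulr0 subrr mul0r.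
have : t ^+ 4 * 6 = 0.
  transitivity (t ^+ 4 * (t - 1) * ((1 / 2 - a) * (t - 1)) - section_value a b c t).
    by rewrite /section_value /conic_form /param_Y /param_x /param_z cE bE; field.
  by rewrite e N0 mulr0 subrr.
by apply/eqP; rewrite mulf_neq0 ?expf_neq0 ?pnatr_eq0.
Qed.

(** For [a = 1 / 2] and [b = - 3], [N = C (t + 1)^2 - 6 t^2] with [C = 1 / 2 - c]; a double root
    could only be [t = 0]. *)
Lemma tangency_infinity_b a b c t : a = 1 / 2 -> tangency a b c t -> - b != 3.
Proof.
move=> aE [t0 N0 dN0]; rewrite eqr_oppLR; apply/eqP => bE.
have e : (1 / 2 - c) * (t + 1) = 0.
  transitivity (section_value a b c t - t * section_slope a b c t / 2).
    rewrite /section_slope /section_value /conic_form /param_Y /param_x /param_z.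
    by rewrite aE bE; field.
  by rewrite N0 dN0 mulr0 mul0r subrr.
have : t ^+ 2 * 6 = 0.
  transitivity ((t + 1) * ((1 / 2 - c) * (t + 1)) - section_value a b c t).
    by rewrite /section_value /conic_form /param_Y /param_x /param_z aE bE; field.
  by rewrite e N0 mulr0 subrr.
by apply/eqP; rewrite mulf_neq0 ?expf_neq0 ?pnatr_eq0.
Qed.

(** Here [N = t^2 ((b - 3) - (b + 3) t^2)], whose nonzero roots are simple. *)
Lemma tangency_zero_infinity a b c t :
  a = 1 / 2 -> c = 1 / 2 -> ~ tangency a b c t.
Proof.
move=> aE cE [t0 N0 dN0].
have bE : b = - 3.
  apply/eqP; rewrite -addr_eq0; apply/eqP/(mulfI (expf_neq0 4 t0)); rewrite mulr0.
  transitivity (section_value a b c t - t * section_slope a b c t / 2).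
    rewrite /section_slope /section_value /conic_form /param_Y /param_x /param_z.
    by rewrite aE cE; field.
  by rewrite N0 dN0 mulr0 mul0r subrr.
have /eqP[] : - b != 3 by apply: tangency_infinity_b aE _; split; eassumption.
by rewrite bE opprK.
Qed.

Lemma two_tangencies_not_A9 a b c t1 t2 : t1 != t2 -> tangency a b c t1 ->
  tangency a b c t2 -> ~ cond_A9 a b c.
Proof.
move=> t12 T1 T2; have [qE AE cE _ _] := two_tangencies t12 T1 T2.
have [A0 _ _] := double_tangency_neq0 AE.
have p0 : - (t1 + t2) != 0.
  have [t10 _ _] := T1; have [t20 _ _] := T2.
  have := mulf_neq0 t10 t20; rewrite qE; apply: contra_neq => ->.
  by rewrite expr0n oppr0.
case=> [c2|a2]; last by rewrite a2 subrr eqxx in A0.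
have /eqP := mulf_neq0 A0 (expf_neq0 5 p0); apply.
by apply: (addrI (1 / 2)); rewrite -cE addr0.
Qed.

End SpecialTangencies.

Section Strata.
Variable K : numClosedFieldType.
Variables a b c : K.
Let F : {mpoly K[3]} := sextic a b c.

Definition types_over_zero :=
  if c == 1 / 2 then [:: cusp_type a b] else nseq 2 (A 4).

Definition types_over_infinity :=
  if a == 1 / 2 then [:: cusp_type c (- b)] else nseq 2 (A 4).

Lemma eqmx_rV_sym (v w : 'rV[K]_3) : (v == w)%MS = (w == v)%MS.
Proof. by rewrite andbC. Qed.

Lemma has_set_zero_first (ts : seq K) : uniq ts ->
  (forall t, tangency a b c t <-> t \in ts) ->
  has_set_of_singularities F (types_over_zero ++ types_over_infinity
                              ++ map (tangency_type a b c) ts).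
Proof.
move=> uts tE; have [P0 e0] := enumerates_over_zero a b c.
have [P1 e1] := enumerates_over_infinity a b c.
have e2 := enumerates_over_tangency uts tE.
exists (P0 ++ P1 ++ map (@tangency_point K) ts).
have e12 := enumerates_cat (@over_infinity_tangency K a b c) e1 e2.
apply: enumerates_eq (enumerates_cat _ e0 e12) => [v|v w v0 [w1|w1]].
- by rewrite singular_point_regions.
- exact: over_zero_infinity v0 w1.
- exact: over_zero_tangency v0 w1.
Qed.

(** The lists of types are ordered and begin with the most degenerate point, which may lie over
    either A_4 point; hence both orders are provided. *)
Lemma has_set_infinity_first (ts : seq K) : uniq ts ->
  (forall t, tangency a b c t <-> t \in ts) ->
  has_set_of_singularities F (types_over_infinity ++ types_over_zero
                              ++ map (tangency_type a b c) ts).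
Proof.
move=> uts tE; have [P0 e0] := enumerates_over_zero a b c.
have [P1 e1] := enumerates_over_infinity a b c.
have e2 := enumerates_over_tangency uts tE.
exists (P1 ++ P0 ++ map (@tangency_point K) ts).
have e02 := enumerates_cat (@over_zero_tangency K a b c) e0 e2.
apply: enumerates_eq (enumerates_cat _ e1 e02) => [v|v w v1 [w0|w2]].
- by rewrite singular_point_regions; tauto.
- by rewrite eqmx_rV_sym; exact: over_zero_infinity w0 v1.
- exact: over_infinity_tangency v1 w2.
Qed.

Definition tangent := exists t, tangency a b c t.
Definition bitangent :=
  exists t1 t2, [/\ t1 != t2, tangency a b c t1 & tangency a b c t2].
Definition osculating :=
  exists t, tangency a b c t /\ section_curvature a b c t = 0.

Lemma bitangent_not_osculating : bitangent -> ~ osculating.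
Proof.
move=> [t1 [t2 [t12 T1 T2]]] [t [T /eqP]]; apply/negP.
have [<-|t1t] := eqVneq t1 t; first exact: two_tangencies_curvature t12 T1 T2.
by apply: (two_tangencies_curvature _ T T1); rewrite eq_sym.
Qed.

Lemma bitangent_not_A9 : bitangent -> ~ cond_A9 a b c.
Proof. by move=> [t1 [t2 [t12 T1 T2]]]; exact: two_tangencies_not_A9 T1 T2. Qed.

Definition tangency_types :=
  if `[< bitangent >] then nseq 2 (A 1)
  else if `[< osculating >] then [:: A 2]
  else if `[< tangent >] then [:: A 1] else [::].

Lemma tangency_typesE : exists2 ts : seq K, uniq ts &
  (forall t, tangency a b c t <-> t \in ts) /\
  map (tangency_type a b c) ts = tangency_types.
Proof.
rewrite /tangency_types; case: asboolP => [bt|nb].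
  have := bitangent_not_osculating bt; have [t1 [t2 [t12 T1 T2]]] := bt => no.
  have no' t : tangency a b c t -> section_curvature a b c t == 0 = false.
    by move=> T; apply/negbTE/eqP => c0; apply: no; exists t.
  exists [:: t1; t2]; rewrite /= ?inE ?t12 //; split.
    move=> t; rewrite !inE; split=> [T|/orP[]/eqP-> //].
    have [//|tt1] := eqVneq t t1; have [//|tt2] := eqVneq t t2.
    by case: (no_three_tangencies _ _ t12 T T1 T2).
  by rewrite /tangency_type !no'.
have one t : tangency a b c t -> forall u, tangency a b c u <-> u \in [:: t].
  move=> T u; rewrite inE; split=> [U|/eqP-> //].
  by have [//|ut] := eqVneq u t; case: nb; exists u, t.
case: asboolP => [[t [T c0]]|no].
  by exists [:: t] => //; split; [exact: one | rewrite /= /tangency_type c0 eqxx].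
case: asboolP => [[t T]|nt]; last first.
  by exists [::] => //; split=> // t; split=> // T; case: nt; exists t.
exists [:: t] => //; split; first exact: one.
rewrite /= /tangency_type; case: eqP => // c0; by case: no; exists t.
Qed.

Lemma has_set_zero : has_set_of_singularities F
  (types_over_zero ++ types_over_infinity ++ tangency_types).
Proof.
have [ts uts [tE <-]] := tangency_typesE; exact: has_set_zero_first.
Qed.

Lemma has_set_infinity : has_set_of_singularities F
  (types_over_infinity ++ types_over_zero ++ tangency_types).
Proof.
have [ts uts [tE <-]] := tangency_typesE; exact: has_set_infinity_first.
Qed.

Definition open_stratum S :=
  cond S a b c /\ forall S', immediate_degeneration S S' -> ~ cond S' a b c.

Lemma tangent_A9 : tangent -> ~ (a = 1 / 2 /\ c = 1 / 2).
Proof. by case=> t T [a2 c2]; apply: tangency_zero_infinity a2 c2 T. Qed.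

Lemma osculating_tangent : osculating -> tangent.
Proof. by case=> t [T _]; exists t. Qed.

Lemma bitangent_tangent : bitangent -> tangent.
Proof. by case=> t [_ [_ T _]]; exists t. Qed.

Lemma tangency_types0 : ~ tangent -> tangency_types = [::].
Proof.
move=> nt; rewrite /tangency_types asboolF; last by move/bitangent_tangent.
by rewrite asboolF ?asboolF //; move/osculating_tangent.
Qed.

Lemma tangency_types1 : tangent -> ~ bitangent -> ~ osculating ->
  tangency_types = [:: A 1].
Proof. by move=> T nb no; rewrite /tangency_types (asboolF nb) (asboolF no) asboolT. Qed.

Lemma tangency_types2 : osculating -> tangency_types = [:: A 2].
Proof.
move=> T; rewrite /tangency_types asboolF; first by rewrite asboolT.
by move/bitangent_not_osculating.
Qed.

Lemma has_set_generic : ~ cond_A9 a b c ->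
  has_set_of_singularities F (nseq 4 (A 4) ++ tangency_types).
Proof.
move=> n; have := has_set_zero; rewrite /types_over_zero /types_over_infinity.
by do 2 (rewrite ifF; last by apply/negbTE/eqP => e; apply: n; rewrite /cond_A9; tauto).
Qed.

Lemma has_set_special (T : singularity) :
  [/\ c = 1 / 2, a <> 1 / 2 & cusp_type a b = T]
  \/ [/\ a = 1 / 2, c <> 1 / 2 & cusp_type c (- b) = T] ->
  has_set_of_singularities F (T :: nseq 2 (A 4) ++ tangency_types).
Proof.
have := has_set_infinity; have := has_set_zero.
rewrite /types_over_zero /types_over_infinity => h0 h1 [[e /eqP/negbTE ne <-]|[e /eqP/negbTE ne <-]].
  by move: h0; rewrite ne e eqxx.
by move: h1; rewrite ne e eqxx.
Qed.

Lemma has_set_A9_tangent : cond_A9 a b c -> tangent ->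
  has_set_of_singularities F (A 9 :: nseq 2 (A 4) ++ tangency_types).
Proof.
move=> h tg; have nb := tangent_A9 tg; have [t T] := tg.
apply: has_set_special; case: h => [c2|a2]; [left | right]; split=> //.
- by move=> a2; apply: nb.
- by rewrite /cusp_type (tangency_zero_b c2 T).
- by move=> c2; apply: nb.
by rewrite /cusp_type (tangency_infinity_b a2 T).
Qed.

Lemma opp_eq_opp3 : (- b == 3) = (b == - 3).
Proof. by rewrite eqr_oppLR. Qed.

Lemma three_neq_opp3 : (3 == - 3 :> K) = false.
Proof. by rewrite -addr_eq0 -natrD pnatr_eq0. Qed.

(** The equivalences of the conditions with tangency statements reduce each case to the types over
    the two A_4 points and those of the tangencies. Failure of the immediate degenerations excludes
    the worse types; the remaining coincidences, such as a bitangent section through an A_4 point,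
    are impossible. *)
Lemma open_stratum_has_set S :
  open_stratum S -> has_set_of_singularities F (singularities S).
Proof.
have tE := propext (cond_4A4_A1P a b c).
have oE := propext (cond_4A4_A2P a b c).
have stE := propext (cond_A9_2A4_A1P a b c).
have soE := propext (cond_A9_2A4_A2P a b c).
have btE := propext (cond_4A4_2A1P a b c).
rewrite /open_stratum => -[cS nS].
have N S' : immediate_degeneration S S' -> ~ cond S' a b c by exact: nS.
case: S cS N {nS} => cS N.
- by have := @has_set_generic (N S_A9_2A4 isT); rewrite tangency_types0 // -[tangent]tE; exact: N.
- have nt : ~ tangent by move=> T; apply: (N S_A9_2A4_A1 isT); rewrite stE.
  rewrite -[singularities _]/(A 9 :: nseq 2 (A 4) ++ [::]) -(tangency_types0 nt).
  have nb : ~ (a = 1 / 2 /\ c = 1 / 2) := N S_2A9 isT.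
  have nY : ~ ((c = 1 / 2 /\ b = 3) \/ (a = 1 / 2 /\ b = - 3)) := N S_Y11_2A4 isT.
  apply: has_set_special; rewrite /cusp_type opp_eq_opp3; case: cS => e; [left | right].
    by split=> [//|a2|]; [apply: nb | case: eqP => // b3; case: nY; left].
  by split=> [//|c2|]; [apply: nb | case: eqP => // b3; case: nY; right].
- have := has_set_zero; case: cS => aE cE.
  rewrite tangency_types0; last by move/tangent_A9; apply.
  have nY : ~ [/\ a = 1 / 2, c = 1 / 2 & b = 3 \/ b = - 3] := N S_Y11_A9 isT.
  rewrite /types_over_zero /types_over_infinity aE cE eqxx /cusp_type opp_eq_opp3.
  case: (b =P 3) => [b3|_]; first by case: nY; split=> //; left.
  by case: (b =P - 3) => [b3|_ //]; case: nY; split=> //; right.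
- have nt : ~ tangent.
    case=> t T; case: cS => -[e bE].
      by have := tangency_zero_b e T; rewrite bE eqxx.
    by have := tangency_infinity_b e T; rewrite bE opprK eqxx.
  rewrite -[singularities _]/(Y11 :: nseq 2 (A 4) ++ [::]) -(tangency_types0 nt).
  have nY : ~ [/\ a = 1 / 2, c = 1 / 2 & b = 3 \/ b = - 3] := N S_Y11_A9 isT.
  have nW : ~ ([/\ a = - (11 / 2), b = 3 & c = 1 / 2]
      \/ [/\ a = 1 / 2, b = - 3 & c = - (11 / 2)]) := N S_W12_2A4 isT.
  have half (x : K) : 2 * x + 11 = 0 -> x = - (11 / 2).
    move=> x0; transitivity ((2 * x + 11) / 2 - 11 / 2); first by field.
    by rewrite x0 mul0r sub0r.
  apply: has_set_special; rewrite /cusp_type opp_eq_opp3.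
  case: cS => -[e bE]; [left | right]; rewrite bE eqxx /=; split=> //.
  + by move=> a2; apply: nY; split=> //; left.
  + by case: eqP => // /half a11; case: nW; left.
  + by move=> c2; apply: nY; split=> //; right.
  by case: eqP => // /half c11; case: nW; right.
- case: cS => aE cE bE; have nt : ~ tangent by move/tangent_A9; apply.
  have two11 : 2 * (1 / 2) + 11 != 0 :> K.
    by rewrite (_ : _ + _ = 12%:R) ?pnatr_eq0 //; field.
  case: bE => bE; [have := has_set_zero | have := has_set_infinity];
    rewrite tangency_types0 // /types_over_zero /types_over_infinity aE cE eqxx;
    rewrite /cusp_type opp_eq_opp3 bE ?eqxx ?three_neq_opp3 ?two11 //=.
  by rewrite eq_sym three_neq_opp3.
- have nt : ~ tangent.
    case=> t T; case: cS => -[aE bE cE].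
      by have := tangency_zero_b cE T; rewrite bE eqxx.
    by have := tangency_infinity_b aE T; rewrite bE opprK eqxx.
  rewrite -[singularities _]/(W12 :: nseq 2 (A 4) ++ [::]) -(tangency_types0 nt).
  have n11 : - (11 / 2) <> 1 / 2 :> K.
    move=> /(congr1 (fun x => 1 / 2 - x)); rewrite subrr => /eqP.
    by rewrite (_ : _ - _ = 6%:R) ?pnatr_eq0 //; field.
  have e11 : 2 * - (11 / 2) + 11 == 0 :> K by apply/eqP; field.
  apply: has_set_special; rewrite /cusp_type opp_eq_opp3.
  by case: cS => -[-> -> ->]; [left | right]; rewrite !eqxx e11.
- have nA9 : ~ cond_A9 a b c.
    by move=> h; apply: (N S_A9_2A4_A1 isT); rewrite stE -tE.
  rewrite -[singularities _]/(nseq 4 (A 4) ++ [:: A 1]) -tangency_types1.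
  + exact: has_set_generic.
  + by rewrite /tangent -tE.
  + by rewrite /bitangent -btE; exact: N.
  by rewrite /osculating -oE; exact: N.
- move: cS; rewrite stE => -[h tg].
  rewrite -[singularities _]/(A 9 :: nseq 2 (A 4) ++ [:: A 1]) -tangency_types1 //.
  + exact: has_set_A9_tangent.
  + by move/bitangent_not_A9.
  by move=> o; apply: (N S_A9_2A4_A2 isT); rewrite soE.
- move: cS; rewrite btE -[ex _]/bitangent => bt.
  have := has_set_generic (bitangent_not_A9 bt).
  by rewrite /tangency_types asboolT.
- move: cS; rewrite oE -[ex _]/osculating => o.
  rewrite -[singularities _]/(nseq 4 (A 4) ++ [:: A 2]) -tangency_types2 //.
  by apply: has_set_generic => h; apply: (N S_A9_2A4_A2 isT); rewrite soE.
move: cS; rewrite soE => -[h o].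
rewrite -[singularities _]/(A 9 :: nseq 2 (A 4) ++ [:: A 2]) -tangency_types2 //.
exact/has_set_A9_tangent/osculating_tangent.
Qed.

(** The properties are tested from the more special to the more general, so that the degenerations
    of the stratum chosen have already been refuted. *)
Lemma open_stratum_exists : exists S, open_stratum S.
Proof.
have tE := propext (cond_4A4_A1P a b c).
have oE := propext (cond_4A4_A2P a b c).
have stE := propext (cond_A9_2A4_A1P a b c).
have soE := propext (cond_A9_2A4_A2P a b c).
have btE := propext (cond_4A4_2A1P a b c).
have bo := bitangent_not_osculating; have bA := bitangent_not_A9.
rewrite /open_stratum.
have [bt|nbt] := pselect bitangent.
  by exists S_4A4_2A1; rewrite btE; split=> // -[].
have [o|no] := pselect osculating.
  have [h|nh] := pselect (cond_A9 a b c).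
    by exists S_A9_2A4_A2; rewrite soE; split=> // -[].
  by exists S_4A4_A2; rewrite oE; split=> // -[] // _; rewrite soE; case.
have [t|nt] := pselect tangent.
  have [h|nh] := pselect (cond_A9 a b c).
    by exists S_A9_2A4_A1; rewrite stE; split=> // -[] // _; rewrite soE; case.
  by exists S_4A4_A1; rewrite tE; split=> // -[] // _; rewrite ?btE ?oE ?stE //; case.
have [h|nh] := pselect (cond_A9 a b c); last first.
  by exists S_4A4; split=> // -[] // _; rewrite tE.
have [Y|nY] := pselect (cond S_Y11_A9 a b c).
  by exists S_Y11_A9; split=> // -[].
have [W|nW] := pselect (cond S_W12_2A4 a b c).
  by exists S_W12_2A4; split=> // -[].
have [Y1|nY1] := pselect (cond S_Y11_2A4 a b c).
  by exists S_Y11_2A4; split=> // -[].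
have [A2|nA2] := pselect (cond S_2A9 a b c).
  by exists S_2A9; split=> // -[].
by exists S_A9_2A4; split=> // -[] // _; rewrite stE; case.
Qed.

End Strata.

(** * A sextic has the list of only one stratum *)

Section Signature.
Variable K : numClosedFieldType.
Variables a b c : K.
Let F : {mpoly K[3]} := sextic a b c.
Implicit Types (P Q : seq 'rV[K]_3) (S : seq singularity).

Lemma eqmx_rV_trans (u v w : 'rV[K]_3) : (u == v)%MS -> (v == w)%MS -> (u == w)%MS.
Proof. by move=> /eqmxP uv /eqmxP vw; apply/eqmxP/(eqmx_trans uv vw). Qed.

Lemma leq_size_points P P' : pairwise (fun v w => ~~ (v == w)%MS) P ->
  (forall v, v \in P -> has (fun w => (v == w)%MS) P') -> (size P <= size P')%N.
Proof.
move=> pP h; pose f (v : 'rV[K]_3) := find (fun w => (v == w)%MS) P'.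
rewrite -(size_map f) -(size_iota 0 (size P')); apply: uniq_leq_size.
  rewrite uniq_pairwise pairwise_map.
  apply: (sub_in_pairwise (P := mem P)) pP; last exact/allP.
  move=> v w /h hv /h hw; apply: contraNneq => e.
  have vE : (v == nth 0 P' (f v))%MS := nth_find 0 hv.
  have wE : (w == nth 0 P' (f w))%MS := nth_find 0 hw.
  by apply: (eqmx_rV_trans vE); rewrite e eqmx_rV_sym.
by move=> n /mapP[v /h hv ->]; rewrite mem_iota add0n -has_find.
Qed.

Lemma has_set_size S S' : has_set_of_singularities F S ->
  has_set_of_singularities F S' -> size S = size S'.
Proof.
move=> [P [<- pP aP cP _]] [Q [<- pQ aQ cQ _]]; apply/eqP; rewrite eqn_leq.
apply/andP; split; apply: leq_size_points => // v.
  by move/aP/cQ.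
by move/aQ/cP.
Qed.

(** The right side does not mention [S], so any two lists for one sextic show the same classes. *)
Lemma has_set_class k S : all occurring_type S -> has_set_of_singularities F S ->
  has (fun T => type_class T == k) S <-> exists v T,
    [/\ singular_point F v, occurring_type T, point_type F v T
       & type_class T = k].
Proof.
move=> oS [P [sP _ aP cP tP]]; split=> [/(has_nthP Y11)[n nS /eqP nk]|].
  exists (nth 0 P n), (nth Y11 S n); split=> //.
  - by apply/aP/mem_nth; rewrite sP.
  - exact: (all_nthP Y11 oS).
  by apply: tP; rewrite sP.
case=> v [T [vs oT vT <-]]; have [v0 _ _] := vs.
have /(has_nthP 0)[n nP vn] := cP v vs.
apply/(has_nthP Y11); exists n; first by rewrite -sP.
rewrite eq_sym; apply/eqP; apply: (equivalent_point_types v0 vn oT _ vT (tP _ nP)).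
by apply: (all_nthP Y11 oS); rewrite -sP.
Qed.

(** The number of points together with the presence of nodes, cusps, Y11 and W12 takes different
    values on all eleven strata. *)
Lemma has_set_inj (S T : stratum) :
  has_set_of_singularities F (singularities S) ->
  has_set_of_singularities F (singularities T) -> S = T.
Proof.
move=> hS hT; have s := has_set_size hS hT.
have o U : all occurring_type (singularities U) by case: U.
have cl k : has (fun U => type_class U == k) (singularities S)
          = has (fun U => type_class U == k) (singularities T).
  have eS := has_set_class k (o S) hS; have eT := has_set_class k (o T) hT.
  by apply/idP/idP => [/eS /eT|/eT /eS].
have c1 := cl 1%N; have c2 := cl 2%N; have c4 := cl 4%N; have c5 := cl 5%N.
by case: S T {hS hT cl} s c1 c2 c4 c5 => -[].
Qed.

End Signature.

Theorem mainTheorem4 (R : realType) (a b c : R[i]) (S : stratum) :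
  has_set_of_singularities (sextic a b c) (singularities S) <->
  cond S a b c /\
  (forall S' : stratum, immediate_degeneration S S' -> ~ cond S' a b c).
Proof.
split=> [h|]; last exact: open_stratum_has_set.
(* The parameters lie in some open stratum [S0], whose list the sextic has; uniqueness identifies it
   with [S]. *)
have [S0 o0] := open_stratum_exists a b c.
by rewrite (has_set_inj h (open_stratum_has_set o0)).
Qed.
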